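(* Assume Hypotheses (H1) and (H2) below, and let all objects be as defined in the context. Then there are constants $\eta, C, L_0>0$ such that, for every $L\geq L_0$ and every $\lambda\in\bar\Omega$, the boundary-value problems (BVP$^+_j$), $j=1,\ldots,r$, and (BVP$^-_j$), $j=1,\ldots,n-r$, defined below each have a unique solution, the matrices $\tilde C^\pm_L(\lambda)$ are uniquely determined, and \[ |\mathcal{E}(\lambda)-\tilde{\mathcal{E}}_L(\lambda)| + |\mathcal{C}_L(\lambda)-\tilde{\mathcal{C}}_L(\lambda)| \leq C\mathrm{e}^{-\eta L} \quad\text{and}\quad |E_L(\lambda)-\tilde E_L(\lambda)|\leq C\mathrm{e}^{-\eta L} \] for all $L\geq L_0$, uniformly in $\lambda\in\bar\Omega$. Furthermore, for each $L\geq L_0$, $\tilde E_L(\lambda)$ is analytic in $\lambda\in\Omega$.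
   Context: Consider the linear system $U_x=A(x,\lambda)U$, $U\in\mathbb{C}^n$, $x\in\mathbb{R}$. (H1): There are an open, bounded, simply connected set $\Omega\subset\mathbb{C}$, a continuous map $A:\mathbb{R}\times\bar\Omega\to\mathbb{C}^{n\times n}$ and continuous maps $A_\pm:\bar\Omega\to\mathbb{C}^{n\times n}$ such that (i) $A(x,\lambda)$ and $A_\pm(\lambda)$ are analytic in $\lambda\in\Omega$; (ii) $A(x,\lambda)\to A_\pm(\lambda)$ exponentially as $x\to\pm\infty$; (iii) $A_\pm(\lambda)$ are hyperbolic for $\lambda\in\bar\Omega$ and each has exactly $r$ eigenvalues, counted with multiplicity, with negative real part. (H2): The eigenvalues of $A_\pm(\lambda)$ are simple for all $\lambda\in\bar\Omega$. Notation: $\langle U,V\rangle:=U^*V$ with ${}^*$ the conjugate transpose; $\mathbb{I}$ is the identity. $P^s_\pm(\lambda)$ is the spectral projection of $A_\pm(\lambda)$ onto the eigenspace of eigenvalues with negative real part and $P^u_\pm(\lambda)=\mathbb{I}-P^s_\pm(\lambda)$. Let $\nu^+_1(\lambda),\ldots,\nu^+_n(\lambda)$ be the eigenvalues of $A_+(\lambda)$, ordered by increasing real part (so $\mathrm{Re}\,\nu^+_j<0$ iff $j\le r$), varying continuously in $\lambda\in\bar\Omega$, with continuously varying eigenvectors $V^+_j(\lambda)$ of $A_+(\lambda)$ for $\nu^+_j(\lambda)$ and $W^+_j(\lambda)$ of $A_+(\lambda)^*$ for $\overline{\nu^+_j(\lambda)}$. Likewise $\nu^-_1(\lambda),\ldots,\nu^-_n(\lambda)$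 are the eigenvalues of $A_-(\lambda)$ ordered by decreasing real part (so $\mathrm{Re}\,\nu^-_j>0$ iff $j\le n-r$), with continuously varying eigenvectors $V^-_j(\lambda)$ of $A_-(\lambda)$ and $W^-_j(\lambda)$ of $A_-(\lambda)^*$ (for $\overline{\nu^-_j(\lambda)}$). Exact Evans function: $E^s_+(y,\lambda)$ is the set of $U_0\in\mathbb{C}^n$ such that the solution with $U(y)=U_0$ tends to $0$ as $x\to\infty$; $E^u_-(y,\lambda)$ is defined analogously with $x\to-\infty$. Let $Z^+_1(\lambda),\ldots,Z^+_r(\lambda)$ be a basis of $\mathrm{Rg}\,P^s_+(\lambda)$ and $Z^-_1(\lambda),\ldots,Z^-_{n-r}(\lambda)$ a basis of $\mathrm{Rg}\,P^u_-(\lambda)$, analytic in $\lambda\in\Omega$ and continuous on $\bar\Omega$; $Z^\pm(\lambda)$ denote the matrices with these columns. For $L$ large, let $Z^+_j(L,\lambda)$ be the projection of $Z^+_j(\lambda)$ onto $E^s_+(L,\lambda)$ along $\mathrm{Rg}\,P^u_+(\lambda)$, and $Z^+_j(x,\lambda)$ the solution of $U_x=A(x,\lambda)U$ with this value at $x=L$; define $Z^-_j(-L,\lambda)$, $Z^-_j(x,\lambda)$ analogously using $E^u_-(-L,\lambda)$ and $\mathrm{Rg}\,P^s_-(\lambda)$. Set $E_L(\lambda):=\det(Z^-_1(0,\lambda),\ldots,Z^-_{n-r}(0,\lambda),Z^+_1(0,\lambda),\ldots,Z^+_r(0,\lambda))\,\mathrm{e}^{-\mathrm{tr}(A_-(\lambda)P^u_-(\lambda))L}\mathrm{e}^{\mathrm{tr}(A_+(\lambda)P^s_+(\lambda))L}$.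 Alternative formulation: for $j=1,\ldots,r$ let $V^+_j(x,\lambda)$, $x\ge0$, be a solution of $V_x=(A(x,\lambda)-\nu^+_j(\lambda)\mathbb{I})V$ depending continuously on $\lambda\in\bar\Omega$ with $V^+_j(x,\lambda)\to V^+_j(\lambda)$ as $x\to\infty$; for $j=1,\ldots,n-r$ let $V^-_j(x,\lambda)$, $x\le0$, be a solution of $V_x=(A(x,\lambda)-\nu^-_j(\lambda)\mathbb{I})V$ continuous in $\lambda$ with $V^-_j(x,\lambda)\to V^-_j(\lambda)$ as $x\to-\infty$. Let $V^\pm(x,\lambda)$ be the matrices with these columns. Define $\mathcal{E}(\lambda):=\det(V^-(0,\lambda),V^+(0,\lambda))$; let $C^+_L(\lambda)\in\mathbb{C}^{r\times r}$ and $C^-_L(\lambda)\in\mathbb{C}^{(n-r)\times(n-r)}$ be the unique matrices with $V^+(L,\lambda)C^+_L(\lambda)=(Z^+_1(L,\lambda),\ldots,Z^+_r(L,\lambda))$ and $V^-(-L,\lambda)C^-_L(\lambda)=(Z^-_1(-L,\lambda),\ldots,Z^-_{n-r}(-L,\lambda))$, and $\mathcal{C}_L(\lambda):=\det C^+_L(\lambda)\det C^-_L(\lambda)$. Algorithm: Fix $L$ and $\lambda\in\bar\Omega$. For $j=1,\ldots,r$ successively, (BVP$^+_j$) asks for $V=V^+_{L,j}(\cdot,\lambda)$ on $[0,L]$ with $V_x=(A(x,\lambda)-\nu^+_j(\lambda)\mathbb{I})V$ on $0<x<L$; $\langle V^+_{L,k}(0,\lambda),V(0)\rangle=0$ for $k=1,\ldots,j-1$;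 $\langle W^+_j(\lambda),V(L)\rangle=\langle W^+_j(\lambda),V^+_j(\lambda)\rangle$; $\langle W^+_k(\lambda),V(L)\rangle=0$ for $k=j+1,\ldots,n$. For $j=1,\ldots,n-r$ successively, (BVP$^-_j$) asks for $V=V^-_{L,j}(\cdot,\lambda)$ on $[-L,0]$ with $V_x=(A(x,\lambda)-\nu^-_j(\lambda)\mathbb{I})V$ on $-L<x<0$; $\langle V^-_{L,k}(0,\lambda),V(0)\rangle=0$ for $k<j$; $\langle W^-_j(\lambda),V(-L)\rangle=\langle W^-_j(\lambda),V^-_j(\lambda)\rangle$; $\langle W^-_k(\lambda),V(-L)\rangle=0$ for $k=j+1,\ldots,n$. Let $V^\pm_L(x,\lambda)$ be the matrices with columns $V^\pm_{L,j}(x,\lambda)$, and let $\tilde C^+_L(\lambda)$, $\tilde C^-_L(\lambda)$ solve $V^+_L(L,\lambda)\tilde C^+_L(\lambda)=Z^+(\lambda)$ and $V^-_L(-L,\lambda)\tilde C^-_L(\lambda)=Z^-(\lambda)$. Set $\tilde{\mathcal{E}}_L(\lambda):=\det(V^-_L(0,\lambda),V^+_L(0,\lambda))$, $\tilde{\mathcal{C}}_L(\lambda):=\det\tilde C^-_L(\lambda)\det\tilde C^+_L(\lambda)$ and $\tilde E_L(\lambda):=\tilde{\mathcal{E}}_L(\lambda)\tilde{\mathcal{C}}_L(\lambda)$. *)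

(* Defs.v *)
From HB Require Import structures.
From mathcomp Require Import all_boot all_order all_algebra.
From mathcomp Require Import all_classical all_reals all_analysis.
From mathcomp Require Export complex.
Import Order.TTheory GRing.Theory Num.Theory.
Import numFieldNormedType.Exports.

Set Implicit Arguments.
Unset Strict Implicit.
Unset Printing Implicit Defensive.

Local Open Scope ring_scope.
Local Open Scope classical_set_scope.

(* Standard (modulus) topology / normed structure on R[i], copied from the
   regular structure R[i]^o, as mathcomp-analysis does for numFieldTypes. *)
Section ComplexInstances.
Variable R : rcfType.
HB.instance Definition _ := GRing.ComAlgebra.copy R[i] R[i]^o.
HB.instance Definition _ := Vector.copy R[i] R[i]^o.
HB.instance Definition _ := PseudoPointedMetric.copy R[i] R[i]^o.
HB.instance Definition _ := NormedModule.copy R[i] R[i]^o.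
End ComplexInstances.

Section Defs.
Variable R : realType.
Local Notation C := R[i].

Definition reC (z : C) : R := complex.Re z.
Definition imC (z : C) : R := complex.Im z.
Definition rC (x : R) : C := (x%:C)%C.

Definition cexp (z : C) : C :=
  rC (expR (reC z)) * (rC (cos (imC z)) + 'i%C * rC (sin (imC z))).

Definition ctr m k (M : 'M[C]_(m, k)) : 'M[C]_(k, m) := (map_mx conjc M)^T.
Definition ip n (U V : 'cV[C]_n) : C := (ctr U *m V) 0 0.

Definition cols n k (f : 'I_k -> 'cV[C]_n) : 'M[C]_(n, k) :=
  \matrix_(i < n, j < k) f j i 0.

Definition detcat n r (hr : (r <= n)%N) (M : 'M[C]_(n, n - r)) (N : 'M[C]_(n, r)) : C :=
  \det (castmx (erefl n, subnK hr) (row_mx M N)).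

Definition has_deriv n (U : R -> 'cV[C]_n) (x : R) (d : 'cV[C]_n) : Prop :=
  ((rC h)^-1 *: (U (x + h) - U x)) @[h --> 0^'] --> d.

Definition simply_connected (O : set C) : Prop :=
  connected O /\
  forall g : R -> C,
    {within `[0, 1], continuous g} -> g @` `[0, 1] `<=` O -> g 0 = g 1 ->
    exists H : R * R -> C,
      {within `[0, 1] `*` `[0, 1], continuous H} /\
      H @` (`[0, 1] `*` `[0, 1]) `<=` O /\
      (forall s, s \in `[0, 1] -> H (s, 0) = g s) /\
      (forall t, t \in `[0, 1] -> H (0, t) = H (1, t)) /\
      (forall s, s \in `[0, 1] -> H (s, 1) = H (0, 1)).

Definition Es_plus n (A : R -> 'M[C]_n) (y : R) : set 'cV[C]_n :=
  [set U0 | exists U : R -> 'cV[C]_n,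
     (forall x, has_deriv U x (A x *m U x)) /\ U y = U0 /\
     U x @[x --> +oo] --> (0 : 'cV[C]_n)].

Definition Eu_minus n (A : R -> 'M[C]_n) (y : R) : set 'cV[C]_n :=
  [set U0 | exists U : R -> 'cV[C]_n,
     (forall x, has_deriv U x (A x *m U x)) /\ U y = U0 /\
     U x @[x --> -oo] --> (0 : 'cV[C]_n)].

(* Z^+_j(x,lambda), j < r (0-based): solution on R of U_x = A U whose value
   at L is the projection of the j-th column of Z onto E^s_+(L) along Rg(I - Ps) *)
Definition Zplus_def n r (A : R -> 'M[C]_n) (Ps : 'M[C]_n) (Z : 'M[C]_(n, r))
    (L : R) (Zx : 'I_r -> R -> 'cV[C]_n) : Prop :=
  forall j : 'I_r,
    (forall x, has_deriv (Zx j) x (A x *m Zx j x)) /\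
    Es_plus A L (Zx j L) /\
    exists w, (1%:M - Ps) *m w = Zx j L - col j Z.

Definition Zminus_def n m (A : R -> 'M[C]_n) (Pu : 'M[C]_n) (Z : 'M[C]_(n, m))
    (L : R) (Zx : 'I_m -> R -> 'cV[C]_n) : Prop :=
  forall j : 'I_m,
    (forall x, has_deriv (Zx j) x (A x *m Zx j x)) /\
    Eu_minus A (- L) (Zx j (- L)) /\
    exists w, (1%:M - Pu) *m w = Zx j (- L) - col j Z.

Definition bvp_plus n r (A : R -> 'M[C]_n) (nu : C) (Vj Wj : 'cV[C]_n)
    (W : 'I_n -> 'cV[C]_n) (j : nat) (prev : 'I_r -> 'cV[C]_n) (L : R)
    (V : R -> 'cV[C]_n) : Prop :=
  {within `[0, L], continuous V} /\
  (forall x, 0 < x < L -> has_deriv V x ((A x - nu%:M) *m V x)) /\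
  (forall k : 'I_r, (k < j)%N -> ip (prev k) (V 0) = 0) /\
  ip Wj (V L) = ip Wj Vj /\
  (forall k : 'I_n, (j < k)%N -> ip (W k) (V L) = 0).

Definition bvp_minus n m (A : R -> 'M[C]_n) (nu : C) (Vj Wj : 'cV[C]_n)
    (W : 'I_n -> 'cV[C]_n) (j : nat) (prev : 'I_m -> 'cV[C]_n) (L : R)
    (V : R -> 'cV[C]_n) : Prop :=
  {within `[- L, 0], continuous V} /\
  (forall x, - L < x < 0 -> has_deriv V x ((A x - nu%:M) *m V x)) /\
  (forall k : 'I_m, (k < j)%N -> ip (prev k) (V 0) = 0) /\
  ip Wj (V (- L)) = ip Wj Vj /\
  (forall k : 'I_n, (j < k)%N -> ip (W k) (V (- L)) = 0).

End Defs.

(* Main.v *)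
Require Import Defs.
From HB Require Import structures.
From mathcomp Require Import all_boot all_order fingroup perm all_algebra.
From mathcomp Require Import all_classical all_reals all_analysis.
From mathcomp Require Import complex ring lra.
Import Order.TTheory GRing.Theory Num.Theory.
Import numFieldNormedType.Exports.
Local Open Scope ring_scope.
Local Open Scope classical_set_scope.
Set Implicit Arguments.
Unset Strict Implicit.
Unset Printing Implicit Defensive.

(* On a half line, pass to the coordinates of the limiting eigenbasis. The r x r
   minors of a tuple of solutions V_j of V' = (A - nu_j) V satisfy a linear system
   whose diagonal rates are sums of r eigenvalues minus the sum of the r smallest
   ones, hence have nonnegative real part, and whose coupling is exponentially
   small. So the energy of the difference of two such minor vectors is, up to a
   bounded factor, monotone in x, and the minors at 0 are controlled by those at L,
   even where real parts of eigenvalues coincide. A Laplace expansion turns this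
   into the estimate for the Evans determinants.

   The boundary conditions make the approximate solutions a unitriangular
   Gram-Schmidt recombination of the solutions that at x = L span the limiting
   eigenspace; the recombination has determinant 1, so it does not affect minors.
   For the same reason the approximate Evans function is the determinant of the
   propagated bases Z times an exponential of eigenvalues, in which no Gram-Schmidt
   vector occurs. Its analyticity reduces to that of the propagator, a locally
   uniform limit of Euler products holomorphic in lambda; such limits are
   holomorphic by Goursat's theorem and Cauchy's estimate. *)

(** Single columns cannot be compared. A solution [V_j] with prescribed limit is determined only up
    to faster decaying modes, whose rates nu_k - nu_j have negative real part, so these modes grow
    when integrated from L back to 0. Minors of all r columns avoid both defects: adding multiples
    of earlier columns changes no minor, and among all minors the leading one has the smallest real
    rate, normalised to 0. The energy is quadratic in the minors, but its bound is only linear in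
    the coupling. The resulting square root is why the error decays at rate alpha / 2 although the
    coefficients converge at rate alpha. The obstacle to analyticity is twofold: the orthogonality
    conditions at 0 contain a complex conjugation, and the eigenvectors are merely continuous. The
    individual approximate solutions are therefore never claimed to be holomorphic; only the
    propagator, the bases Z and the eigenvalues are. All half-line results are stated for x >= 0 and
    eigenvalues of increasing real part, so that x -> -x, A -> -A carries them to the other half
    line. *)

(** * Modulus, real part and imaginary part of complex numbers *)

Section ComplexModulus.
Variable R : realType.
Local Notation C := R[i].
Implicit Types z w : C.

(** The norm of [R[i]] takes its values in [R[i]]; its real part is the modulus as an element of
    [R], where suprema, exponentials and derivatives live. *)
Definition cab z : R := complex.Re `|z|.

Lemma cabE z : `|z| = rC (cab z).
Proof. by rewrite /cab /rC; case: `|z| (ger0_Im (normr_ge0 z)) => a b /= ->. Qed.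

Lemma rC_le (x y : R) : (rC x <= rC y) = (x <= y). Proof. exact: lecR. Qed.
Lemma rC_lt (x y : R) : (rC x < rC y) = (x < y). Proof. exact: ltcR. Qed.
Lemma rCD (x y : R) : rC (x + y) = rC x + rC y. Proof. exact: rmorphD. Qed.
Lemma rCM (x y : R) : rC (x * y) = rC x * rC y. Proof. exact: rmorphM. Qed.
Lemma rC1 : rC 1 = 1 :> C. Proof. exact: rmorph1. Qed.
Lemma rC0 : rC 0 = 0 :> C. Proof. exact: rmorph0. Qed.
Lemma rCV (x : R) : rC x^-1 = (rC x)^-1. Proof. exact: fmorphV. Qed.

Lemma rC_gt0_ex (e : C) : 0 < e -> exists2 r : R, 0 < r & e = rC r.
Proof.
move=> e0; exists (complex.Re e); first by move: e0; rewrite ltcE => /andP[].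
by move: (gtr0_real e0) => /complex_realP[k ->].
Qed.

Lemma cab_ge0 z : 0 <= cab z.
Proof. by rewrite -rC_le -cabE rC0. Qed.
Lemma cab0 : cab 0 = 0. Proof. by rewrite /cab normr0. Qed.
Lemma cab1 : cab 1 = 1. Proof. by rewrite /cab normr1. Qed.
Lemma cabN z : cab (- z) = cab z. Proof. by rewrite /cab normrN. Qed.
Lemma cabB z w : cab (z - w) = cab (w - z). Proof. by rewrite /cab distrC. Qed.
Lemma cabM z w : cab (z * w) = cab z * cab w.
Proof. by apply: (@complexI R); rewrite -/(rC _) -cabE normrM !cabE -rCM. Qed.
Lemma cabD z w : cab (z + w) <= cab z + cab w.
Proof. by rewrite -rC_le rCD -!cabE ler_normD. Qed.
Lemma cabV z : cab z^-1 = (cab z)^-1.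
Proof. by apply: (@complexI R); rewrite -/(rC _) -cabE normfV cabE -rCV. Qed.
Lemma cab_eq0 z : (cab z == 0) = (z == 0).
Proof. by rewrite -(inj_eq (@complexI R)) -/(rC _) -cabE -[X in _ == X]/(rC 0) rC0 normr_eq0. Qed.
Lemma cab_gt0 z : (0 < cab z) = (z != 0).
Proof. by rewrite lt_def cab_eq0 cab_ge0 andbT. Qed.
Lemma cabX z k : cab (z ^+ k) = cab z ^+ k.
Proof. by elim: k => [|k IH]; rewrite ?expr0 ?cab1// !exprS cabM IH. Qed.
Lemma cab_rC (x : R) : cab (rC x) = `|x|.
Proof. by rewrite /cab /rC normc_def /= expr0n addr0 sqrtr_sqr. Qed.

Lemma cab_sum (I : finType) (P : pred I) (F : I -> C) :
  cab (\sum_(i | P i) F i) <= \sum_(i | P i) cab (F i).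
Proof.
elim/big_ind2: _ => //; first by rewrite cab0.
by move=> a b c d ab cd; apply: le_trans (cabD _ _) _; rewrite lerD.
Qed.
Lemma cab_prod (I : finType) (P : pred I) (F : I -> C) :
  cab (\prod_(i | P i) F i) = \prod_(i | P i) cab (F i).
Proof. by apply: (big_morph cab cabM cab1). Qed.

Lemma cab_Re z : `|reC z| <= cab z.
Proof. by rewrite -rC_le -cabE; exact: normc_ge_Re. Qed.
Lemma sqr_cab z : cab z ^+ 2 = reC z ^+ 2 + imC z ^+ 2.
Proof. by apply: (@complexI R); rewrite add_Re2_Im2 cabE rmorphXn. Qed.
Lemma cab_Im z : `|imC z| <= cab z.
Proof.
rewrite -(@ler_pXn2r _ 2) ?nnegrE ?cab_ge0// sqr_cab real_normK ?num_real//.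
by rewrite lerDr sqr_ge0.
Qed.
Lemma cab_le z : cab z <= `|reC z| + `|imC z|.
Proof.
rewrite -(@ler_pXn2r _ 2) ?nnegrE ?cab_ge0 ?addr_ge0// sqr_cab.
have := real_normK (num_real (reC z)); have := real_normK (num_real (imC z)).
by rewrite sqrrD => -> ->; rewrite lerD2r lerDl mulrn_wge0 // mulr_ge0.
Qed.

Lemma complex_eq z w : reC z = reC w -> imC z = imC w -> z = w.
Proof. by case: z => a b; case: w => c d; rewrite /reC /imC /= => -> ->. Qed.

Lemma reCD z w : reC (z + w) = reC z + reC w. Proof. by case: z; case: w. Qed.
Lemma imCD z w : imC (z + w) = imC z + imC w. Proof. by case: z; case: w. Qed.
Lemma reCN z : reC (- z) = - reC z. Proof. by case: z. Qed.
Lemma imCN z : imC (- z) = - imC z. Proof. by case: z. Qed.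
Lemma reCM z w : reC (z * w) = reC z * reC w - imC z * imC w.
Proof. by case: z; case: w. Qed.
Lemma imCM z w : imC (z * w) = reC z * imC w + imC z * reC w.
Proof. by case: z => a b; case: w => c d. Qed.
Lemma reC_rC (x : R) : reC (rC x) = x. Proof. by []. Qed.
Lemma imC_rC (x : R) : imC (rC x) = 0. Proof. by []. Qed.
Lemma reC0 : reC (0 : C) = 0. Proof. by []. Qed.
Lemma imC0 : imC (0 : C) = 0. Proof. by []. Qed.
Lemma reC_sum (I : finType) (P : pred I) (F : I -> C) :
  reC (\sum_(i | P i) F i) = \sum_(i | P i) reC (F i).
Proof. by elim/big_rec2: _ => // i y1 y2 _ <-; rewrite reCD. Qed.
(** The matrix norm is the largest modulus of an entry, so topological statements about matrices
    become families of bounds on [cab]. *)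
Lemma mxnorm_leP m n (M : 'M[C]_(m, n)) (e : R) : 0 <= e ->
  (`|M| <= rC e) <-> (forall i j, cab (M i j) <= e).
Proof.
move=> e0.
have e0C : (0 : C) <= rC e by rewrite -rC0 rC_le.
rewrite /Num.Def.normr /= /mx_norm.
have -> : rC e = (NngNum e0C)%:num by [].
rewrite num_le; split.
  move=> /bigmax_leP[_ H] i j; have := H (i, j) isT.
  by rewrite -num_le /= cabE rC_le.
move=> H; apply/bigmax_leP; split; first by rewrite -num_le /=.
by move=> [i j] _; rewrite -num_le /= cabE rC_le.
Qed.

End ComplexModulus.

(** * Derivatives of complex and vector valued functions of a real variable *)

Section Deriv.
Variable R : realType.
Local Notation C := R[i].

Lemma is_derive1P (f : R -> R) (x d : R) :
  is_derive x 1 f d <->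
  forall e : R, 0 < e -> \forall h \near 0^', `|h^-1 * (f (x + h) - f x) - d| <= e.
Proof.
have E : (fun h : R => h^-1 *: ((f \o shift x) (h *: (1 : R)) - f x))
   = (fun h => h^-1 * (f (x + h) - f x)).
  by apply/funext => h; rewrite /= [h *: 1]mulr1 (addrC h).
split.
  case=> dv De e e0.
  have : h^-1 *: ((f \o shift x) (h *: (1:R)) - f x) @[h --> 0^'] --> d.
    by rewrite -De; exact: dv.
  by rewrite E => /cvgrPdist_le /(_ e e0); apply: filterS => h; rewrite distrC.
move=> H.
have cv : h^-1 *: ((f \o shift x) (h *: (1:R)) - f x) @[h --> 0^'] --> d.
  rewrite E; apply/cvgrPdist_le => e e0; have := H e e0.
  by apply: filterS => h; rewrite distrC.
split; first by apply/cvg_ex; exists d.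
exact: (cvg_lim _ cv).
Qed.

(** Split into real and imaginary parts because the mean value theorem is applied to real
    functions. *)
Definition cderiv (u : R -> C) (x : R) (d : C) : Prop :=
  is_derive x 1 (fun y => reC (u y)) (reC d) /\
  is_derive x 1 (fun y => imC (u y)) (imC d).

Lemma has_derivP n (U : R -> 'cV[C]_n) x d :
  has_deriv U x d <-> forall i, cderiv (fun y => U y i 0) x (d i 0).
Proof.
have E h i : reC (((rC h)^-1 *: (U (x + h) - U x) - d) i 0) =
    h^-1 * (reC (U (x + h) i 0) - reC (U x i 0)) - reC (d i 0).
  by rewrite !mxE -rCV reCD reCN reCM reC_rC imC_rC mul0r subr0 reCD reCN.
have E2 h i : imC (((rC h)^-1 *: (U (x + h) - U x) - d) i 0) =
    h^-1 * (imC (U (x + h) i 0) - imC (U x i 0)) - imC (d i 0).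
  by rewrite !mxE -rCV imCD imCN imCM reC_rC imC_rC mul0r addr0 imCD imCN.
split.
  move=> /cvgrPdist_le H i; split; apply/is_derive1P => e e0;
  (have eC : (0 : C) < rC e by rewrite -rC0 rC_lt);
  have := H _ eC; apply: filterS => h; rewrite distrC;
  move/mxnorm_leP => /(_ (ltW e0) i 0) Hh; apply: le_trans Hh.
    by rewrite -E; exact: cab_Re.
  by rewrite -E2; exact: cab_Im.
move=> H; apply/cvgrPdist_le => eC /rC_gt0_ex[e e0 ->].
have : \forall h \near 0^', forall i,
    `|h^-1 * (reC (U (x + h) i 0) - reC (U x i 0)) - reC (d i 0)| <= e / 2 /\
    `|h^-1 * (imC (U (x + h) i 0) - imC (U x i 0)) - imC (d i 0)| <= e / 2.
  apply: filter_forall => i; have [/is_derive1P H1 /is_derive1P H2] := H i.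
  have e2 : 0 < e / 2 by rewrite divr_gt0.
  by apply: filterS2 (H1 _ e2) (H2 _ e2).
apply: filterS => h Hh; rewrite distrC; apply/mxnorm_leP; first exact: ltW.
move=> i j; rewrite (ord1 j); apply: le_trans (cab_le _) _.
by rewrite E E2; have [] := Hh i; lra.
Qed.

Lemma cderiv_eq u x d d' : cderiv u x d -> d = d' -> cderiv u x d'.
Proof. by move=> H <-. Qed.

Lemma cderiv_cst (c : C) x : cderiv (fun=> c) x 0.
Proof. by split; exact: is_derive_cst. Qed.

Lemma cderivD u v x d e : cderiv u x d -> cderiv v x e ->
  cderiv (fun y => u y + v y) x (d + e).
Proof.
move=> [u1 u2] [v1 v2]; split.
  rewrite reCD (_ : (fun y => _) = (fun y => reC (u y)) + (fun y => reC (v y))).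
    exact: is_deriveD.
  by apply/funext => y; rewrite reCD.
rewrite imCD (_ : (fun y => _) = (fun y => imC (u y)) + (fun y => imC (v y))).
  exact: is_deriveD.
by apply/funext => y; rewrite imCD.
Qed.

Lemma cderivM u v x d e : cderiv u x d -> cderiv v x e ->
  cderiv (fun y => u y * v y) x (d * v x + u x * e).
Proof.
move=> [u1 u2] [v1 v2]; split.
  rewrite (_ : (fun y => _) = (fun y => reC (u y)) * (fun y => reC (v y))
     - (fun y => imC (u y)) * (fun y => imC (v y))).
    apply: is_derive_eq; rewrite !reCD !reCM /GRing.scale /=; ring.
  by apply/funext => y; rewrite reCM.
rewrite (_ : (fun y => _) = (fun y => reC (u y)) * (fun y => imC (v y))
   + (fun y => imC (u y)) * (fun y => reC (v y))).
  apply: is_derive_eq; rewrite !imCD !imCM /GRing.scale /=; ring.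
by apply/funext => y; rewrite imCM.
Qed.

Lemma cderivZ c u x d : cderiv u x d -> cderiv (fun y => c * u y) x (c * d).
Proof.
move=> H; apply: cderiv_eq (cderivM (cderiv_cst c x) H) _.
by rewrite mul0r add0r.
Qed.

Lemma cderivN u x d : cderiv u x d -> cderiv (fun y => - u y) x (- d).
Proof.
move=> /(cderivZ (-1)); rewrite mulN1r; congr cderiv.
by apply/funext => y; rewrite mulN1r.
Qed.

Lemma cderivB u v x d e : cderiv u x d -> cderiv v x e ->
  cderiv (fun y => u y - v y) x (d - e).
Proof. by move=> H /cderivN; exact: cderivD. Qed.

Lemma cderiv_bigsum (I : Type) (s : seq I) (P : pred I) (u : I -> R -> C) x (d : I -> C) :
  (forall i, P i -> cderiv (u i) x (d i)) ->
  cderiv (fun y => \sum_(i <- s | P i) u i y) x (\sum_(i <- s | P i) d i).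
Proof.
move=> H; elim: s => [|a s IH].
  rewrite big_nil (_ : (fun y => _) = fun=> 0); first exact: cderiv_cst.
  by apply/funext => y; rewrite big_nil.
rewrite big_cons (_ : (fun y => _) = fun y => if P a then u a y + \sum_(i <- s | P i) u i y
   else \sum_(i <- s | P i) u i y); last by apply/funext => y; rewrite big_cons.
by case: ifP => // Pa; apply: cderivD => //; exact: H.
Qed.

(** The derivative keeps full products with one factor replaced, the shape in which the Leibniz
    formula gives a determinant with one row replaced. *)
Lemma cderiv_prod (I : eqType) (s : seq I) (u : I -> R -> C) x (d : I -> C) :
  uniq s -> (forall i, i \in s -> cderiv (u i) x (d i)) ->
  cderiv (fun y => \prod_(i <- s) u i y) x
    (\sum_(i <- s) \prod_(k <- s) (if k == i then d k else u k x)).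
Proof.
elim: s => [|a s IH] /=.
  rewrite big_nil (_ : (fun y => _) = fun=> 1); first by move=> *; exact: cderiv_cst.
  by apply/funext => y; rewrite big_nil.
move=> /andP[aNs us] H.
rewrite (_ : (fun y => _) = fun y => u a y * \prod_(i <- s) u i y); last first.
  by apply/funext => y; rewrite big_cons.
apply: cderiv_eq.
  apply: cderivM; first by apply: H; rewrite mem_head.
  by apply: IH => // i si; apply: H; rewrite in_cons si orbT.
rewrite big_cons big_cons eqxx; congr (_ * _ + _).
  apply: eq_big_seq => i si; case: eqP => // ia.
  by move: aNs; rewrite -ia si.
rewrite mulr_sumr; apply: eq_big_seq => i si; rewrite big_cons.
by case: eqP => // ia; move: aNs; rewrite ia si.
Qed.

End Deriv.

(** * Mean value estimates, an integrating factor, and primitives on the real line *)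

Section RealCalculus.
Variable R : realType.
Implicit Types (f g : R -> R) (a b : R).

Lemma der_ge0_le f df a b : a <= b ->
  (forall x, a < x < b -> is_derive x 1 f (df x)) ->
  {within `[a, b], continuous f} ->
  (forall x, a < x < b -> 0 <= df x) -> f a <= f b.
Proof.
rewrite le_eqVlt => /predU1P[-> //|ab] Hd Hc H0.
have [c cab E] := MVT ab (fun x (xab : x \in `]a, b[%R) => Hd x xab) Hc.
by rewrite -subr_ge0 E mulr_ge0 ?subr_ge0 ?(ltW ab)// H0.
Qed.

Lemma der_bound f df a b M : a <= b ->
  (forall x, a < x < b -> is_derive x 1 f (df x)) ->
  {within `[a, b], continuous f} ->
  (forall x, a < x < b -> `|df x| <= M) -> `|f b - f a| <= M * (b - a).
Proof.
rewrite le_eqVlt => /predU1P[-> *|ab Hd Hc H0].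
  by rewrite !subrr normr0 mulr0.
have [c cab E] := MVT ab (fun x (xab : x \in `]a, b[%R) => Hd x xab) Hc.
have ba : 0 < b - a by rewrite subr_gt0.
by rewrite E normrM (gtr0_norm ba) ler_wpM2r ?(ltW ba)//; exact: H0.
Qed.

Lemma der_continuous f (x d : R) : is_derive x 1 f d -> {for x, continuous f}.
Proof. by case=> /derivable1_diffP /differentiable_continuous. Qed.

Lemma within_continuous_der f df a b :
  (forall x, a <= x <= b -> is_derive x 1 f (df x)) -> {within `[a, b], continuous f}.
Proof.
move=> H; apply/continuous_in_subspaceT => x /set_mem /=.
by rewrite in_itv /= => /H; exact: der_continuous.
Qed.

Lemma der_eq0_cst f a b : a <= b ->
  (forall x, a < x < b -> is_derive x 1 f 0) ->
  {within `[a, b], continuous f} -> f a = f b.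
Proof.
move=> ab H Hc; apply/eqP; rewrite eq_sym -subr_eq0 -normr_le0.
rewrite -(mul0r (b - a)).
by apply: (der_bound (df := fun=> 0)) => // x _; rewrite normr0.
Qed.

Lemma is_derive_expR_comp g (x d : R) :
  is_derive x 1 g d -> is_derive x 1 (fun y => expR (g y)) (expR (g x) * d).
Proof.
move=> H; have := @is_derive1_comp R expR g x _ _ (is_derive_expR (g x)) H.
by [].
Qed.

Lemma within_expR f (A : set R) : {within A, continuous f} ->
  {within A, continuous (fun x => expR (f x))}.
Proof. by move=> H x; apply: continuous_comp; [exact: H|exact: continuous_expR]. Qed.

(** Gronwall's inequality in the form of monotonicity: [expR w] is the integrating factor of the
    differential inequality. *)
Lemma der_exp_mono f df w dw a b : a <= b ->
  (forall x, a < x < b -> is_derive x 1 f (df x)) ->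
  (forall x, a < x < b -> is_derive x 1 w (dw x)) ->
  {within `[a, b], continuous f} -> {within `[a, b], continuous w} ->
  (forall x, a < x < b -> 0 <= df x + f x * dw x) ->
  f a * expR (w a) <= f b * expR (w b).
Proof.
move=> ab Hf Hw cf cw H.
apply: (@der_ge0_le (f * (fun x => expR (w x)))
   (fun x => expR (w x) * (df x + f x * dw x))) => //.
- move=> x xab; have Hfx := Hf x xab; have Hwx := is_derive_expR_comp (Hw x xab).
  by apply: is_derive_eq; rewrite /GRing.scale /=; ring.
- by move=> x; apply: continuousM; [exact: cf|exact: (within_expR cw)].
- by move=> x xab; rewrite mulr_ge0 ?expR_ge0 ?H.
Qed.

Let primitive_from f (a : R) : continuous f ->
  exists F : R -> R, forall x, a < x -> is_derive x 1 F (f x).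
Proof.
move=> cf; exists (fun x => \int[lebesgue_measure]_(t in `[a, x]) f t) => x ax.
have i : lebesgue_measure.-integrable `[a, x + 1] (EFin \o f).
  apply: continuous_compact_integrable; first exact: segment_compact.
  exact: continuous_subspaceT.
have xu : x < x + 1 by rewrite ltrDl.
have [d e] := continuous_FTC1_closed xu i ax (cf x).
by split => //; rewrite -derive1E.
Qed.

Lemma is_derive_near f g (x d : R) : (\forall y \near x, f y = g y) ->
  is_derive x 1 f d -> is_derive x 1 g d.
Proof.
move=> fg /is_derive1P H; apply/is_derive1P => e e0.
have := H e e0.
have fgx : f x = g x by exact: nbhs_singleton fg.
have : \forall h \near 0^', f (x + h) = g (x + h).
  move/nbhs_ballP: fg => [r r0 rfg]; apply/nbhs_ballP; exists r => //= h.
  rewrite /ball /= sub0r normrN => hr _; apply: rfg.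
  by rewrite /ball /= opprD addNKr normrN.
by apply: filterS2 => h <-; rewrite -fgx.
Qed.

Lemma is_derive_Nid g (x d : R) : is_derive (- x) 1 g d ->
  is_derive x 1 (fun y => g (- y)) (- d).
Proof.
move=> H; have := @is_derive1_comp R g (fun y => - y) x d (-1) H _.
by rewrite mulrN1; apply; exact: is_deriveNid.
Qed.

(** The integral is a primitive to the right of its base point only. Reflection supplies one to the
    left; on the overlap (-1, 1) the two differ by a constant, so they can be glued at 0. *)
Lemma ex_primitive f : continuous f ->
  exists F : R -> R, forall x : R, is_derive x 1 F (f x).
Proof.
move=> cf.
have [P HP] := primitive_from (-1) cf.
have cf' : continuous (fun x => f (- x)).
  by move=> x; apply: continuous_comp; [exact: opp_continuous|exact: cf].
have [Q HQ] := primitive_from (-1) cf'.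
have HQ' (x : R) : x < 1 -> is_derive x 1 (fun y => - Q (- y)) (f x).
  move=> x1; have x1' : -1 < - x by rewrite ltrN2.
  have := is_derive_Nid (HQ _ x1'); rewrite opprK => H.
  by rewrite -[f x]opprK; apply: (is_deriveN (f := fun y => Q (- y))).
pose D x := P x - (- Q (- x)).
have HD (x : R) : -1 < x < 1 -> is_derive x 1 D 0.
  move=> /andP[x0 x1]; rewrite -(subrr (f x)).
  by apply: is_deriveB; [exact: HP|exact: HQ'].
have DC (x : R) : -1 < x < 1 -> D x = D 0.
  move=> xb; have [x0|x0] := leP 0 x.
    apply/esym/der_eq0_cst => //.
      by move=> y /andP[y0 yx]; apply: HD; move: xb; lra.
    by apply: (@within_continuous_der _ (fun=> 0)) => y yx; apply: HD; move: xb; lra.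
  apply: der_eq0_cst; first exact: ltW.
    by move=> y /andP[y0 yx]; apply: HD; move: xb; lra.
  by apply: (@within_continuous_der _ (fun=> 0)) => y yx; apply: HD; move: xb; lra.
(* [D 0] is the constant by which the two primitives differ near the gluing point. *)
exists (fun x => if 0 < x then P x else - Q (- x) + D 0) => x.
have [x0|x0] := ltP 0 x.
  apply: (@is_derive_near P); last by apply: HP; lra.
  near=> y; have -> : 0 < y; last by [].
  by near: y; exact: lt_nbhsr.
have x1 : x < 1 by lra.
apply: (@is_derive_near (fun y => - Q (- y) + D 0)); last first.
  have := HQ' _ x1 => H; rewrite -[f x]addr0.
  exact: is_deriveD.
near=> y; case: ifPn => // y0; rewrite -(DC y); first by rewrite /D; ring.
rewrite (lt_trans _ y0) ?oppr_lt0 ?ltr01//=.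
by near: y; exact: lt_nbhsl.
Unshelve. all: by end_near. Qed.

End RealCalculus.

(** * Convergence, continuity and compactness for complex functions *)

Section ComplexTopology.
Variable R : realType.
Local Notation C := R[i].

Lemma rC_gt0 (e : R) : (0 < rC e) = (0 < e).
Proof. by rewrite -rC0 rC_lt. Qed.

Lemma cabBB (z w : C) : `|cab z - cab w| <= cab (z - w).
Proof.
rewrite ler_norml; apply/andP; split.
  by rewrite lerNl opprB lerBlDr cabB -[in leLHS](subrK z w) cabD.
by rewrite lerBlDr -[in leLHS](subrK w z) cabD.
Qed.

Lemma ccvgP {T : Type} {F : set_system T} {FF : Filter F} (u : T -> C) (l : C) :
  u @ F --> l <-> forall e : R, 0 < e -> \forall x \near F, cab (u x - l) <= e.
Proof.
split=> [/cvgrPdist_le H e e0|H].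
  have := H (rC e); rewrite rC_gt0 => /(_ e0); apply: filterS => x.
  by rewrite cabE rC_le cabB.
apply/cvgrPdist_le => eC /rC_gt0_ex[e e0 ->]; have := H e e0.
by apply: filterS => x; rewrite cabE rC_le cabB.
Qed.

Lemma near_cab (z : C) (e : R) : 0 < e -> \forall w \near z, cab (w - z) <= e.
Proof. by move=> e0; apply: (@ccvgP C (nbhs z) (nbhs_filter z) id z).1 => //; exact: cvg_id. Qed.

Lemma reC_continuous : continuous (@reC R).
Proof.
move=> z; apply/(@cvgrPdist_le _ _ _ (nbhs z) (nbhs_filter z)) => e e0.
apply: (@filterS _ (nbhs z) (nbhs_filter z) _ _ _ (near_cab z e0)) => w; rewrite cabB -reCN -reCD; apply: le_trans; exact: cab_Re.
Qed.

Lemma imC_continuous : continuous (@imC R).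
Proof.
move=> z; apply/(@cvgrPdist_le _ _ _ (nbhs z) (nbhs_filter z)) => e e0.
apply: (@filterS _ (nbhs z) (nbhs_filter z) _ _ _ (near_cab z e0)) => w; rewrite cabB -imCN -imCD; apply: le_trans; exact: cab_Im.
Qed.

Lemma cab_continuous : continuous (@cab R).
Proof.
move=> z; apply/(@cvgrPdist_le _ _ _ (nbhs z) (nbhs_filter z)) => e e0.
apply: (@filterS _ (nbhs z) (nbhs_filter z) _ _ _ (near_cab z e0)) => w; rewrite cabB; apply: le_trans; exact: cabBB.
Qed.

Lemma cvg_reim {T : Type} {F : set_system T} {FF : Filter F} (u : T -> C) (l : C) :
  (fun x => reC (u x)) @ F --> reC l -> (fun x => imC (u x)) @ F --> imC l ->
  u @ F --> l.
Proof.
move=> /cvgrPdist_le Hr /cvgrPdist_le Hi; apply/ccvgP => e e0.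
have e2 : 0 < e / 2 by rewrite divr_gt0.
apply: filterS2 (Hr _ e2) (Hi _ e2) => x hr hi; apply: le_trans (cab_le _) _.
by rewrite reCD reCN imCD imCN distrC (distrC (imC _)); lra.
Qed.

Lemma within_comp (T S U : topologicalType) (A : set T) (u : T -> S) (g : S -> U) :
  {within A, continuous u} -> continuous g -> {within A, continuous (fun x => g (u x))}.
Proof. by move=> H Hg x; exact: (@cvg_comp _ _ _ u g _ _ _ (H x) (Hg (u x))). Qed.

Lemma within_coord (T : topologicalType) (A : set T) m n (U : T -> 'M[C]_(m, n)) i j :
  {within A, continuous U} -> {within A, continuous (fun x => U x i j)}.
Proof. by move=> H; apply: (within_comp (g := fun M : 'M[C]_(m, n) => M i j) H); exact: coord_continuous. Qed.

Lemma mxcvgP {T : Type} {F : set_system T} {FF : Filter F} m n (U : T -> 'M[C]_(m, n)) (V : 'M[C]_(m, n)) :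
  U @ F --> V <-> forall i j, (fun x => U x i j) @ F --> V i j.
Proof.
split=> [H i j|H].
  by apply: (cvg_comp U (fun M : 'M[C]_(m, n) => M i j) H); exact: coord_continuous.
apply/cvgrPdist_le => eC /rC_gt0_ex[e e0 ->].
have : \forall x \near F, forall ij, cab (U x ij.1 ij.2 - V ij.1 ij.2) <= e.
  by apply: filter_forall => ij; have /ccvgP := H ij.1 ij.2; exact.
apply: filterS => x Hx; apply/mxnorm_leP; first exact: ltW.
by move=> i j; rewrite !mxE cabB; exact: (Hx (i, j)).
Qed.

Lemma within_mx (T : topologicalType) (A : set T) m n (U : T -> 'M[C]_(m, n)) :
  (forall i j, {within A, continuous (fun x => U x i j)}) -> {within A, continuous U}.
Proof. by move=> H x; apply/mxcvgP => i j; exact: H. Qed.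

Lemma cderiv_continuous (u : R -> C) (x : R) d : cderiv u x d -> {for x, continuous u}.
Proof.
by move=> [H1 H2]; apply: cvg_reim; [exact: (der_continuous H1)|exact: (der_continuous H2)].
Qed.

Lemma within_cderiv (u : R -> C) du (a b : R) :
  (forall x, a <= x <= b -> cderiv u x (du x)) -> {within `[a, b], continuous u}.
Proof.
move=> H; apply/continuous_in_subspaceT => x /set_mem /=.
by rewrite in_itv /= => /H; exact: cderiv_continuous.
Qed.

Lemma within_csum (T : topologicalType) (A : set T) (I : Type) (s : seq I) (P : pred I) (u : I -> T -> C) :
  (forall i, {within A, continuous (u i)}) ->
  {within A, continuous (fun x => \sum_(i <- s | P i) u i x)}.
Proof.
move=> H; elim: s => [|a s IH].
  rewrite (_ : (fun x => _) = fun=> 0); first by move=> x; exact: cvg_cst.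
  by apply/funext => x; rewrite big_nil.
case Pa : (P a); last first.
  rewrite (_ : (fun x => _) = (fun x => \sum_(i <- s | P i) u i x)) //.
  by apply/funext => x; rewrite big_cons Pa.
rewrite (_ : (fun x => _) = (fun x => u a x + \sum_(i <- s | P i) u i x)); last first.
  by apply/funext => x; rewrite big_cons Pa.
by move=> x; apply: cvgD; [exact: H|exact: IH].
Qed.

Lemma within_cprod (T : topologicalType) (A : set T) (I : Type) (s : seq I) (P : pred I) (u : I -> T -> C) :
  (forall i, {within A, continuous (u i)}) ->
  {within A, continuous (fun x => \prod_(i <- s | P i) u i x)}.
Proof.
move=> H; elim: s => [|a s IH].
  rewrite (_ : (fun x => _) = fun=> 1); first by move=> x; exact: cvg_cst.
  by apply/funext => x; rewrite big_nil.
case Pa : (P a); last first.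
  rewrite (_ : (fun x => _) = (fun x => \prod_(i <- s | P i) u i x)) //.
  by apply/funext => x; rewrite big_cons Pa.
rewrite (_ : (fun x => _) = (fun x => u a x * \prod_(i <- s | P i) u i x)); last first.
  by apply/funext => x; rewrite big_cons Pa.
by move=> x; apply: cvgM; [exact: H|exact: IH].
Qed.

Lemma within_cM (T : topologicalType) (A : set T) (u v : T -> C) :
  {within A, continuous u} -> {within A, continuous v} ->
  {within A, continuous (fun x => u x * v x)}.
Proof. by move=> Hu Hv x; apply: cvgM; [exact: Hu|exact: Hv]. Qed.

Lemma within_cB (T : topologicalType) (A : set T) (u v : T -> C) :
  {within A, continuous u} -> {within A, continuous v} ->
  {within A, continuous (fun x => u x - v x)}.
Proof. by move=> Hu Hv x; apply: cvgB; [exact: Hu|exact: Hv]. Qed.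

Lemma within_ccst (T : topologicalType) (A : set T) (c : C) :
  {within A, continuous (fun=> c)}.
Proof. by move=> x; exact: cvg_cst. Qed.

Lemma within_det (T : topologicalType) (A : set T) n (M : T -> 'M[C]_n) :
  {within A, continuous M} -> {within A, continuous (fun x => \det (M x))}.
Proof.
move=> HM; apply: within_csum => s; apply: within_cM; first exact: within_ccst.
by apply: within_cprod => i; exact: within_coord.
Qed.

Lemma compact_cab_bounded (T : topologicalType) (K : set T) (u : T -> C) :
  compact K -> {within K, continuous u} ->
  exists2 M : R, 0 < M & forall x, K x -> cab (u x) <= M.
Proof.
move=> cK cu.
have cc : {within K, continuous (fun x => cab (u x))}.
  by apply: (within_comp cu); exact: cab_continuous.
have /compact_bounded[M [_ HM]] := continuous_compact cc cK.
exists (`|M| + 1) => [|x Kx]; first by rewrite ltr_pwDr.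
have := HM (`|M| + 1); rewrite (le_lt_trans (ler_norm M)) ?ltrDl// => /(_ isT).
move=> /(_ (cab (u x))) /=; rewrite ger0_norm ?cab_ge0//; apply.
by exists x.
Qed.

Lemma compact_cab_bounded_fin (T : topologicalType) (K : set T) (I : finType) (u : I -> T -> C) :
  compact K -> (forall i, {within K, continuous (u i)}) ->
  exists2 M : R, 0 < M & forall i x, K x -> cab (u i x) <= M.
Proof.
move=> cK cu.
have /choice[M HM] i : exists M : R, 0 < M /\ forall x, K x -> cab (u i x) <= M.
  by have [M M0 H] := compact_cab_bounded cK (cu i); exists M.
(* The sum of the individual bounds serves every index; the 1 keeps it positive when the index type
   is empty. *)
exists (1 + \sum_i M i) => [|i x Kx].
  by rewrite ltr_pwDl// sumr_ge0// => i _; rewrite ltW// (HM i).1.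
apply: (le_trans ((HM i).2 x Kx)); rewrite (bigD1 i)//= addrCA lerDl.
by rewrite addr_ge0// sumr_ge0// => j _; rewrite ltW// (HM j).1.
Qed.

End ComplexTopology.

(** * Energy inequality for linear systems with nonnegative diagonal rates *)

Section Energy.
Variable R : realType.
Local Notation C := R[i].

(** The diagonal part can only increase the energy and is dropped. Young's inequality splits the
    coupling into 2|d_i|^2 + |d_j|^2 + |c_j|^2; summed over i and j this gives [3 * #|I|] for d and
    [#|I|] for c, whence the constant. Later c is the limit and d the deviation from it. *)
Lemma energy_lower (I : finType) (a d e c : I -> C) (g : R) : 0 <= g ->
  (forall i, 0 <= reC (a i) \/ d i = 0) ->
  (forall i, cab (e i) <= g * \sum_j (cab (d j) + cab (c j))) ->
  - (3 * g * #|I|%:R) * (\sum_i cab (d i) ^+ 2 + \sum_i cab (c i) ^+ 2) <=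
  \sum_i 2 * (reC (d i) * reC (a i * d i + e i) + imC (d i) * imC (a i * d i + e i)).
Proof.
move=> g0 Ha He.
have term i : - (g * \sum_j (2 * cab (d i) ^+ 2 + (cab (d j) ^+ 2 + cab (c j) ^+ 2))) <=
   2 * (reC (d i) * reC (a i * d i + e i) + imC (d i) * imC (a i * d i + e i)).
  (* The right-hand side is the real inner product of two complex numbers, that is, the real part of
     [conjc (d i) * e i]. *)
  have cs : - (cab (d i) * cab (e i)) <= reC (d i) * reC (e i) + imC (d i) * imC (e i).
    have H := cab_Re (conjc (d i) * e i); rewrite cabM in H.
    have -> : cab (d i) = cab (conjc (d i)) by rewrite /cab normcJ.
    have -> : reC (d i) * reC (e i) + imC (d i) * imC (e i) = reC (conjc (d i) * e i).
      by rewrite reCM; case: (d i) => p q; rewrite /reC /imC /=; ring.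
    by move: H; rewrite ler_norml => /andP[].
  have ad : 0 <= reC (a i) * (reC (d i) ^+ 2 + imC (d i) ^+ 2).
    case: (Ha i) => [a0|->]; first by rewrite mulr_ge0// addr_ge0 ?sqr_ge0.
    by rewrite reC0 imC0 expr0n addr0 mulr0.
  have -> : 2 * (reC (d i) * reC (a i * d i + e i) + imC (d i) * imC (a i * d i + e i))
    = 2 * (reC (a i) * (reC (d i) ^+ 2 + imC (d i) ^+ 2)) +
      2 * (reC (d i) * reC (e i) + imC (d i) * imC (e i)).
    by rewrite reCD imCD reCM imCM; ring.
  have de : cab (d i) * cab (e i) <= g * \sum_j (cab (d i) * (cab (d j) + cab (c j))).
    rewrite -mulr_sumr mulrCA; apply: ler_wpM2l; first exact: cab_ge0.
    exact: He.
  have sq : 2 * (g * \sum_j (cab (d i) * (cab (d j) + cab (c j)))) <=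
     g * \sum_j (2 * cab (d i) ^+ 2 + (cab (d j) ^+ 2 + cab (c j) ^+ 2)).
    rewrite mulrCA; apply: ler_wpM2l => //; rewrite mulr_sumr; apply: ler_sum => j _.
    have := sqr_ge0 (cab (d i) - cab (d j)); have := sqr_ge0 (cab (d i) - cab (c j)).
    by rewrite !expr2; nra.
  lra.
apply: (le_trans _ (ler_sum _ (fun i _ => term i))).
rewrite sumrN -mulr_sumr mulNr lerN2.
under eq_bigr do rewrite big_split /= big_split /= sumr_const.
rewrite big_split /= sumr_const sumrMnl -mulr_sumr -mulrnDl -mulr_natr.
set E := \sum_i _ ^+ 2; set s := \sum_i _ ^+ 2; set N : R := #|I|%:R.
have s0 : 0 <= s by apply: sumr_ge0 => j _; exact: sqr_ge0.
have : 0 <= g * N * s by rewrite !mulr_ge0// ler0n.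
nra.
Qed.

Definition energy (I : finType) (u : I -> R -> C) (x : R) : R :=
  \sum_i cab (u i x) ^+ 2.

Lemma energy_der (I : finType) (u : I -> R -> C) (d : I -> C) (x : R) :
  (forall i, cderiv (u i) x (d i)) ->
  is_derive x 1 (energy u)
    (\sum_i 2 * (reC (u i x) * reC (d i) + imC (u i x) * imC (d i))).
Proof.
move=> H; rewrite /energy.
have E i : is_derive x 1 (fun y => cab (u i y) ^+ 2)
   (2 * (reC (u i x) * reC (d i) + imC (u i x) * imC (d i))).
  have [H1 H2] := H i.
  rewrite (_ : (fun y => _) = (fun y => reC (u i y)) * (fun y => reC (u i y)) +
    (fun y => imC (u i y)) * (fun y => imC (u i y))).
    by apply: is_derive_eq; rewrite /GRing.scale /=; ring.
  by apply/funext => y; rewrite sqr_cab !expr2.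
elim: index_enum => [|a s IH].
  rewrite big_nil (_ : (fun y => _) = cst 0); first exact: is_derive_cst.
  by apply/funext => y; rewrite big_nil.
rewrite big_cons (_ : (fun y => _) = (fun y => cab (u a y) ^+ 2) +
   (fun y => \sum_(i <- s) cab (u i y) ^+ 2)); first exact: is_deriveD.
by apply/funext => y; rewrite big_cons.
Qed.

Lemma within_energy (I : finType) (u : I -> R -> C) (A : set R) :
  (forall i, {within A, continuous (u i)}) -> {within A, continuous (energy u)}.
Proof.
move=> H; rewrite /energy; elim: index_enum => [|a s IH].
  rewrite (_ : (fun y => _) = cst 0); first by move=> x; exact: cvg_cst.
  by apply/funext => y; rewrite big_nil.
rewrite (_ : (fun y => _) = (fun y => cab (u a y) ^+ 2 +
   \sum_(i <- s) cab (u i y) ^+ 2)); last by apply/funext => y; rewrite big_cons.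
move=> x; apply: cvgD; last exact: IH.
have Hc := within_comp (H a) (@cab_continuous R).
exact: cvgM (Hc x) (Hc x).
Qed.

Lemma energy_ge0 (I : finType) (u : I -> R -> C) (x : R) : 0 <= energy u x.
Proof. by apply: sumr_ge0 => i _; exact: sqr_ge0. Qed.

Lemma cab_le_energy (I : finType) (u : I -> R -> C) (x : R) i :
  cab (u i x) ^+ 2 <= energy u x.
Proof.
by rewrite /energy (bigD1 i)//= lerDl; apply: sumr_ge0 => j _; exact: sqr_ge0.
Qed.

(** The weight w compensates exactly the loss allowed by [energy_lower]. The estimate runs from
    right to left, the direction in which data prescribed at L are propagated to 0. *)
Lemma energy_mono (I : finType) (u e : I -> R -> C) (a c : I -> C)
    (g w : R -> R) (x1 x2 : R) : x1 <= x2 ->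
  (forall i x, x1 < x < x2 -> cderiv (u i) x (a i * u i x + e i x)) ->
  (forall i, {within `[x1, x2], continuous (u i)}) ->
  (forall x, x1 < x < x2 -> 0 <= g x) ->
  (forall x, x1 < x < x2 -> is_derive x 1 w (3 * g x * #|I|%:R)) ->
  {within `[x1, x2], continuous w} ->
  (forall i, 0 <= reC (a i) \/ forall x, x1 < x < x2 -> u i x = 0) ->
  (forall i x, x1 < x < x2 -> cab (e i x) <= g x * \sum_j (cab (u j x) + cab (c j))) ->
  (energy u x1 + \sum_i cab (c i) ^+ 2) * expR (w x1) <=
  (energy u x2 + \sum_i cab (c i) ^+ 2) * expR (w x2).
Proof.
move=> x12 Hu cu g0 Hw cw Ha He; set s := \sum_i _.
apply: (@der_exp_mono R (fun x => energy u x + s)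
  (fun x => \sum_i 2 * (reC (u i x) * reC (a i * u i x + e i x) +
                        imC (u i x) * imC (a i * u i x + e i x)))
  w (fun x => 3 * g x * #|I|%:R)) => //.
- move=> x xb; rewrite -[X in is_derive _ _ _ X]addr0; apply: is_deriveD.
  by apply: energy_der => i; exact: Hu.
- move=> x; apply: cvgD; last exact: cvg_cst.
  exact: (within_energy cu).
- move=> x xb.
  have := @energy_lower I a (u ^~ x) (e ^~ x) c (g x) (g0 x xb).
  rewrite mulNr => H; rewrite -lerBlDr sub0r (mulrC (_ + _)); apply: H.
    by move=> i; case: (Ha i) => [?|/(_ x xb)]; [left|right].
  by move=> i; exact: He.
Qed.

End Energy.

(** * Growth bounds and uniqueness for linear equations, and limits with geometric error *)

Section LinearODE.
Variable R : realType.
Local Notation C := R[i].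

Lemma cderiv_Nid (u : R -> C) (x : R) d : cderiv u (- x) d ->
  cderiv (fun y => u (- y)) x (- d).
Proof.
by move=> [H1 H2]; split; rewrite ?reCN ?imCN;
  [exact: (is_derive_Nid H1)|exact: (is_derive_Nid H2)].
Qed.

Lemma has_deriv_Nid n (U : R -> 'cV[C]_n) (x : R) d : has_deriv U (- x) d ->
  has_deriv (fun y => U (- y)) x (- d).
Proof.
move/has_derivP => H; apply/has_derivP => i; rewrite mxE.
exact: (cderiv_Nid (u := fun y => U y i 0) (H i)).
Qed.

Lemma is_derive_linear (c x : R) : is_derive x 1 (fun y : R => c * y) c.
Proof.
rewrite (_ : (fun y => _) = c \*: (id : R -> R)); last by apply/funext.
by apply: is_derive_eq; rewrite /GRing.scale /= mulr1.
Qed.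

Lemma cab_mulmx n (B : 'M[C]_n) (V : 'cV[C]_n) M i :
  (forall i j, cab (B i j) <= M) -> cab ((B *m V) i 0) <= M * \sum_j cab (V j 0).
Proof.
move=> HB; rewrite mxE; apply: le_trans (cab_sum _ _) _.
rewrite mulr_sumr; apply: ler_sum => j _; rewrite cabM.
by apply: ler_wpM2r; [exact: cab_ge0|exact: HB].
Qed.

(** The energy inequality with zero diagonal, the whole matrix B being treated as coupling of size
    M. *)
Lemma ode_growth_back n (B : R -> 'M[C]_n) (V : R -> 'cV[C]_n) (a b M : R) :
  0 <= M -> a <= b -> {within `[a, b], continuous V} ->
  (forall x, a < x < b -> has_deriv V x (B x *m V x)) ->
  (forall x i j, a < x < b -> cab (B x i j) <= M) ->
  energy (fun i x => V x i 0) a <= energy (fun i x => V x i 0) b * expR (3 * M * n%:R * (b - a)).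
Proof.
move=> M0 ab cV HV HB.
have := @energy_mono R _ (fun i x => V x i 0) (fun i x => (B x *m V x) i 0)
  (fun=> 0) (fun=> 0) (fun=> M) (fun x => 3 * M * n%:R * x) a b ab.
have -> : \sum_(i < n) cab (0 : C) ^+ 2 = 0.
  by rewrite big1// => i _; rewrite cab0 expr0n.
rewrite !addr0 card_ord mulrBr expRD expRN mulrA ler_pdivlMr ?expR_gt0//; apply.
- move=> i x xab; rewrite mul0r add0r; exact: (has_derivP _ _ _).1 (HV x xab) i.
- by move=> i; exact: within_coord.
- by [].
- by move=> x xab; exact: is_derive_linear.
- by apply: (@within_continuous_der _ _ (fun=> 3 * M * n%:R)) => x _; exact: is_derive_linear.
- by move=> i; left; rewrite reC0.
- move=> i x xab; have := @cab_mulmx n (B x) (V x) M i (fun i j => HB x i j xab).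
  move/le_trans; apply; apply: ler_wpM2l => //; apply: ler_sum => j _.
  by rewrite cab0 addr0.
Qed.

Lemma ode_growth n (B : R -> 'M[C]_n) (V : R -> 'cV[C]_n) (a b M : R) :
  0 <= M -> a <= b -> {within `[a, b], continuous V} ->
  (forall x, a < x < b -> has_deriv V x (B x *m V x)) ->
  (forall x i j, a < x < b -> cab (B x i j) <= M) ->
  energy (fun i x => V x i 0) b <= energy (fun i x => V x i 0) a * expR (3 * M * n%:R * (b - a)).
Proof.
move=> M0 ab cV HV HB.
have E x : energy (fun i x => V (- x) i 0) x = energy (fun i x => V x i 0) (- x) by [].
suff : energy (fun i x => V (- x) i 0) (- b) <=
   energy (fun i x => V (- x) i 0) (- a) * expR (3 * M * n%:R * (- a - - b)).
  by rewrite (E (- b)) (E (- a)) (opprK a) (opprK b) (addrC (- a)).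
apply: (@ode_growth_back n (fun x => - B (- x)) (fun x => V (- x)) (- b) (- a) M M0).
- by rewrite lerN2.
- by apply: (@within_continuous_compN _ _ _ V (- b) (- a)); rewrite !opprK.
- move=> x xab; rewrite mulNmx; apply: has_deriv_Nid; apply: HV.
  by move: xab; lra.
- by move=> x i j xab; rewrite mxE cabN HB//; move: xab; lra.
Qed.

Lemma energy_eq0 n (V : R -> 'cV[C]_n) x :
  energy (fun i x => V x i 0) x <= 0 -> V x = 0.
Proof.
move=> H; apply/colP => i; rewrite mxE; apply/eqP; rewrite -cab_eq0 -sqrf_eq0.
rewrite eq_le sqr_ge0 andbT; apply: le_trans H.
exact: (cab_le_energy (fun i x => V x i 0)).
Qed.

Lemma within_sub (T : topologicalType) (U : R -> T) (a b c d : R) : a <= c -> d <= b ->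
  {within `[a, b], continuous U} -> {within `[c, d], continuous U}.
Proof.
by move=> ac db; apply: continuous_subspaceW; apply: subset_itv; rewrite bnd_simp.
Qed.

Lemma ode_unique n (B : R -> 'M[C]_n) (V W : R -> 'cV[C]_n) (a b M x0 : R) :
  0 <= M -> a <= x0 <= b -> {within `[a, b], continuous V} -> {within `[a, b], continuous W} ->
  (forall x, a < x < b -> has_deriv V x (B x *m V x)) ->
  (forall x, a < x < b -> has_deriv W x (B x *m W x)) ->
  (forall x i j, a < x < b -> cab (B x i j) <= M) ->
  V x0 = W x0 -> forall x, a <= x <= b -> V x = W x.
Proof.
move=> M0 /andP[ax0 x0b] cV cW HV HW HB E x /andP[ax xb].
apply/eqP; rewrite -subr_eq0; apply/eqP.
pose D y := V y - W y.
have cD : {within `[a, b], continuous D}.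
  by move=> y; apply: cvgB; [exact: cV|exact: cW].
have HD y : a < y < b -> has_deriv D y (B y *m D y).
  move=> yab; apply/has_derivP => i; rewrite mulmxBr mxE.
  rewrite (_ : (fun y => _) = (fun y => V y i 0 - W y i 0)); last first.
    by apply/funext => z; rewrite !mxE.
  rewrite [in X in cderiv _ _ (_ + X)]mxE.
  by apply: cderivB; [have /has_derivP := HV y yab|have /has_derivP := HW y yab]; exact.
have E0 : energy (fun i x => D x i 0) x0 = 0.
  by rewrite /energy big1// => i _; rewrite /D E subrr mxE cab0 expr0n.
apply: (@energy_eq0 n D x).
have [xx0|x0x] := leP x x0.
  have := @ode_growth_back n B D x x0 M M0 xx0 (within_sub ax x0b cD).
  rewrite E0 mul0r; apply.
    by move=> y yb; apply: HD; move: yb ax x0b; lra.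
  by move=> y i j yb; apply: HB; move: yb ax x0b; lra.
have := @ode_growth n B D x0 x M M0 (ltW x0x) (within_sub ax0 xb cD).
rewrite E0 mul0r; apply.
  by move=> y yb; apply: HD; move: yb ax0 xb; lra.
by move=> y i j yb; apply: HB; move: yb ax0 xb; lra.
Qed.

Lemma ex_cprimitive (u : R -> C) : continuous u ->
  exists F : R -> C, F 0 = 0 /\ forall x, cderiv F x (u x).
Proof.
move=> cu.
have cr : continuous (fun x => reC (u x)).
  by move=> x; exact: (cvg_comp _ _ (cu x) (@reC_continuous R (u x))).
have ci : continuous (fun x => imC (u x)).
  by move=> x; exact: (cvg_comp _ _ (cu x) (@imC_continuous R (u x))).
have [P HP] := ex_primitive cr; have [Q HQ] := ex_primitive ci.
exists (fun x => Complex (P x - P 0) (Q x - Q 0)); rewrite !subrr; split => // x.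
by split; rewrite /reC /imC /=; [rewrite -[complex.Re (u x)]addr0|rewrite -[complex.Im (u x)]addr0];
  apply: is_deriveD.
Qed.

(** The mean value theorem fails for complex values, so it is applied to real and imaginary part
    separately; this costs the factor 2. *)
Lemma cder_bound_fun (F : R -> C) dF (G dG : R -> R) (a b : R) : a <= b ->
  (forall x, a <= x <= b -> cderiv F x (dF x)) ->
  (forall x, a <= x <= b -> is_derive x 1 G (dG x)) ->
  (forall x, a < x < b -> cab (dF x) <= dG x) ->
  cab (F b - F a) <= 2 * (G b - G a).
Proof.
move=> ab HF HG H; apply: le_trans (cab_le _) _.
suff K (f df : R -> R) : (forall x, a <= x <= b -> is_derive x 1 f (df x)) ->
   (forall x, a < x < b -> `|df x| <= dG x) -> `|f b - f a| <= G b - G a.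
  have := K (fun x => reC (F x)) (fun x => reC (dF x)) _ _.
  have := K (fun x => imC (F x)) (fun x => imC (dF x)) _ _.
  rewrite reCD imCD reCN imCN => Hi Hr.
  rewrite mulrDl mul1r lerD//; [apply: Hr|apply: Hi].
  - by move=> x /HF[].
  - by move=> x /H; apply: le_trans; exact: cab_Re.
  - by move=> x /HF[].
  - by move=> x /H; apply: le_trans; exact: cab_Im.
move=> Hf Hd.
have oc x : a < x < b -> a <= x <= b by move=> /andP[/ltW -> /ltW ->].
rewrite ler_norml; apply/andP; split.
  have := @der_ge0_le R (G + f) (fun x => dG x + df x) a b ab.
  move=> /(_ (fun x xb => is_deriveD (HG x (oc x xb)) (Hf x (oc x xb)))).
  have -> : forall x, (G + f) x = G x + f x by [].
  move=> K; have : G a + f a <= G b + f b.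
    apply: K; first by apply: (@within_continuous_der _ _ (fun x => dG x + df x)) => x xb;
      apply: is_deriveD; [exact: HG|exact: Hf].
    by move=> x xb; have := Hd x xb; rewrite ler_norml; lra.
  lra.
have := @der_ge0_le R (G - f) (fun x => dG x - df x) a b ab.
move=> /(_ (fun x xb => is_deriveB (HG x (oc x xb)) (Hf x (oc x xb)))).
have -> : forall x, (G - f) x = G x - f x by [].
move=> K; have : G a - f a <= G b - f b.
  apply: K; first by apply: (@within_continuous_der _ _ (fun x => dG x - df x)) => x xb;
    apply: is_deriveB; [exact: HG|exact: Hf].
  by move=> x xb; have := Hd x xb; rewrite ler_norml; lra.
lra.
Qed.

Lemma cder_bound (F : R -> C) dF (a b M : R) : a <= b ->
  (forall x, a <= x <= b -> cderiv F x (dF x)) ->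
  (forall x, a < x < b -> cab (dF x) <= M) ->
  cab (F b - F a) <= 2 * M * (b - a).
Proof.
move=> ab HF H.
have := @cder_bound_fun F dF (fun x => M * x) (fun=> M) a b ab HF.
by rewrite -mulrBr mulrA; apply => // x _; exact: is_derive_linear.
Qed.

(** The tail of the geometric series is 2c / 2^k, so intervals of that radius about the real (or
    imaginary) parts are nested. Their common point is the limit, and adding both parts gives 4c. *)
Lemma geometric_limit (u : nat -> C) (c : R) :
  (forall k, cab (u k.+1 - u k) <= c / 2 ^+ k) ->
  exists l, forall k, cab (l - u k) <= 4 * c / 2 ^+ k.
Proof.
move=> H.
have real_case (f : nat -> R) : (forall k, `|f k.+1 - f k| <= c / 2 ^+ k) ->
    exists l, forall k, `|l - f k| <= 2 * c / 2 ^+ k.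
  move=> Hf.
  have c0 : 0 <= c by have := Hf 0%N; rewrite expr0 divr1; apply: le_trans.
  pose lo k := f k - 2 * c / 2 ^+ k; pose hi k := f k + 2 * c / 2 ^+ k.
  have step k : 2 * c / 2 ^+ k.+1 = c / 2 ^+ k.
    by rewrite exprS invfM; field; exact: expf_neq0.
  have dbl k : 2 * c / 2 ^+ k = 2 * (c / 2 ^+ k) by rewrite mulrA.
  have lohi k : lo k <= hi k.
    by rewrite /lo /hi; have : 0 <= 2 * c / 2 ^+ k; [rewrite !mulr_ge0 ?invr_ge0 ?exprn_ge0|lra].
  have lom : {homo lo : i j / (i <= j)%N >-> i <= j}.
    apply: homo_leq => // [x y z|k]; first exact: le_trans.
    have := Hf k; rewrite /lo step dbl ler_norml; lra.
  have him : {homo hi : i j / (i <= j)%N >-> j <= i}.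
    apply: homo_leq => // [x y z yx zy|k]; first exact: le_trans zy yx.
    have := Hf k; rewrite /hi step dbl ler_norml; lra.
  have cross i j : lo i <= hi j.
    apply: (le_trans (lom _ _ (leq_maxl i j))); apply: (le_trans (lohi _)).
    exact: him (leq_maxr i j).
  exists (sup (range lo)) => k; rewrite ler_norml; apply/andP; split.
    have : lo k <= sup (range lo).
      by apply: ub_le_sup; [exists (hi 0%N) => _ [i _ <-]|exists k].
    by rewrite /lo; lra.
  have : sup (range lo) <= hi k.
    by apply: ge_sup; [exists (lo 0%N); exists 0%N|move=> _ [i _ <-]].
  by rewrite /hi; lra.
have hr k : `|reC (u k.+1) - reC (u k)| <= c / 2 ^+ k.
  by rewrite -reCN -reCD; exact: le_trans (cab_Re _) (H k).
have hi k : `|imC (u k.+1) - imC (u k)| <= c / 2 ^+ k.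
  by rewrite -imCN -imCD; exact: le_trans (cab_Im _) (H k).
have [l1 H1] := real_case (fun k => reC (u k)) (fun k => hr k).
have [l2 H2] := real_case (fun k => imC (u k)) (fun k => hi k).
exists (Complex l1 l2) => k; apply: le_trans (cab_le _) _.
rewrite reCD imCD reCN imCN [reC _]/= [imC (Complex _ _)]/=.
have -> : 4 * c / 2 ^+ k = 2 * c / 2 ^+ k + 2 * c / 2 ^+ k by lra.
exact: lerD.
Qed.

End LinearODE.

(** * Existence of solutions by Picard iteration *)

Section ODEExistence.
Variable R : realType.
Local Notation C := R[i].

Lemma within_setT_continuous (T S : topologicalType) (f : T -> S) :
  {within setT, continuous f} -> continuous f.
Proof. by move=> H x; have := H x; rewrite /continuous_at nbhs_subspaceT. Qed.

Lemma le0_geometric (x c : R) : (forall k, x <= c / 2 ^+ k) -> x <= 0.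
Proof.
move=> H; rewrite leNgt; apply/negP => x0.
pose k := Num.bound (c / x).
have c0 : 0 < c by have := H 0%N; rewrite expr0 divr1; exact: lt_le_trans.
have Hk : c / x < k%:R.
  by have := archi_boundP (ltW (divr_gt0 c0 x0)).
have : (k%:R : R) <= 2 ^+ k by rewrite -natrX ler_nat ltnW// ltn_expl.
have p0 : (0 : R) < 2 ^+ k by rewrite exprn_gt0.
move=> k2; have := H k; rewrite ler_pdivlMr// leNgt => /negP; apply.
by rewrite mulrC -ltr_pdivrMr// (lt_le_trans Hk).
Qed.

Lemma continuous_ode_rhs (I : finType) (B : I -> R -> C) (W : I -> R -> C) :
  (forall j, continuous (B j)) -> (forall j, continuous (W j)) ->
  continuous (fun s => \sum_j B j s * W j s).
Proof.
move=> HB HW; apply: within_setT_continuous; apply: within_csum => j.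
by apply: within_cM; apply: continuous_subspaceT.
Qed.

Let clamp (L x : R) := Num.max 0 (Num.min x L).

Let clamp_id L x : 0 <= x <= L -> clamp L x = x.
Proof. by move=> /andP[x0 xL]; rewrite /clamp min_l// max_r. Qed.

Let clamp_in L x : 0 <= L -> 0 <= clamp L x <= L.
Proof. by move=> L0; rewrite /clamp le_max lexx /= ge_max L0 ge_min lexx orbT. Qed.

Let clamp_cont L : continuous (clamp L).
Proof.
move=> x; apply: (@continuous_max _ _ (cst 0) (fun x => Num.min x L)); first exact: cvg_cst.
by apply: (@continuous_min _ _ id (cst L)); [exact: cvg_id|exact: cvg_cst].
Qed.

(** Picard iteration measured with the weight [expR (K * x)]: for K large the Picard operator
    contracts by 1/2 on all of [0, L] at once, whatever the length of the interval. *)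
Lemma ode_exists n (B : R -> 'M[C]_n) (L : R) (v : 'cV[C]_n) :
  (forall i j, continuous (fun x => B x i j)) -> 0 <= L ->
  exists P : R -> 'cV[C]_n, P 0 = v /\
    forall x, 0 <= x <= L -> has_deriv P x (B x *m P x).
Proof.
move=> cB L0.
(* [pr] chooses a primitive of every continuous function and is arbitrary elsewhere, which makes the
   Picard operator [T] total. *)
have /choice[pr Hpr] (u : R -> C) : exists F : R -> C,
    continuous u -> F 0 = 0 /\ forall x, cderiv F x (u x).
  have [cu|ncu] := pselect (continuous u); last by exists u.
  by have [F HF] := ex_cprimitive cu; exists F.
pose T (W : 'I_n -> R -> C) i x := v i 0 + pr (fun s => \sum_j B s i j * W j s) x.
have TP W : (forall j, continuous (W j)) -> forall i,
    [/\ T W i 0 = v i 0 & forall x, cderiv (T W i) x (\sum_j B x i j * W j x)].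
  move=> cW i; have [p0 pd] := Hpr _ (continuous_ode_rhs (cB i) cW).
  split; first by rewrite /T p0 addr0.
  by move=> x; rewrite -[X in cderiv _ _ X]add0r; apply: cderivD (cderiv_cst _ _) (pd x).
pose W k := iter k T (fun i _ => v i 0).
have WC k j : continuous (W k j).
  elim: k j => [|k IH] j; first by move=> x; exact: cvg_cst.
  by move=> x; have [_ /(_ x)] := TP _ IH j; exact: cderiv_continuous.
have WD k j x : cderiv (W k.+1 j) x (\sum_i B x j i * W k i x).
  by have [_] := TP _ (WC k) j; exact.
have W0 k j : W k j 0 = v j 0.
  by case: k => [//|k]; have [] := TP _ (WC k) j.
have [M M0 HM] : exists2 M : R, 0 < M & forall (ij : 'I_n * 'I_n) x, 0 <= x <= L ->
    cab (B x ij.1 ij.2) <= M.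
  have [M M0 HM] := compact_cab_bounded_fin (u := fun (ij : 'I_n * 'I_n) x => B x ij.1 ij.2)
    (@segment_compact R 0 L) (fun ij => continuous_subspaceT (cB ij.1 ij.2)).
  by exists M => // ij x xL; apply: HM; rewrite /= in_itv.
have [D D0 HD] : exists2 D : R, 0 < D & forall i x, 0 <= x <= L ->
    cab (W 1%N i x - W 0%N i x) <= D.
  have c10 i : continuous (fun x => W 1%N i x - W 0%N i x).
    by move=> x; apply: cvgB; exact: WC.
  have [D D0 HD] := compact_cab_bounded_fin
    (@segment_compact R 0 L) (fun i => continuous_subspaceT (c10 i)).
  by exists D => // i x xL; apply: HD; rewrite /= in_itv.
pose N : R := n%:R; have N0 : 0 <= N by rewrite ler0n.
(* Integrating the weight gains 1 / K and [cder_bound_fun] loses 2, so a contraction by 1/2 needs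
   [4 * M * N <= K]; the 1 keeps K positive. *)
pose K := 4 * M * N + 1.
have MN0 : 0 <= M * N by rewrite mulr_ge0// ltW.
have K0 : 0 < K by rewrite /K; lra.
have step k i x : 0 <= x <= L ->
    cab (W k.+1 i x - W k i x) <= D / 2 ^+ k * expR (K * x).
  elim: k i x => [|k IH] i x xL.
    apply: (le_trans (HD i x xL)); rewrite expr0 divr1 ler_pMr//.
    by case/andP: xL => x0 _; rewrite -expR0 ler_expR mulr_ge0// ltW.
  have [x0 xL'] := andP xL.
  pose c := D / 2 ^+ k.
  have c0 : 0 <= c by rewrite divr_ge0 ?exprn_ge0// ltW.
  pose F y := W k.+2 i y - W k.+1 i y.
  pose dF y := \sum_j B y i j * (W k.+1 j y - W k j y).
  have HF y : cderiv F y (dF y).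
    apply: cderiv_eq (cderivB (WD k.+1 i y) (WD k i y)) _.
    by rewrite -sumrB; apply: eq_bigr => j _; rewrite mulrBr.
  have HdF y : 0 < y < x -> cab (dF y) <= M * N * c * expR (K * y).
    move=> /andP[y0 yx]; have yL : 0 <= y <= L by rewrite (ltW y0) ltW// (lt_le_trans yx).
    apply: le_trans (cab_sum _ _) _.
    have -> : M * N * c * expR (K * y) = \sum_(j < n) (M * (c * expR (K * y))).
      by rewrite sumr_const card_ord -mulr_natr -/N; ring.
    apply: ler_sum => j _; rewrite cabM; apply: ler_pM; rewrite ?cab_ge0//.
      exact: (HM (i, j) y yL).
    exact: IH.
  pose G y := M * N * c / K * expR (K * y).
  have HG (y : R) : is_derive y 1 G (M * N * c * expR (K * y)).
    have := is_derive_expR_comp (is_derive_linear K y) => E.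
    rewrite /G (_ : (fun y => _) = (M * N * c / K) \*: (fun y => expR (K * y))).
      by apply: is_derive_eq; rewrite /GRing.scale /=; field; rewrite gt_eqF.
    by apply/funext.
  have := @cder_bound_fun R F dF G (fun y => M * N * c * expR (K * y)) 0 x x0
    (fun y _ => HF y) (fun y _ => HG y) HdF.
  rewrite {2}/F !W0 subrr subr0 => H; apply: (le_trans H).
  have G0 : 0 <= G 0 by rewrite /G mulr_ge0 ?expR_ge0// mulr_ge0 ?invr_ge0 ?(ltW K0)// mulr_ge0.
  have -> : D / 2 ^+ k.+1 = c / 2 by rewrite /c exprS invfM; ring.
  have : 2 * G x <= c / 2 * expR (K * x).
    rewrite /G mulrA; apply: ler_wpM2r; first exact: expR_ge0.
    rewrite mulrA ler_pdivrMr//.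
    have := mulr_ge0 MN0 c0; rewrite /K; nra.
  lra.
pose c := D * expR (K * L).
have step2 k i x : 0 <= x <= L -> cab (W k.+1 i x - W k i x) <= c / 2 ^+ k.
  move=> xL; apply: (le_trans (step k i x xL)); rewrite /c mulrAC.
  apply: ler_wpM2r; first by rewrite invr_ge0 exprn_ge0.
  apply: ler_wpM2l; first exact: ltW.
  by rewrite ler_expR ler_wpM2l ?(ltW K0)//; case/andP: xL.
(* The iterates are controlled on [0, L] only. Composition with [clamp] extends their limit
   continuously to the whole line, as [pr] requires. *)
have /choice[V HV] (ix : 'I_n * R) : exists l : C, forall k,
    cab (l - W k ix.1 (clamp L ix.2)) <= 4 * c / 2 ^+ k.
  by apply: geometric_limit => k; apply: step2; exact: clamp_in.
pose Vc i x := V (i, x).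
have cV i : continuous (Vc i).
  move=> x; apply/ccvgP => e e0.
  have [k Hk] : exists k, 4 * c / 2 ^+ k <= e / 3.
    apply: contrapT => /forallNP Hk.
    have : e / 3 <= 0.
      by apply: (@le0_geometric _ (4 * c)) => k; rewrite ltW// ltNge; apply/negP/Hk.
    lra.
  have /ccvgP/(_ (e / 3)) : (fun y => W k i (clamp L y)) @ x --> W k i (clamp L x).
    exact: (cvg_comp (clamp L) (W k i) (@clamp_cont L x) (WC k i (clamp L x))).
  rewrite divr_gt0// => /(_ isT); apply: filterS => y Hy.
  have H1 := HV (i, y) k; have H2 := HV (i, x) k.
  have -> : Vc i y - Vc i x = (V (i, y) - W k i (clamp L y)) +
    ((W k i (clamp L y) - W k i (clamp L x)) - (V (i, x) - W k i (clamp L x))).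
    by rewrite /Vc; ring.
  apply: (le_trans (cabD _ _)); have := cabD (W k i (clamp L y) - W k i (clamp L x))
    (- (V (i, x) - W k i (clamp L x))); rewrite cabN.
  move: H1 H2 => /=; lra.
(* One more Picard step turns the merely continuous limit into a differentiable function, which is
   then shown to agree with the limit on [0, L]. *)
pose P i := T Vc i.
have [P0 PD] : (forall i, P i 0 = v i 0) /\
   (forall i x, cderiv (P i) x (\sum_j B x i j * Vc j x)).
  by split => i *; have [] := TP _ cV i; auto.
have PV i x : 0 <= x <= L -> P i x = Vc i x.
  move=> xL; apply/eqP; rewrite -subr_eq0 -cab_eq0 eq_le cab_ge0 andbT.
  have [x0 xL'] := andP xL.
  pose c' := 4 * c * (2 * M * N * L + 1).
  apply: (@le0_geometric _ c') => k.
  have H1 : cab (P i x - W k.+1 i x) <= 2 * (M * N * (4 * c / 2 ^+ k)) * L.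
    have HF y : cderiv (fun y => P i y - W k.+1 i y) y
       (\sum_j B y i j * (Vc j y - W k j y)).
      apply: cderiv_eq (cderivB (PD i y) (WD k i y)) _.
      by rewrite -sumrB; apply: eq_bigr => j _; rewrite mulrBr.
    have := @cder_bound R (fun y => P i y - W k.+1 i y) _ 0 x
      (M * N * (4 * c / 2 ^+ k)) x0 (fun y _ => HF y).
    rewrite P0 W0 subrr !subr0 => H; apply: (le_trans (H _)).
      move=> y /andP[y0 yx].
      have yL : 0 <= y <= L by rewrite (ltW y0) ltW// (lt_le_trans yx).
      apply: le_trans (cab_sum _ _) _.
      have -> : M * N * (4 * c / 2 ^+ k) = \sum_(j < n) (M * (4 * c / 2 ^+ k)).
        by rewrite sumr_const card_ord -mulr_natr -/N; ring.
      apply: ler_sum => j _; rewrite cabM; apply: ler_pM; rewrite ?cab_ge0//.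
        exact: (HM (i, j) y yL).
      by have := HV (j, y) k; rewrite /= clamp_id.
    apply: ler_wpM2l => //.
    have : 0 <= 4 * c / 2 ^+ k.
      by rewrite divr_ge0 ?exprn_ge0// mulr_ge0// mulr_ge0 ?expR_ge0// ltW.
    by move=> ?; rewrite mulr_ge0// mulr_ge0.
  have H2 := HV (i, x) k.+1; rewrite /= clamp_id// in H2.
  have -> : P i x - Vc i x = (P i x - W k.+1 i x) - (V (i, x) - W k.+1 i x).
    by rewrite /Vc; ring.
  apply: (le_trans (cabD _ _)); rewrite cabN.
  have c0 : 0 <= 4 * c / 2 ^+ k.
    by rewrite divr_ge0 ?exprn_ge0// mulr_ge0// mulr_ge0 ?expR_ge0// ltW.
  have E : 4 * c / 2 ^+ k.+1 = 4 * c / 2 ^+ k / 2 by rewrite exprS invfM; ring.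
  have -> : c' / 2 ^+ k = 2 * (M * N * (4 * c / 2 ^+ k)) * L + 4 * c / 2 ^+ k.
    by rewrite /c'; ring.
  rewrite E in H2; lra.
exists (fun x => \col_i P i x); split; first by apply/colP => i; rewrite mxE P0.
move=> x xL; apply/has_derivP => i.
rewrite (_ : (fun y => _) = P i); last by apply/funext => y; rewrite mxE.
apply: cderiv_eq (PD i x) _; rewrite mxE; apply: eq_bigr => j _.
by rewrite mxE PV.
Qed.

Lemma fundamental_exists n (B : R -> 'M[C]_n) (L : R) :
  (forall i j, continuous (fun x => B x i j)) -> 0 <= L ->
  exists M : R -> 'M[C]_n, M 0 = 1%:M /\
    forall x, 0 <= x <= L -> forall v, has_deriv (fun y => M y *m v) x (B x *m (M x *m v)).
Proof.
move=> cB L0.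
have /choice[P HP] (k : 'I_n) := ode_exists (delta_mx k 0 : 'cV_n) cB L0.
exists (fun x => \matrix_(i, k) P k x i 0); split.
  by apply/matrixP => i k; rewrite !mxE (HP k).1 mxE eqxx andbT.
move=> x xL v; apply/has_derivP => i.
rewrite (_ : (fun y => _) = (fun y => \sum_k v k 0 * P k y i 0)); last first.
  by apply/funext => y; rewrite mxE; apply: eq_bigr => k _; rewrite mxE mulrC.
have H k : cderiv (fun y => v k 0 * P k y i 0) x (v k 0 * (B x *m P k x) i 0).
  by apply: cderivZ; have /has_derivP := (HP k).2 x xL; exact.
apply: cderiv_eq (cderiv_bigsum (index_enum 'I_n) (P := xpredT) (fun k _ => H k)) _.
rewrite mulmxA mxE; apply: eq_bigr => k _; rewrite mulrC; congr (_ * _).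
by rewrite !mxE; apply: eq_bigr => j _; rewrite mxE.
Qed.

End ODEExistence.

(** * Cauchy-Binet and Laplace expansions *)

Section Minors.
Variable K : comPzRingType.

(** Cauchy-Binet before terms are collected: multilinearity in the rows alone gives a sum over all
    index functions g, with plain products of entries of V instead of its minors. This suffices for
    bounds and avoids ordered subsets. *)
Lemma det_rowsub_mulmx (p n r : nat) (f : 'I_r -> 'I_p) (V : 'M[K]_(p, n)) (Y : 'M[K]_(n, r)) :
  \det (rowsub f (V *m Y)) =
  \sum_(g : {ffun 'I_r -> 'I_n}) (\prod_i V (f i) (g i)) * \det (rowsub g Y).
Proof.
transitivity (\sum_(s : 'S_r) \sum_(g : {ffun 'I_r -> 'I_n})
    (-1) ^+ s * \prod_i (V (f i) (g i) * Y (g i) (s i))).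
  apply: eq_bigr => s _; rewrite -mulr_sumr; congr (_ * _).
  rewrite -(bigA_distr_bigA (fun i k => V (f i) k * Y k (s i))) /=.
  by apply: eq_bigr => i _; rewrite !mxE.
rewrite exchange_big; apply: eq_bigr => g _; rewrite mulr_sumr.
apply: eq_bigr => s _; rewrite big_split /= mulrCA; congr (_ * (_ * _)).
by apply: eq_bigr => i _; rewrite !mxE.
Qed.

Lemma det_row_mx_col_perm (m r : nat) (M : 'M[K]_(m + r, m)) (N : 'M[K]_(m + r, r))
    (s : 'S_m) (t : 'S_r) :
  \det (row_mx (col_perm s M) (col_perm t N)) = (-1) ^+ s * (-1) ^+ t * \det (row_mx M N).
Proof.
rewrite !col_permE.
have -> : row_mx (M *m perm_mx s^-1) (N *m perm_mx t^-1) =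
    row_mx M N *m block_mx (perm_mx s^-1) 0 0 (perm_mx t^-1).
  by rewrite mul_row_block !mulmx0 addr0 add0r.
by rewrite det_mulmx det_ublock !det_perm !odd_permV mulrC.
Qed.

(* Laplace expansion along a column splitting, symmetrised over the two blocks
   so that every permutation contributes a product of two minors. *)
Lemma laplace_row_mx (m r : nat) (M : 'M[K]_(m + r, m)) (N : 'M[K]_(m + r, r)) :
  (m`! * r`!)%:R * \det (row_mx M N) =
  \sum_(s : 'S_(m + r)) (-1) ^+ s *
     (\det (rowsub (fun i => s (lshift r i)) M) * \det (rowsub (fun j => s (rshift m j)) N)).
Proof.
have signK (k : nat) (s : 'S_k) : (-1) ^+ s * (-1) ^+ s = 1 :> K.
  by rewrite -expr2 sqrr_sign.
transitivity (\sum_(s : 'S_m) \sum_(t : 'S_r) (-1) ^+ s * (-1) ^+ t *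
    \det (row_mx (col_perm s M) (col_perm t N))).
  have E (s : 'S_m) (t : 'S_r) : (-1) ^+ s * (-1) ^+ t *
      \det (row_mx (col_perm s M) (col_perm t N)) = \det (row_mx M N).
    by rewrite det_row_mx_col_perm mulrA mulrACA !signK mulr1 mul1r.
  under eq_bigr do (under eq_bigr do rewrite E).
  by rewrite !sumr_const -mulrnA mulr_natl !card_Sn mulnC.
transitivity (\sum_(u : 'S_(m + r)) \sum_(s : 'S_m) \sum_(t : 'S_r)
    (-1) ^+ u * (((-1) ^+ s * \prod_i M (u (lshift r i)) (s i)) *
    ((-1) ^+ t * \prod_j N (u (rshift m j)) (t j)))).
  rewrite [RHS]exchange_big; apply: eq_bigr => s _.
  rewrite [RHS]exchange_big; apply: eq_bigr => t _.
  rewrite -det_tr mulr_sumr; apply: eq_bigr => u _.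
  rewrite big_split_ord /=.
  have -> : \prod_i (row_mx (col_perm s M) (col_perm t N))^T (lshift r i) (u (lshift r i)) =
     \prod_i M (u (lshift r i)) (s i).
    by apply: eq_bigr => i _; rewrite mxE row_mxEl mxE.
  have -> : \prod_i (row_mx (col_perm s M) (col_perm t N))^T (rshift m i) (u (rshift m i)) =
     \prod_j N (u (rshift m j)) (t j).
    by apply: eq_bigr => i _; rewrite mxE row_mxEr mxE.
  by rewrite mulrCA mulrACA.
apply: eq_bigr => u _.
under eq_bigr do rewrite -mulr_sumr -mulr_sumr.
rewrite -mulr_sumr -mulr_suml; congr (_ * (_ * _)).
  by apply: eq_bigr => s _; congr (_ * _); apply: eq_bigr => i _; rewrite mxE.
by apply: eq_bigr => s _; congr (_ * _); apply: eq_bigr => i _; rewrite mxE.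
Qed.

Lemma det_rowsub_noninj (n r : nat) (f : 'I_r -> 'I_n) (Y : 'M[K]_(n, r)) :
  ~ injective f -> \det (rowsub f Y) = 0.
Proof.
move=> /injectiveP; rewrite /injectiveb /dinjectiveb => /negP/negP.
move=> H; have [i [j [ij E]]] : exists i j, i != j /\ f i = f j.
  apply: contrapT => Hc; move/negP: H; apply; apply/injectiveP => i j E.
  by apply/eqP/negPn/negP => ij; apply: Hc; exists i, j.
by apply: (determinant_alternate ij) => k; rewrite !mxE E.
Qed.

End Minors.

(** * The differential system satisfied by minors *)

Section MinorDerivative.
Variable R : realType.
Local Notation C := R[i].

Lemma cab_det_le n (X : 'M[C]_n) (b : R) :
  (forall i j, cab (X i j) <= b) -> cab (\det X) <= #|'S_n|%:R * b ^+ n.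
Proof.
move=> H; apply: le_trans (cab_sum _ _) _.
rewrite mulr_natl -sumr_const; apply: ler_sum => s _.
rewrite cabM cab_prod cabX cabN cab1 expr1n mul1r -[n in b ^+ n]card_ord -prodr_const.
by apply: ler_prod => i _; rewrite cab_ge0 H.
Qed.

Definition updf (r n : nat) (f : {ffun 'I_r -> 'I_n}) (i : 'I_r) (k : 'I_n) :
  {ffun 'I_r -> 'I_n} := [ffun l => if l == i then k else f l].

Lemma cderiv_det r (X : R -> 'M[C]_r) (H : 'M[C]_r) (x : R) :
  (forall i j, cderiv (fun y => X y i j) x (H i j)) ->
  cderiv (fun y => \det (X y)) x
    (\sum_i \sum_(s : 'S_r) (-1) ^+ s * \prod_k (if k == i then H k (s k) else X x k (s k))).
Proof.
move=> HX; rewrite exchange_big /=.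
apply: cderiv_bigsum => s _; rewrite -mulr_sumr; apply: cderivZ.
apply: (@cderiv_prod R _ (index_enum 'I_r) (fun k y => X y k (s k)) x (fun k => H k (s k))).
  exact: index_enum_uniq.
by move=> i _; exact: HX.
Qed.

(** The system induced on the r-th exterior power: row rates a and column rates b add up along a
    minor, while S replaces one row at a time, expanded by linearity in that row. *)
Lemma minor_cderiv (n r : nat) (Y : R -> 'M[C]_(n, r)) (f : {ffun 'I_r -> 'I_n}) (x : R)
    (a : 'I_n -> C) (b : 'I_r -> C) (S : 'M[C]_n) :
  (forall i j, cderiv (fun y => Y y i j) x
     (a i * Y x i j + (S *m Y x) i j - Y x i j * b j)) ->
  cderiv (fun y => \det (rowsub f (Y y))) x
    ((\sum_i a (f i) - \sum_j b j) * \det (rowsub f (Y x)) +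
     \sum_i \sum_k S (f i) k * \det (rowsub (updf f i k) (Y x))).
Proof.
move=> HY.
have := @cderiv_det r (fun y => rowsub f (Y y))
  (\matrix_(i, j) (a (f i) * Y x (f i) j + (S *m Y x) (f i) j - Y x (f i) j * b j)) x.
move=> /(_ _)/cderiv_eq; apply.
  move=> i j; rewrite mxE (_ : (fun y => _) = (fun y => Y y (f i) j)) //.
  by apply/funext => y; rewrite mxE.
pose p i (s : 'S_r) : C := \prod_(k | k != i) Y x (f k) (s k).
have pE (i : 'I_r) (s : 'S_r) : Y x (f i) (s i) * p i s = \prod_k rowsub f (Y x) k (s k).
  by rewrite [RHS](bigD1 i)//= mxE; congr (_ * _); apply: eq_bigr => k _; rewrite mxE.
have term i : \sum_(s : 'S_r) (-1) ^+ s *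
   \prod_k (if k == i then (\matrix_(i, j) (a (f i) * Y x (f i) j + (S *m Y x) (f i) j - Y x (f i) j * b j)) k (s k)
      else rowsub f (Y x) k (s k)) =
   a (f i) * \det (rowsub f (Y x)) + \sum_k S (f i) k * \det (rowsub (updf f i k) (Y x)) -
   \sum_(s : 'S_r) (-1) ^+ s * ((\prod_k rowsub f (Y x) k (s k)) * b (s i)).
  have -> : \sum_k S (f i) k * \det (rowsub (updf f i k) (Y x)) =
      \sum_(s : 'S_r) (-1) ^+ s * ((S *m Y x) (f i) (s i) * p i s).
    under eq_bigr do rewrite mulr_sumr.
    rewrite exchange_big /=; apply: eq_bigr => s _.
    rewrite mxE mulr_suml mulr_sumr; apply: eq_bigr => k _.
    rewrite (bigD1 i)//= !mxE ffunE eqxx.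
    have -> : \prod_(l | l != i) rowsub (updf f i k) (Y x) l (s l) = p i s.
      by apply: eq_bigr => l li; rewrite mxE ffunE (negbTE li).
    by rewrite mulrCA -mulrA.
  rewrite mulr_sumr -big_split -sumrB /=; apply: eq_bigr => s _.
  rewrite (bigD1 i)//= eqxx mxE.
  have -> : \prod_(k | k != i) (if k == i then (\matrix_(i, j) (a (f i) * Y x (f i) j + (S *m Y x) (f i) j - Y x (f i) j * b j)) k (s k) else rowsub f (Y x) k (s k)) = p i s.
    by apply: eq_bigr => l li; rewrite (negbTE li) mxE.
  rewrite -(pE i) /=; move: ((-1) ^+ _) (p i s) => u v; ring.
rewrite (eq_bigr _ (fun i _ => term i)) sumrB big_split /= -mulr_suml.
rewrite [X in _ - X]exchange_big /=.
(* A permutation meets each column once, so the column rates give the same sum for every [s]. *)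
have -> : \sum_(s : 'S_r) \sum_i (-1) ^+ s * ((\prod_k rowsub f (Y x) k (s k)) * b (s i)) =
   (\sum_j b j) * \det (rowsub f (Y x)).
  rewrite mulr_sumr; apply: eq_bigr => s _.
  rewrite -mulr_sumr -mulr_sumr [\sum_j b j](reindex_inj (@perm_inj _ s)) /=.
  by rewrite mulrA mulrC.
by rewrite mulrBl addrAC.
Qed.

End MinorDerivative.

(** * Rates of minors and monotonicity of their energy *)

Section MinorEstimates.
Variable R : realType.
Local Notation C := R[i].

(** After subtraction of the threshold [t], the largest of the first r values, terms with index
    below r are nonpositive and all others nonnegative, and the indices common to both sums
    cancel. *)
Lemma sum_first_le (n r : nat) (hr : (r <= n)%N) (g : 'I_n -> R) (f : 'I_r -> 'I_n) :
  (forall i j : 'I_n, (i <= j)%N -> g i <= g j) -> injective f ->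
  \sum_(j < r) g (widen_ord hr j) <= \sum_(j < r) g (f j).
Proof.
move=> gm finj.
case: r hr f finj => [|r] hr f finj; first by rewrite !big_ord0.
pose t := g (widen_ord hr ord_max).
have E (h : 'I_r.+1 -> 'I_n) : injective h ->
    \sum_j g (h j) = \sum_(k in [set h j | j : 'I_r.+1]) (g k - t) + t *+ r.+1.
  move=> hinj; rewrite big_imset /=; last by move=> a b _ _; exact: hinj.
  by rewrite sumrB sumr_const card_ord subrK.
rewrite !E//; last by move=> a b /(congr1 val) /= H; exact: val_inj.
rewrite lerD2r.
set S := [set f j | j : _]; set T := [set widen_ord hr j | j : _].
have inT k : (k \in T) = (k < r.+1)%N.
  apply/imsetP/idP => [[j _ ->] /=|kr]; first exact: ltn_ord.
  by exists (Ordinal kr) => //; exact: val_inj.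
rewrite (big_setID S) /= [leRHS](big_setID T) /= finset.setIC.
apply: lerD => //; apply: (@le_trans _ _ 0).
  apply: sumr_le0 => k; rewrite inE inT => /andP[_ kr].
  by rewrite subr_le0; apply: gm; rewrite /= -ltnS.
apply: sumr_ge0 => k; rewrite inE inT -leqNgt => /andP[kr _].
by rewrite subr_ge0; apply: gm => /=; exact: ltnW.
Qed.

Variables (n r : nat) (hr : (r <= n)%N).
Local Notation idx := {ffun 'I_r -> 'I_n}.
Local Notation fst_ j := (widen_ord hr j).

Definition top_sub (M : 'M[C]_n) : 'M[C]_(n, r) := colsub (widen_ord hr) M.

(** Diagonal rate of the minor with rows f, when the j-th column is a solution rescaled by its own
    eigenvalue [mu (fst_ j)]; the leading minor gets rate 0. *)
Definition gexp (mu : 'I_n -> C) (f : idx) : C := \sum_i mu (f i) - \sum_j mu (fst_ j).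

(** A minor is coupled through r rows with n replacements each, every one of size at most kS up to
    the decaying exponential; [3 * #|I|] comes from [energy_lower]. *)
Definition wconst (kS : R) : R := 3 * (r%:R * n%:R * kS) * #|{: idx}|%:R.

(* Ordering the eigenvalues makes every rate [gexp f] of an injective [f] have
   nonnegative real part; minors with a repeated row vanish identically. *)
Lemma minor_energy_mono (mu : 'I_n -> C) (S : R -> 'M[C]_n) (u : idx -> R -> C) (c : idx -> C)
    (alpha kS x1 x2 : R) : 0 < alpha -> 0 <= kS -> x1 <= x2 ->
  (forall i j : 'I_n, (i <= j)%N -> reC (mu i) <= reC (mu j)) ->
  (forall x i k, x1 < x < x2 -> cab (S x i k) <= kS * expR (- alpha * x)) ->
  (forall f x, x1 < x < x2 -> cderiv (u f) x (gexp mu f * u f x +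
      \sum_i \sum_k S x (f i) k * (u (updf f i k) x + c (updf f i k)))) ->
  (forall f, {within `[x1, x2], continuous (u f)}) ->
  (forall (f : idx) x, x1 < x < x2 -> ~ injective f -> u f x = 0) ->
  (energy u x1 + \sum_f cab (c f) ^+ 2) * expR (- (wconst kS / alpha * expR (- alpha * x1))) <=
  (energy u x2 + \sum_f cab (c f) ^+ 2) * expR (- (wconst kS / alpha * expR (- alpha * x2))).
Proof.
move=> a0 k0 x12 mum HS Hu cu Hn.
(* Among the primitives of the required rate this one vanishes at infinity, so the weight stays
   between a positive constant and 1 on the half line. *)
have Hw (x : R) : is_derive x 1 (fun x => - (wconst kS / alpha * expR (- alpha * x)))
    (3 * (r%:R * n%:R * kS * expR (- alpha * x)) * #|{: idx}|%:R).
  have D := is_derive_expR_comp (is_derive_linear (- alpha) x).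
  rewrite (_ : (fun x => _) = - ((wconst kS / alpha) \*: (fun x => expR (- alpha * x)))).
    apply: is_derive_eq; rewrite /GRing.scale /= /wconst.
    by field; rewrite gt_eqF.
  by apply/funext.
apply: (@energy_mono R _ u (fun f x => \sum_i \sum_k S x (f i) k * (u (updf f i k) x + c (updf f i k)))
  (gexp mu) c (fun x => r%:R * n%:R * kS * expR (- alpha * x))) => //.
- by move=> x _; rewrite !mulr_ge0 ?expR_ge0 ?ler0n.
- by apply: (@within_continuous_der _ _ _ _ _ (fun x _ => Hw x)).
- move=> f; have [/injectiveP finj|/injectiveP fN] := boolP (injectiveb f); last first.
    by right => x xb; exact: Hn.
  left; rewrite /gexp reCD reCN !reC_sum subr_ge0.
  exact: (@sum_first_le n r hr (fun i => reC (mu i)) f mum finj).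
- move=> f x xb; set T := \sum_j (cab (u j x) + cab (c j)).
  have T0 : 0 <= T by apply: sumr_ge0 => g _; rewrite addr_ge0 ?cab_ge0.
  have -> : r%:R * n%:R * kS * expR (- alpha * x) * T =
     \sum_(i < r) \sum_(k < n) (kS * expR (- alpha * x) * T).
    rewrite !sumr_const !card_ord -(mulr_natr (_ *+ n)) -(mulr_natr (_ * T)); ring.
  apply: le_trans (cab_sum _ _) _; apply: ler_sum => i _.
  apply: le_trans (cab_sum _ _) _; apply: ler_sum => k _.
  rewrite cabM; apply: ler_pM; rewrite ?cab_ge0//; first exact: HS.
  apply: le_trans (cabD _ _) _; rewrite /T (bigD1 (updf f i k))//= lerDl.
  by apply: sumr_ge0 => g _; rewrite addr_ge0 ?cab_ge0.
Qed.

End MinorEstimates.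

(** * Convergence and comparison of minors on a half line *)

Section HalfLine.
Variable R : realType.
Local Notation C := R[i].

Lemma cderiv_unique (u : R -> C) (x : R) d d' : cderiv u x d -> cderiv u x d' -> d = d'.
Proof.
move=> [H1 H2] [H1' H2']; apply: complex_eq.
  by rewrite -(@derive_val _ _ _ _ _ _ _ H1) -(@derive_val _ _ _ _ _ _ _ H1').
by rewrite -(@derive_val _ _ _ _ _ _ _ H2) -(@derive_val _ _ _ _ _ _ _ H2').
Qed.

Lemma expR_sub1_le (t : R) : 0 <= t -> expR t - 1 <= t * expR t.
Proof.
move=> t0; have := expR_ge1Dx (- t); have := expR_gt0 t => e0.
rewrite expRN => H; have : (1 - t) * expR t <= 1.
  by rewrite -ler_pdivlMr// div1r.
lra.
Qed.

Lemma le_sqr_expR (x c a L : R) : 0 <= c -> x ^+ 2 <= c ^+ 2 * expR (- a * L) ->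
  x <= c * expR (- (a / 2) * L).
Proof.
move=> c0 H; have [x0|x0] := leP x 0.
  by apply: (le_trans x0); rewrite mulr_ge0 ?expR_ge0.
rewrite -(@ler_pXn2r _ 2) ?nnegrE ?(ltW x0) ?mulr_ge0 ?expR_ge0//.
rewrite exprMn -expRM_natl (_ : 2%:R * _ = - a * L) //.
by field.
Qed.

Lemma cvg_csum (T I : Type) (F : set_system T) {FF : Filter F} (s : seq I) (u : I -> T -> C) (l : I -> C) :
  (forall i, u i @ F --> l i) -> (fun x => \sum_(i <- s) u i x) @ F --> \sum_(i <- s) l i.
Proof.
move=> H; elim: s => [|a s IH].
  rewrite big_nil (_ : (fun x => _) = fun=> 0); first exact: cvg_cst.
  by apply/funext => x; rewrite big_nil.
rewrite big_cons (_ : (fun x => _) = (fun x => u a x + \sum_(i <- s) u i x)); first exact: (cvgD (H a) IH).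
by apply/funext => x; rewrite big_cons.
Qed.

Lemma cvg_cprod (T I : Type) (F : set_system T) {FF : Filter F} (s : seq I) (u : I -> T -> C) (l : I -> C) :
  (forall i, u i @ F --> l i) -> (fun x => \prod_(i <- s) u i x) @ F --> \prod_(i <- s) l i.
Proof.
move=> H; elim: s => [|a s IH].
  rewrite big_nil (_ : (fun x => _) = fun=> 1); first exact: cvg_cst.
  by apply/funext => x; rewrite big_nil.
rewrite big_cons (_ : (fun x => _) = (fun x => u a x * \prod_(i <- s) u i x)); first exact: (cvgM (H a) IH).
by apply/funext => x; rewrite big_cons.
Qed.

Lemma cvg_det (T : Type) (F : set_system T) {FF : Filter F} n (X : T -> 'M[C]_n) (X0 : 'M[C]_n) :
  (forall i j, (fun x => X x i j) @ F --> X0 i j) -> (fun x => \det (X x)) @ F --> \det X0.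
Proof.
move=> H; apply: cvg_csum => s; apply: cvgM; first exact: cvg_cst.
by apply: cvg_cprod => i; exact: H.
Qed.

Variables (n r : nat) (hr : (r <= n)%N).
Local Notation idx := {ffun 'I_r -> 'I_n}.
Local Notation fst_ j := (widen_ord hr j).

Definition mnr (Vi : 'M[C]_n) (N : 'I_r -> R -> 'cV[C]_n) (x : R) (f : idx) : C :=
  \det (rowsub f (Vi *m cols (N ^~ x))).
(** In the coordinates of the eigenbasis the limiting columns are the first r unit vectors; these
    are their minors. *)
Definition mnr_lim (f : idx) : C := \det (rowsub f (top_sub hr (1%:M : 'M[C]_n))).

Lemma top_sub1E (i : 'I_n) (j : 'I_r) : top_sub hr (1%:M : 'M[C]_n) i j = (i == fst_ j)%:R.
Proof. by rewrite !mxE. Qed.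

(** The limit is an equilibrium of the uncoupled minor system: the constant matrix of unit vectors
    solves the uncoupled equation, since row and column rates cancel on its nonzero entries, and its
    minors have derivative 0. *)
Lemma gexp_mnr_lim (mu : 'I_n -> C) (f : idx) : gexp hr mu f * mnr_lim f = 0.
Proof.
have := @minor_cderiv R n r (fun=> top_sub hr 1%:M) f 0 mu (fun j => mu (fst_ j)) 0 _.
move=> /(_ _) H; apply/esym; rewrite -[LHS]/(0 : C).
apply: (cderiv_unique (cderiv_cst (mnr_lim f) 0)).
apply: cderiv_eq (H _) _.
  move=> i j; have -> : ((0 : 'M[C]_n) *m top_sub hr (1%:M : 'M[C]_n)) i j = 0.
    by rewrite mul0mx mxE.
  rewrite addr0 top_sub1E.
  have -> : mu i * (i == fst_ j)%:R - (i == fst_ j)%:R * mu (fst_ j) = 0.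
    by case: eqP => [->|_]; rewrite ?mulr1 ?mul1r ?mulr0 ?mul0r subrr.
  exact: cderiv_cst.
have -> : \sum_i \sum_k (0 : 'M[C]_n) (f i) k *
    \det (rowsub (updf f i k) (top_sub hr (1%:M : 'M[C]_n))) = 0.
  by rewrite big1// => i _; rewrite big1// => k _; rewrite mxE mul0r.
by rewrite addr0.
Qed.

Lemma mnr_lim_fst : mnr_lim [ffun j => fst_ j] = 1.
Proof.
rewrite /mnr_lim (_ : rowsub _ _ = 1%:M) ?det1//.
by apply/matrixP => i j; rewrite !mxE ffunE.
Qed.

Lemma mnr_lim_le (f : idx) : cab (mnr_lim f) <= #|'S_r|%:R.
Proof.
have := @cab_det_le R r (rowsub f (top_sub hr (1%:M : 'M[C]_n))) 1.
rewrite expr1n mulr1; apply => i j; rewrite mxE top_sub1E.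
by case: eqP => _; rewrite ?cab1 ?cab0 ?ler01.
Qed.

Lemma mnr_cvg (T : Type) (F : set_system T) {FF : Filter F} (Vi V : 'M[C]_n)
    (N : 'I_r -> T -> 'cV[C]_n) (f : idx) : Vi *m V = 1%:M ->
  (forall j, N j @ F --> col (fst_ j) V) ->
  (fun x => \det (rowsub f (Vi *m cols (N ^~ x)))) @ F --> mnr_lim f.
Proof.
move=> ViV HN; apply: cvg_det => i j.
have -> : rowsub f (top_sub hr (1%:M : 'M[C]_n)) i j = \sum_k Vi (f i) k * V k (fst_ j).
  by rewrite mxE -ViV 2!mxE.
rewrite (_ : (fun x => _) = (fun x => \sum_k Vi (f i) k * N j x k 0)); last first.
  by apply/funext => x; rewrite !mxE; apply: eq_bigr => k _; rewrite !mxE.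
apply: cvg_csum => k; apply: cvgM; first exact: cvg_cst.
by have /mxcvgP/(_ k 0) := HN j; rewrite mxE.
Qed.

Variables (B : R -> 'M[C]_n) (B0 V Vi : 'M[C]_n) (mu : 'I_n -> C) (kap K alpha : R).
Hypotheses (HBV : B0 *m V = V *m diag_mx (\row_i mu i))
  (VVi : V *m Vi = 1%:M) (ViV : Vi *m V = 1%:M)
  (kap0 : 0 <= kap) (K0 : 0 <= K) (alpha0 : 0 < alpha)
  (HV : forall i j, cab (V i j) <= kap) (HVi : forall i j, cab (Vi i j) <= kap)
  (HB : forall x i j, 0 <= x -> cab ((B x - B0) i j) <= K * expR (- alpha * x))
  (mum : forall i j : 'I_n, (i <= j)%N -> reC (mu i) <= reC (mu j)).

Let S x := Vi *m (B x - B0) *m V.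
Let kS := n%:R * (n%:R * (kap * K) * kap).

Let kS0 : 0 <= kS.
Proof. by rewrite /kS !mulr_ge0. Qed.

Let S_le x i k : 0 <= x -> cab (S x i k) <= kS * expR (- alpha * x).
Proof.
move=> x0; rewrite /S mxE; apply: le_trans (cab_sum _ _) _.
have -> : kS * expR (- alpha * x) = \sum_(j < n) (n%:R * (kap * (K * expR (- alpha * x))) * kap).
  by rewrite sumr_const card_ord -mulr_natl /kS; ring.
apply: ler_sum => j _; rewrite cabM; apply: ler_pM; rewrite ?cab_ge0//.
rewrite mxE; apply: le_trans (cab_sum _ _) _.
rewrite mulr_natl -[n in _ *+ n]card_ord -sumr_const; apply: ler_sum => l _.
by rewrite cabM; apply: ler_pM; rewrite ?cab_ge0// HB.
Qed.

(** In the eigenbasis the coefficient matrix splits into the diagonal of eigenvalues and the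
    exponentially small conjugate S of [B x - B0]. *)
Lemma mnr_cderiv (N : 'I_r -> R -> 'cV[C]_n) (x : R) (f : idx) :
  (forall j, has_deriv (N j) x ((B x - (mu (fst_ j))%:M) *m N j x)) ->
  cderiv (fun y => mnr Vi N y f) x (gexp hr mu f * mnr Vi N x f +
    \sum_i \sum_k S x (f i) k * mnr Vi N x (updf f i k)).
Proof.
move=> HN; apply: minor_cderiv => i j.
rewrite (_ : (fun y => _) = (fun y => \sum_k Vi i k * N j y k 0)); last first.
  by apply/funext => y; rewrite !mxE; apply: eq_bigr => k _; rewrite !mxE.
have H k : cderiv (fun y => Vi i k * N j y k 0) x
    (Vi i k * ((B x - (mu (fst_ j))%:M) *m N j x) k 0).
  by apply: cderivZ; have /has_derivP := HN j; exact.
apply: cderiv_eq (cderiv_bigsum (index_enum 'I_n) (P := xpredT) (fun k _ => H k)) _.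
set Nx := cols (N ^~ x).
have colN k : N j x k 0 = Nx k j by rewrite mxE.
have -> : \sum_k Vi i k * ((B x - (mu (fst_ j))%:M) *m N j x) k 0 =
    (Vi *m (B x) *m Nx) i j - (Vi *m Nx) i j * mu (fst_ j).
  rewrite -mulmxA mxE [(Vi *m Nx) i j]mxE mulr_suml -sumrB; apply: eq_bigr => k _.
  rewrite mulmxBl mul_scalar_mx.
  have -> : (B x *m N j x - mu (fst_ j) *: N j x) k 0 = (B x *m Nx) k j - mu (fst_ j) * Nx k j.
    rewrite [LHS]mxE [X in _ + X]mxE [X in _ - X]mxE colN; congr (_ - _).
    by rewrite [LHS]mxE [RHS]mxE; apply: eq_bigr => l _; rewrite colN.
  by rewrite mulrBr -mulrA (mulrC (Nx k j)).
congr (_ - _).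
have -> : Vi *m B x *m Nx = diag_mx (\row_i mu i) *m (Vi *m Nx) + S x *m (Vi *m Nx).
  rewrite -mulmxDl /S mulmxBr mulmxBl -!mulmxA HBV (mulmxA Vi V) ViV mul1mx addrC subrK.
  by rewrite !mulmxA -(mulmxA (Vi *m B x)) VVi mulmx1.
by rewrite mxE mul_diag_mx !mxE.
Qed.

Let within_mnr (N : 'I_r -> R -> 'cV[C]_n) a b (f : idx) :
  (forall j, {within `[a, b], continuous (N j)}) ->
  {within `[a, b], continuous (fun x => mnr Vi N x f)}.
Proof.
move=> cN; apply: within_det; apply: within_mx => i j.
rewrite (_ : (fun y => _) = (fun y => \sum_k Vi (f i) k * N j y k 0)); last first.
  by apply/funext => y; rewrite !mxE; apply: eq_bigr => k _; rewrite !mxE.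
by apply: within_csum => k; apply: within_cM; [exact: within_ccst|exact: within_coord].
Qed.

(** Integral over the half line of the rate allowed by the energy inequality; [expR qconst] bounds
    the total loss through the weight. *)
Definition qconst := wconst n r kS / alpha.
Let q0 : 0 <= qconst.
Proof. by apply: divr_ge0; [rewrite /wconst !mulr_ge0|exact: ltW]. Qed.

Let card_sum (F : idx -> C) c : (forall f, cab (F f) ^+ 2 <= c) ->
  \sum_f cab (F f) ^+ 2 <= #|{: idx}|%:R * c.
Proof. by move=> H; rewrite mulr_natl -sumr_const; apply: ler_sum => f _. Qed.

Let slim := \sum_(f : idx) cab (mnr_lim f) ^+ 2.

(** The weighted energy of the deviation plus [slim] is compared between x and X, and X tends to
    infinity, where the deviation vanishes. What remains is [slim * (expR t - 1)] with t
    proportional to [expR (- alpha * x)], hence linear in the coupling. *)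
Lemma mnr_limit_sqr (N : 'I_r -> R -> 'cV[C]_n) :
  (forall j x, 0 < x -> has_deriv (N j) x ((B x - (mu (fst_ j))%:M) *m N j x)) ->
  (forall j X, {within `[0, X], continuous (N j)}) ->
  (forall j, N j x @[x --> +oo] --> col (fst_ j) V) ->
  forall x f, 0 <= x ->
  cab (mnr Vi N x f - mnr_lim f) ^+ 2 <= slim * (qconst * expR qconst) * expR (- alpha * x).
Proof.
move=> HN cN lN x f x0.
pose u f x := mnr Vi N x f - mnr_lim f.
have E0 X : x <= X -> (energy u x + slim) * expR (- (qconst * expR (- alpha * x))) <=
    energy u X + slim.
  move=> xX.
  have := @minor_energy_mono R n r hr mu S u mnr_lim alpha kS x X alpha0 kS0 xX mum.
  rewrite -/qconst -/slim => H; apply: (le_trans (H _ _ _ _)).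
  - by move=> y i k /andP[xy _]; apply: S_le; rewrite ltW// (le_lt_trans x0).
  - move=> g y /andP[xy _]; have y0 := le_lt_trans x0 xy.
    have := mnr_cderiv g (fun j => HN j y y0).
    move=> /cderivB/(_ (cderiv_cst (mnr_lim g) y)) => D.
    apply: cderiv_eq D _; rewrite subr0 /u mulrBr gexp_mnr_lim subr0; congr (_ + _).
    by apply: eq_bigr => i _; apply: eq_bigr => k _; rewrite subrK.
  - move=> g; apply: within_cB; last exact: within_ccst.
    apply: within_mnr => j; apply: within_sub (cN j X) => //.
  - move=> g y _ ginj; rewrite /u /mnr /mnr_lim !det_rowsub_noninj ?subrr//.
  - rewrite ler_piMr//; first by rewrite addr_ge0 ?energy_ge0// sumr_ge0// => g _; exact: sqr_ge0.
    by rewrite -[leRHS]expR0 ler_expR oppr_le0 mulr_ge0 ?expR_ge0.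
have lE : energy u X @[X --> +oo] --> 0.
  apply/cvgrPdist_le => e e0.
  have d0 : 0 < e / (#|{: idx}|%:R + 1) by rewrite divr_gt0// ltr_wpDl.
  pose d := Num.sqrt (e / (#|{: idx}|%:R + 1)).
  have dp : 0 < d by rewrite sqrtr_gt0.
  have : \forall X \near +oo, forall g : idx, cab (u g X) <= d.
    apply: filter_forall => g.
    have /ccvgP/(_ d dp) : mnr Vi N X g @[X --> +oo] --> mnr_lim g by apply: mnr_cvg ViV lN.
    by apply: filterS => X.
  apply: filterS => X HX; rewrite sub0r normrN ger0_norm ?energy_ge0//.
  apply: (@le_trans _ _ (#|{: idx}|%:R * d ^+ 2)).
    by apply: card_sum => g; rewrite ler_pXn2r ?nnegrE ?cab_ge0 ?(ltW dp)//; exact: HX.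
  rewrite sqr_sqrtr ?(ltW d0)// mulrCA ler_piMr ?(ltW e0)//.
  by rewrite ler_pdivrMr ?ltr_wpDl// mul1r lerDl.
have lE' : energy u X + slim @[X --> +oo] --> 0 + slim by apply: cvgD => //; exact: cvg_cst.
have E1 : (energy u x + slim) * expR (- (qconst * expR (- alpha * x))) <= 0 + slim.
  apply: (cvgr_to_ge lE'); near=> X; apply: E0.
  by near: X; apply: nbhs_pinfty_ge; exact: num_real.
set t := qconst * expR (- alpha * x) in E1.
have t0 : 0 <= t by rewrite /t mulr_ge0 ?expR_ge0 ?q0.
have slim0 : 0 <= slim by apply: sumr_ge0 => g _; exact: sqr_ge0.
have tq : t <= qconst.
  by rewrite ler_piMr ?q0// -[leRHS]expR0 ler_expR mulNr oppr_le0 mulr_ge0// ltW.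
move: E1; rewrite add0r expRN ler_pdivrMr ?expR_gt0// => E1.
apply: le_trans (cab_le_energy u x f) _.
have H1 : energy u x <= slim * (expR t - 1) by rewrite mulrBr mulr1; lra.
apply: (le_trans H1); rewrite -mulrA; apply: ler_wpM2l => //.
apply: (le_trans (expR_sub1_le t0)); rewrite /t mulrAC; apply: ler_wpM2r; first exact: expR_ge0.
by apply: ler_wpM2l; rewrite ?q0// ler_expR.
Unshelve. all: by end_near. Qed.

(** Square root of the bound in [mnr_limit_sqr], with [slim] estimated through the Leibniz formula,
    which has [#|'S_r|] terms. *)
Definition minor_const : R :=
  Num.sqrt (#|{: idx}|%:R * #|'S_r|%:R ^+ 2 * (qconst * expR qconst)).

Let minor_const0 : 0 <= minor_const. Proof. exact: sqrtr_ge0. Qed.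

Lemma mnr_limit (N : 'I_r -> R -> 'cV[C]_n) :
  (forall j x, 0 < x -> has_deriv (N j) x ((B x - (mu (fst_ j))%:M) *m N j x)) ->
  (forall j X, {within `[0, X], continuous (N j)}) ->
  (forall j, N j x @[x --> +oo] --> col (fst_ j) V) ->
  forall x f, 0 <= x ->
  cab (mnr Vi N x f - mnr_lim f) <= minor_const * expR (- (alpha / 2) * x).
Proof.
move=> HN cN lN x f x0; apply: le_sqr_expR => //.
apply: (le_trans (mnr_limit_sqr HN cN lN f x0)).
apply: ler_wpM2r; first exact: expR_ge0.
have qq : 0 <= qconst * expR qconst by rewrite mulr_ge0 ?expR_ge0 ?q0.
rewrite sqr_sqrtr; last by rewrite mulr_ge0// mulr_ge0// sqr_ge0.
apply: ler_wpM2r => //; apply: card_sum => g.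
by rewrite ler_pXn2r ?nnegrE ?cab_ge0 ?ler0n// mnr_lim_le.
Qed.

(** Both families of minors solve the same homogeneous system, so the energy of their difference at
    0 is at most [expR qconst] times that at L. At L the approximate minors equal the limit, and
    [mnr_limit] bounds the difference there. *)
Lemma mnr_compare (N NL : 'I_r -> R -> 'cV[C]_n) (L : R) : 0 <= L ->
  (forall j x, 0 < x -> has_deriv (N j) x ((B x - (mu (fst_ j))%:M) *m N j x)) ->
  (forall j X, {within `[0, X], continuous (N j)}) ->
  (forall j, N j x @[x --> +oo] --> col (fst_ j) V) ->
  (forall j x, 0 < x < L -> has_deriv (NL j) x ((B x - (mu (fst_ j))%:M) *m NL j x)) ->
  (forall j, {within `[0, L], continuous (NL j)}) ->
  (forall f, mnr Vi NL L f = mnr_lim f) ->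
  forall f, cab (mnr Vi N 0 f - mnr Vi NL 0 f) <=
    Num.sqrt (expR qconst * #|{: idx}|%:R) * minor_const * expR (- (alpha / 2) * L).
Proof.
move=> L0 HN cN lN HNL cNL EL f.
apply: le_sqr_expR; first by rewrite mulr_ge0// sqrtr_ge0.
pose u f x := mnr Vi N x f - mnr Vi NL x f.
have := @minor_energy_mono R n r hr mu S u (fun=> 0) alpha kS 0 L alpha0 kS0 L0 mum.
have -> : \sum_(f : idx) cab (0 : C) ^+ 2 = 0.
  by rewrite big1// => i _; rewrite cab0 expr0n.
rewrite !addr0 -/qconst mulr0 expR0 mulr1 => H.
have {H} H : energy u 0 * expR (- qconst) <= energy u L.
  apply: le_trans (H _ _ _ _) _.
  - by move=> y i k /andP[y0 _]; apply: S_le; exact: ltW.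
  - move=> g y yL; have y0 : 0 < y by case/andP: yL.
    have D1 := mnr_cderiv g (fun j => HN j y y0).
    have D2 := mnr_cderiv g (fun j => HNL j y yL).
    apply: cderiv_eq (cderivB D1 D2) _.
    rewrite opprD addrACA -mulrBr; congr (_ + _).
    rewrite -sumrB; apply: eq_bigr => i _; rewrite -sumrB; apply: eq_bigr => k _.
    by rewrite addr0 -mulrBr.
  - by move=> g; apply: within_cB; apply: within_mnr => j; [exact: cN|exact: cNL].
  - by move=> g y _ ginj; rewrite /u /mnr !det_rowsub_noninj ?subrr.
  - rewrite ler_piMr ?energy_ge0// -[leRHS]expR0 ler_expR oppr_le0.
    by rewrite mulr_ge0 ?expR_ge0 ?q0.
have HL : energy u L <= #|{: idx}|%:R * (minor_const ^+ 2 * expR (- alpha * L)).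
  apply: card_sum => g; rewrite /u EL.
  have := mnr_limit HN cN lN g L0 => HH.
  have -> : expR (- alpha * L) = expR (- (alpha / 2) * L) ^+ 2.
    by rewrite -expRM_natl; congr expR; field.
  by rewrite -exprMn ler_pXn2r ?nnegrE ?cab_ge0// mulr_ge0 ?expR_ge0.
apply: le_trans (cab_le_energy u 0 f) _.
rewrite expRN ler_pdivrMr ?expR_gt0// in H.
apply: (le_trans H); apply: le_trans (ler_wpM2r (expR_ge0 _) HL) _.
have E : Num.sqrt (expR qconst * #|{: idx}|%:R) ^+ 2 = expR qconst * #|{: idx}|%:R.
  by rewrite sqr_sqrtr// mulr_ge0 ?expR_ge0.
rewrite exprMn E.
by rewrite le_eqVlt; apply/orP; left; apply/eqP; ring.
Qed.

End HalfLine.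

(** * Goursat's theorem for closed forms on rectangles *)

Section Goursat.
Variable R : realType.
Implicit Types (P Q : R -> R -> R) (u : R -> R).

Definition primitive u : R -> R :=
  if pselect (continuous u) is left cu then sval (cid (ex_primitive cu)) else cst 0.

(** Integrals are increments of one chosen primitive, so additivity over subintervals is a ring
    identity. *)
Definition rint u (a b : R) : R := primitive u b - primitive u a.

Lemma primitiveP u (x : R) : continuous u -> is_derive x 1 (primitive u) (u x).
Proof.
by move=> cu; rewrite /primitive; case: pselect => // cu'; case: cid => F /= HF.
Qed.

Lemma rint_approx u (F f : R -> R) (a b e : R) : continuous u -> a <= b ->
  (forall x : R, is_derive x 1 F (f x)) ->
  (forall x, a <= x <= b -> `|u x - f x| <= e) ->
  `|rint u a b - (F b - F a)| <= e * (b - a).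
Proof.
move=> cu ab HF H.
have HD (x : R) : is_derive x 1 (primitive u - F) (u x - f x).
  by have ? := primitiveP x cu; have ? := HF x; exact: is_deriveB.
have -> : rint u a b - (F b - F a) = (primitive u - F) b - (primitive u - F) a.
  by rewrite /rint /=; rewrite !fctE; ring.
apply: (der_bound (df := fun x => u x - f x)) => //.
  by apply: (within_continuous_der (df := fun x => u x - f x)).
by move=> x /andP[ax xb]; apply: H; rewrite !ltW.
Qed.

Definition loop P Q a b c d : R :=
  rint (fun x => P x c) a b + rint (Q b) c d - rint (fun x => P x d) a b - rint (Q a) c d.

Lemma loop_split P Q a m b c k d :
  loop P Q a b c d = loop P Q a m c k + loop P Q m b c k + loop P Q a m k d + loop P Q m b k d.
Proof. by rewrite /loop /rint; ring. Qed.

(* Frechet differentiability at (x, y) of the coefficients of a form P dx + Q dy,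
   with d_y P = d_x Q there. *)
Definition closed_at P Q (x y : R) : Prop :=
  exists p1 p2 q2 : R, forall e : R, 0 < e -> exists2 d : R, 0 < d &
    forall x' y', `|x' - x| <= d -> `|y' - y| <= d ->
      `|P x' y' - (P x y + p1 * (x' - x) + p2 * (y' - y))| <= e * (`|x' - x| + `|y' - y|) /\
      `|Q x' y' - (Q x y + p2 * (x' - x) + q2 * (y' - y))| <= e * (`|x' - x| + `|y' - y|).

Lemma is_derive_quad (k0 k1 x0 x : R) :
  is_derive x 1 (fun x : R => k0 * x + k1 * ((x - x0) * (x - x0) / 2)) (k0 + k1 * (x - x0)).
Proof.
pose g (y : R) := y - x0.
have D : is_derive x 1 g 1.
  by rewrite -[X in is_derive _ _ _ X]subr0; apply: is_deriveB.
rewrite (_ : (fun x => _) = (k0 \*: (id : R -> R)) + (k1 / 2) \*: (g * g)).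
  by apply: is_derive_eq; rewrite /GRing.scale /= /g; field.
apply/funext => y.
rewrite -[RHS]/(k0 * y + k1 / 2 * ((y - x0) * (y - x0))).
by field.
Qed.

(** The linearised form is exact and contributes nothing. The remainder is at most e s on each side,
    s being half the perimeter, and the sides have total length 2 s. *)
Lemma closed_at_loop P Q (x y e : R) :
  (forall c, continuous (P^~ c)) -> (forall a, continuous (Q a)) ->
  closed_at P Q x y -> 0 < e -> exists2 dl : R, 0 < dl &
    forall a b c d, a <= x <= b -> c <= y <= d -> b - a <= dl -> d - c <= dl ->
    `|loop P Q a b c d| <= 2 * e * ((b - a) + (d - c)) ^+ 2.
Proof.
move=> cP cQ [p1 [p2 [q2 H]]] e0; have [dl dl0 {}H] := H e e0.
exists dl => // a b c d /andP[ax xb] /andP[cy yd] ba dc.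
have ab : a <= b by exact: le_trans ax xb.
have cd : c <= d by exact: le_trans cy yd.
set s := (b - a) + (d - c).
have xin x' : a <= x' <= b -> `|x' - x| <= b - a.
  by move=> /andP[? ?]; rewrite ler_norml; apply/andP; split; lra.
have yin y' : c <= y' <= d -> `|y' - y| <= d - c.
  by move=> /andP[? ?]; rewrite ler_norml; apply/andP; split; lra.
pose FP y' x' := (P x y + p2 * (y' - y)) * x' + p1 * ((x' - x) * (x' - x) / 2).
pose FQ x' y' := (Q x y + p2 * (x' - x)) * y' + q2 * ((y' - y) * (y' - y) / 2).
have eP y' : c <= y' <= d -> `|rint (fun x => P x y') a b - (FP y' b - FP y' a)| <= e * s * (b - a).
  move=> y'in; apply: (rint_approx (cP y') ab (fun x' => is_derive_quad _ p1 x x')).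
  move=> x' x'in; have [] := H x' y' (le_trans (xin _ x'in) ba) (le_trans (yin _ y'in) dc).
  rewrite (_ : P x y + p1 * (x' - x) + p2 * (y' - y) = P x y + p2 * (y' - y) + p1 * (x' - x)); last ring.
  move=> /le_trans K _; apply: K; apply: ler_wpM2l; first exact: ltW.
  by rewrite /s lerD// ?xin ?yin.
have eQ x' : a <= x' <= b -> `|rint (Q x') c d - (FQ x' d - FQ x' c)| <= e * s * (d - c).
  move=> x'in; apply: (rint_approx (cQ x') cd (fun y' => is_derive_quad _ q2 y y')).
  move=> y' y'in; have [_] := H x' y' (le_trans (xin _ x'in) ba) (le_trans (yin _ y'in) dc).
  move=> /le_trans K; apply: K; apply: ler_wpM2l; first exact: ltW.
  by rewrite /s lerD// ?xin ?yin.
(* Here the equality of the mixed coefficients, the shared [p2], is used. *)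
have cancel : (FP c b - FP c a) + (FQ b d - FQ b c) - (FP d b - FP d a) - (FQ a d - FQ a c) = 0.
  by rewrite /FP /FQ; ring.
have h1 := eP c; have h2 := eP d; have h3 := eQ a; have h4 := eQ b.
rewrite !lexx ?ab ?cd in h1 h2 h3 h4.
move: (h1 isT) (h2 isT) (h3 isT) (h4 isT) => {h1 h2 h3 h4}.
rewrite /loop; set i1 := rint _ a b; set i2 := rint (Q b) _ _; set i3 := rint _ a b.
set i4 := rint _ _ _; rewrite !ler_norml => /andP[h1 h1'] /andP[h3 h3'] /andP[h4 h4'] /andP[h2 h2'].
have -> : 2 * e * s ^+ 2 = 2 * (e * s * (b - a)) + 2 * (e * s * (d - c)) by rewrite /s; ring.
apply/andP; split; lra.
Qed.

Lemma nested_point (lo hi : nat -> R) :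
  (forall k, lo k <= hi k) -> (forall k, lo k <= lo k.+1) -> (forall k, hi k.+1 <= hi k) ->
  exists x, forall k, lo k <= x <= hi k.
Proof.
move=> lohi los his.
have lom : {homo lo : i j / (i <= j)%N >-> i <= j} by apply: homo_leq => // x y z; exact: le_trans.
have him : {homo hi : i j / (i <= j)%N >-> j <= i}.
  by apply: homo_leq => // x y z yx zy; exact: le_trans zy yx.
have cross i j : lo i <= hi j.
  by rewrite (le_trans (lom _ _ (leq_maxl i j)))// (le_trans (lohi _))// him// leq_maxr.
exists (sup (range lo)) => k; apply/andP; split.
  by apply: ub_le_sup; [exists (hi 0%N) => _ [i _ <-]|exists k].
by apply: ge_sup; [exists (lo 0%N); exists 0%N|move=> _ [i _ <-]].
Qed.

(** Bisection: one of the four quarters carries at least a quarter of the loop integral. The factor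
    4^k cancels the quadratic smallness of the loop at the common point of the nested rectangles. *)
Lemma goursat P Q (a b c d : R) : a <= b -> c <= d ->
  (forall c, continuous (P^~ c)) -> (forall a, continuous (Q a)) ->
  (forall x y, a <= x <= b -> c <= y <= d -> closed_at P Q x y) ->
  loop P Q a b c d = 0.
Proof.
move=> ab cd cP cQ H.
pose w k : R := (b - a) / 2 ^+ k; pose h k : R := (d - c) / 2 ^+ k.
have wS k : w k = w k.+1 + w k.+1 by rewrite /w exprS invfM; field.
have hS k : h k = h k.+1 + h k.+1 by rewrite /h exprS invfM; field.
have w0 k : 0 <= w k by rewrite divr_ge0 ?exprn_ge0 ?subr_ge0.
have h0 k : 0 <= h k by rewrite divr_ge0 ?exprn_ge0 ?subr_ge0.
pose J k (p : R * R) := loop P Q p.1 (p.1 + w k) p.2 (p.2 + h k).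
have /choice[st Hst] (kp : nat * (R * R)) : exists q : R * R,
   [/\ kp.2.1 <= q.1 <= kp.2.1 + w kp.1.+1, kp.2.2 <= q.2 <= kp.2.2 + h kp.1.+1 &
    `|J kp.1 kp.2| <= 4 * `|J kp.1.+1 q|].
  case: kp => k [x y] /=.
  have E := loop_split P Q x (x + w k.+1) (x + w k) y (y + h k.+1) (y + h k).
  have wk := w0 k.+1; have hk := h0 k.+1.
  apply: contrapT => /forallNP Hn.
  have N q1 q2 : x <= q1 <= x + w k.+1 -> y <= q2 <= y + h k.+1 ->
     4 * `|J k.+1 (q1, q2)| < `|J k (x, y)|.
    by move=> i1 i2; rewrite ltNge; apply/negP => K; apply: (Hn (q1, q2)); split.
  have N1 := N x y; have N2 := N (x + w k.+1) y; have N3 := N x (y + h k.+1).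
  have N4 := N (x + w k.+1) (y + h k.+1).
  rewrite !lexx !lerDl wk hk /= in N1 N2 N3 N4.
  move: (N1 isT isT) (N2 isT isT) (N3 isT isT) (N4 isT isT).
  rewrite /J /= -!addrA -wS -hS E.
  set j1 := loop _ _ _ _ _ _; set j2 := loop _ _ _ _ _ _; set j3 := loop _ _ _ _ _ _.
  set j4 := loop _ _ _ _ _ _.
  have := ler_normD (j1 + j2 + j3) j4; have := ler_normD (j1 + j2) j3; have := ler_normD j1 j2.
  lra.
pose s := fix s k : R * R := if k is k'.+1 then st (k', s k') else (a, c).
have [x0 Hx0] : exists x0, forall k, (s k).1 <= x0 <= (s k).1 + w k.
  apply: nested_point => k; rewrite ?lerDl//.
    by have [/andP[]] := Hst (k, s k).
  by have [/andP[_ K] _ _] := Hst (k, s k); rewrite [in leRHS]wS addrA lerD2r.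
have [y0 Hy0] : exists y0, forall k, (s k).2 <= y0 <= (s k).2 + h k.
  apply: nested_point => k; rewrite ?lerDl//.
    by have [_ /andP[]] := Hst (k, s k).
  by have [_ /andP[_ K] _] := Hst (k, s k); rewrite [in leRHS]hS addrA lerD2r.
have cl : closed_at P Q x0 y0.
  have := Hx0 0%N; have := Hy0 0%N; rewrite /= /w /h expr0 !divr1 !(addrC _ (_ - _)) !subrK.
  by move=> ? ?; exact: H.
have JS k : `|loop P Q a b c d| <= 4 ^+ k * `|J k (s k)|.
  elim: k => [|k IH].
    by rewrite /J /= /w /h !expr0 mul1r !divr1 (addrC a) subrK (addrC c) subrK.
  apply: (le_trans IH); rewrite exprSr -mulrA; apply: ler_wpM2l; first exact: exprn_ge0.
  by have [] := Hst (k, s k).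
apply/eqP; rewrite -normr_le0; apply/ler_addgt0Pl => e e0; rewrite addr0.
pose D := (b - a) + (d - c).
have D0 : 0 <= D by rewrite addr_ge0 ?subr_ge0.
(* Chosen so that [2 * e' * D ^+ 2 <= e], also when the rectangle is degenerate. *)
pose e' := e / (2 * (D ^+ 2 + 1)).
have De : 0 < 2 * (D ^+ 2 + 1) by rewrite mulr_gt0// ltr_wpDl ?sqr_ge0.
have e'0 : 0 < e' by rewrite divr_gt0.
have [dl dl0 Hdl] := closed_at_loop cP cQ cl e'0.
have [k Hk] : exists k, D / 2 ^+ k <= dl.
  apply: contrapT => /forallNP Hk.
  have : dl <= 0 by apply: (@le0_geometric R dl D) => k; rewrite ltW// ltNge; apply/negP/Hk.
  by rewrite leNgt dl0.
have DE : D / 2 ^+ k = w k + h k by rewrite /D mulrDl.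
apply: (le_trans (JS k)).
have := Hdl _ _ _ _ (Hx0 k) (Hy0 k).
rewrite ![_ + _ - _]addrAC !subrr !add0r => K.
have {}K : `|J k (s k)| <= 2 * e' * (w k + h k) ^+ 2.
  by apply: K; have := w0 k; have := h0 k; rewrite DE in Hk; lra.
apply: (@le_trans _ _ (4 ^+ k * (2 * e' * (w k + h k) ^+ 2))).
  by apply: ler_wpM2l => //; exact: exprn_ge0.
rewrite -DE.
have -> : 4 ^+ k * (2 * e' * (D / 2 ^+ k) ^+ 2) = 2 * e' * D ^+ 2.
  have -> : (4 : R) ^+ k = 2 ^+ k * 2 ^+ k by rewrite -exprMn; congr (_ ^+ _); ring.
  by field; rewrite expf_neq0.
have -> : 2 * e' * D ^+ 2 = e * (D ^+ 2 / (D ^+ 2 + 1)).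
  by rewrite /e'; field; rewrite gt_eqF// ltr_wpDl ?sqr_ge0.
rewrite ler_piMr ?(ltW e0)// ler_pdivrMr ?ltr_wpDl ?sqr_ge0//.
by rewrite mul1r lerDl.
Qed.

End Goursat.

(** * Complex differentiability and the exponential function *)

Section Holomorphic.
Variable R : realType.
Local Notation C := R[i].
Implicit Types (f g : C -> C) (z w : C).

Lemma for_cD f g z : {for z, continuous f} -> {for z, continuous g} ->
  {for z, continuous (fun w => f w + g w)}.
Proof. by move=> Hf Hg; exact: (@cvgD _ _ _ (nbhs z) (nbhs_filter z) f g (f z) (g z) Hf Hg). Qed.

Lemma for_cM f g z : {for z, continuous f} -> {for z, continuous g} ->
  {for z, continuous (fun w => f w * g w)}.
Proof. by move=> Hf Hg; exact: (@cvgM _ _ (nbhs z) (nbhs_filter z) f g (f z) (g z) Hf Hg). Qed.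

Lemma for_cst (c : C) z : {for z, continuous (fun _ : C => c)}.
Proof. exact: (@cvg_cst _ c _ (nbhs z) (nbhs_filter z)). Qed.

Lemma for_id z : {for z, continuous (fun w : C => w)}.
Proof. exact: cvg_id. Qed.

(* Caratheodory's formulation of complex differentiability. *)
Definition holo_at f z (d : C) : Prop := exists phi : C -> C,
  [/\ {for z, continuous phi}, phi z = d & forall w, f w - f z = phi w * (w - z)].

Lemma holo_continuous f z d : holo_at f z d -> {for z, continuous f}.
Proof.
move=> [phi [cphi _ E]].
have -> : f = (fun w => phi w * (w - z) + f z).
  by apply/funext => w; rewrite -E subrK.
apply: for_cD; last exact: for_cst.
by apply: for_cM; [exact: cphi|apply: for_cD; [exact: for_id|exact: for_cst]].
Qed.

Lemma holo_cst c z : holo_at (fun=> c) z 0.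
Proof. by exists (fun=> 0); split => // [|w]; [exact: for_cst|rewrite mul0r subrr]. Qed.

Lemma holo_id z : holo_at id z 1.
Proof. by exists (fun=> 1); split => // [|w]; [exact: for_cst|rewrite mul1r]. Qed.

Lemma holoD f g z d e : holo_at f z d -> holo_at g z e -> holo_at (fun w => f w + g w) z (d + e).
Proof.
move=> [p [cp pz pE]] [q [cq qz qE]]; exists (fun w => p w + q w); split.
- exact: for_cD.
- by rewrite pz qz.
- by move=> w; rewrite mulrDl -pE -qE; ring.
Qed.

Lemma holoM f g z d e : holo_at f z d -> holo_at g z e ->
  holo_at (fun w => f w * g w) z (d * g z + f z * e).
Proof.
move=> Hf [q [cq qz qE]]; have cf := holo_continuous Hf.
have [p [cp pz pE]] := Hf; exists (fun w => p w * g z + f w * q w); split.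
- apply: for_cD; first by apply: for_cM; [exact: cp|exact: for_cst].
  by apply: for_cM; [exact: cf|exact: cq].
- by rewrite pz qz.
- move=> w; rewrite mulrDl (mulrAC (p w)) -pE -mulrA -qE; ring.
Qed.

Lemma holoZ c f z d : holo_at f z d -> holo_at (fun w => c * f w) z (c * d).
Proof. by move=> /(holoM (holo_cst c z)); rewrite mul0r add0r. Qed.

Lemma holoB f g z d e : holo_at f z d -> holo_at g z e -> holo_at (fun w => f w - g w) z (d - e).
Proof.
move=> Hf /(holoZ (-1)) Hg; have := holoD Hf Hg; rewrite mulN1r.
by congr holo_at; apply/funext => w; rewrite mulN1r.
Qed.

Lemma holo_comp f g z d e : holo_at g z e -> holo_at f (g z) d ->
  holo_at (fun w => f (g w)) z (d * e).
Proof.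
move=> Hg [p [cp pz pE]]; have cg := holo_continuous Hg.
have [q [cq qz qE]] := Hg; exists (fun w => p (g w) * q w); split.
- apply: for_cM; last exact: cq.
  exact: (@cvg_comp _ _ _ g p (nbhs z) _ _ cg cp).
- by rewrite pz qz.
- by move=> w; rewrite pE qE mulrA.
Qed.

Lemma holo_sum (I : Type) (s : seq I) (F : I -> C -> C) z (d : I -> C) :
  (forall i, holo_at (F i) z (d i)) ->
  holo_at (fun w => \sum_(i <- s) F i w) z (\sum_(i <- s) d i).
Proof.
move=> H; elim: s => [|a s IH].
  rewrite big_nil (_ : (fun w => _) = fun=> 0); first exact: holo_cst.
  by apply/funext => w; rewrite big_nil.
rewrite big_cons (_ : (fun w => _) = (fun w => F a w + \sum_(i <- s) F i w)).
  exact: holoD (H a) IH.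
by apply/funext => w; rewrite big_cons.
Qed.

Lemma holo_prod (I : Type) (s : seq I) (F : I -> C -> C) z :
  (forall i, exists d, holo_at (F i) z d) ->
  exists d, holo_at (fun w => \prod_(i <- s) F i w) z d.
Proof.
move=> H; elim: s => [|a s [e IH]].
  exists 0; rewrite (_ : (fun w => _) = fun=> 1); first exact: holo_cst.
  by apply/funext => w; rewrite big_nil.
have [d Ha] := H a.
rewrite (_ : (fun w => _) = (fun w => F a w * \prod_(i <- s) F i w)).
  by eexists; exact: holoM Ha IH.
by apply/funext => w; rewrite big_cons.
Qed.

Lemma near_cab_ex z (P : C -> Prop) :
  (\forall w \near z, P w) -> exists2 r : R, 0 < r & forall w, cab (w - z) < r -> P w.
Proof.
move=> /(@nbhs_ballP _ C) [e /= /rC_gt0_ex[r r0 ->] H]; exists r => // w wr.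
have zw : `|z - w| < rC r by rewrite cabE rC_lt cabB.
exact: H.
Qed.

Lemma near_cab_lt z (r : R) : 0 < r -> \forall w \near z, cab (w - z) < r.
Proof.
move=> r0; have r2 : 0 < r / 2 by rewrite divr_gt0.
apply: (@filterS _ (nbhs z) (nbhs_filter z) _ _ _ (near_cab z r2)) => w; lra.
Qed.

Lemma for_continuousP (phi : C -> C) z : {for z, continuous phi} <->
  forall e : R, 0 < e -> exists2 d : R, 0 < d & forall w, cab (w - z) < d -> cab (phi w - phi z) <= e.
Proof.
split=> [H e e0|H].
  by apply: near_cab_ex; exact: (@ccvgP R C (nbhs z) (nbhs_filter z) phi (phi z)).1.
apply: (@ccvgP R C (nbhs z) (nbhs_filter z) phi (phi z)).2 => e e0.
have [d d0 Hd] := H e e0.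
by apply: (@filterS _ (nbhs z) (nbhs_filter z) _ _ _ (near_cab_lt z d0)) => w; exact: Hd.
Qed.

Lemma holo_atP f z d : holo_at f z d <->
  forall e : R, 0 < e -> exists2 dl : R, 0 < dl &
    forall w, cab (w - z) < dl -> cab (f w - f z - d * (w - z)) <= e * cab (w - z).
Proof.
split=> [[phi [/for_continuousP cphi pz pE]] e e0|H].
  have [dl dl0 Hd] := cphi e e0; exists dl => // w wd.
  by rewrite pE -mulrBl -pz cabM; apply: ler_wpM2r; [exact: cab_ge0|exact: Hd].
exists (fun w => if w == z then d else (f w - f z) / (w - z)); split.
- apply/for_continuousP => e e0; have [dl dl0 Hd] := H e e0; exists dl => // w wd.
  rewrite eqxx; case: eqP => [_|/eqP wz]; first by rewrite subrr cab0 ltW.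
  have wz0 : w - z != 0 by rewrite subr_eq0.
  rewrite -[X in _ - X](mulfK wz0) -mulrBl cabM cabV ler_pdivrMr ?cab_gt0//.
  exact: Hd.
- by rewrite eqxx.
- move=> w; case: eqP => [->|/eqP wz]; first by rewrite !subrr mulr0.
  by rewrite divfK// subr_eq0.
Qed.

Lemma holo_derivable f z d : holo_at f z d -> derivable f z 1.
Proof.
move=> /holo_atP H; apply/cvg_ex; exists d.
apply: (@ccvgP R C (dnbhs (0 : C)) _ _ d).2 => e e0.
have [dl dl0 Hd] := H e e0.
suff : \forall h \near nbhs (0 : C), h != 0 ->
   cab (h^-1 *: ((f \o shift z) (h *: 1) - f z) - d) <= e by [].
apply: (@filterS _ (nbhs (0 : C)) (nbhs_filter 0) _ _ _ (near_cab_lt 0 dl0)) => h.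
rewrite subr0 => hd h0.
have -> : h^-1 *: ((f \o shift z) (h *: 1) - f z) - d =
    h^-1 * (f (h + z) - f z - d * ((h + z) - z)).
  by rewrite addrK mulrBr (mulrCA _ d) mulVf// mulr1 /= [h *: 1]mulr1.
rewrite cabM cabV mulrC ler_pdivrMr ?cab_gt0//.
by have := Hd (h + z); rewrite addrK; apply.
Qed.

Lemma derivable_holo f z : derivable f z 1 -> exists d, holo_at f z d.
Proof.
move=> /cvg_ex[d Hd]; exists d; apply/holo_atP => e e0.
have : \forall h \near nbhs (0 : C), h != 0 ->
   cab (h^-1 *: ((f \o shift z) (h *: 1) - f z) - d) <= e.
  exact: ((@ccvgP R C (dnbhs (0 : C)) _ _ d).1 Hd e e0).
move=> /near_cab_ex[dl dl0 H]; exists dl => // w wd.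
have [->|wz] := eqVneq w z; first by rewrite !subrr mulr0 subr0 cab0 mulr0.
have wz0 : w - z != 0 by rewrite subr_eq0.
have := H (w - z); rewrite subr0 => /(_ wd wz0).
rewrite /= [_ *: 1]mulr1 subrK => K.
have -> : f w - f z - d * (w - z) = ((w - z)^-1 *: (f w - f z) - d) * (w - z).
  by rewrite mulrBl [_ *: _]mulrC divfK.
by rewrite cabM; apply: ler_wpM2r; [exact: cab_ge0|exact: K].
Qed.

Lemma cexpD z w : cexp (z + w) = cexp z * cexp w.
Proof.
by rewrite /cexp reCD imCD expRD cosD sinD; apply: complex_eq;
  rewrite !(reCM, imCM, reCD, imCD, reC_rC, imC_rC) /=; ring.
Qed.

Lemma cexp_re z : reC (cexp z) = expR (reC z) * cos (imC z).
Proof. by rewrite /cexp !(reCM, imCM, reCD, imCD, reC_rC, imC_rC) /=; ring. Qed.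

Lemma cexp_im z : imC (cexp z) = expR (reC z) * sin (imC z).
Proof. by rewrite /cexp !(reCM, imCM, reCD, imCD, reC_rC, imC_rC) /=; ring. Qed.

Lemma cexp0 : cexp (0 : C) = 1.
Proof.
by apply: complex_eq; rewrite ?cexp_re ?cexp_im /= expR0 ?cos0 ?sin0 mul1r.
Qed.

Lemma cab_cexp z : cab (cexp z) = expR (reC z).
Proof.
apply/eqP; rewrite -(@eqrXn2 _ 2) ?cab_ge0 ?expR_ge0// sqr_cab cexp_re cexp_im.
by rewrite !exprMn -mulrDr cos2Dsin2 mulr1.
Qed.

Lemma cexp_neq0 z : cexp z != 0.
Proof. by rewrite -cab_eq0 cab_cexp gt_eqF ?expR_gt0. Qed.

Lemma cexp_continuous : continuous (@cexp R).
Proof.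
move=> z; have rz := @reC_continuous R z; have iz := @imC_continuous R z.
apply: (@cvg_reim R C (nbhs z) (nbhs_filter z)).
  rewrite (_ : (fun x => _) = (fun x => expR (reC x) * cos (imC x))); last first.
    by apply/funext => x; rewrite cexp_re.
  rewrite cexp_re; apply: (@cvgM _ _ (nbhs z) (nbhs_filter z) (fun x => expR (reC x)) (fun x => cos (imC x))).
    exact: (@cvg_comp _ _ _ (@reC R) expR (nbhs z) _ _ rz (@continuous_expR R _)).
  exact: (@cvg_comp _ _ _ (@imC R) cos (nbhs z) _ _ iz (@continuous_cos R _)).
rewrite (_ : (fun x => _) = (fun x => expR (reC x) * sin (imC x))); last first.
  by apply/funext => x; rewrite cexp_im.
rewrite cexp_im; apply: (@cvgM _ _ (nbhs z) (nbhs_filter z) (fun x => expR (reC x)) (fun x => sin (imC x))).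
  exact: (@cvg_comp _ _ _ (@reC R) expR (nbhs z) _ _ rz (@continuous_expR R _)).
exact: (@cvg_comp _ _ _ (@imC R) sin (nbhs z) _ _ iz (@continuous_sin R _)).
Qed.

Lemma cderiv_cexp (c z : C) (x : R) :
  cderiv (fun y => cexp (z + c * rC y)) x (c * cexp (z + c * rC x)).
Proof.
have Er y : reC (z + c * rC y) = reC z + reC c * y.
  by rewrite reCD reCM reC_rC imC_rC mulr0 subr0.
have Ei y : imC (z + c * rC y) = imC z + imC c * y.
  by rewrite imCD imCM reC_rC imC_rC mulr0 add0r.
have Dr : is_derive x 1 (fun y => reC z + reC c * y) (reC c).
  by rewrite -[X in is_derive _ _ _ X]add0r; have ? := is_derive_linear (reC c) x; exact: is_deriveD.
have Di : is_derive x 1 (fun y => imC z + imC c * y) (imC c).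
  by rewrite -[X in is_derive _ _ _ X]add0r; have ? := is_derive_linear (imC c) x; exact: is_deriveD.
have De := is_derive_expR_comp Dr.
have Dc := @is_derive1_comp R cos _ x _ _ (is_derive_cos (imC z + imC c * x)) Di.
have Ds := @is_derive1_comp R sin _ x _ _ (is_derive_sin (imC z + imC c * x)) Di.
split.
  rewrite (_ : (fun y => _) = (fun y => expR (reC z + reC c * y)) *
     (cos \o (fun y => imC z + imC c * y))).
    apply: is_derive_eq; rewrite reCM cexp_re cexp_im Er Ei /GRing.scale /=; ring.
  by apply/funext => y; rewrite cexp_re Er Ei.
rewrite (_ : (fun y => _) = (fun y => expR (reC z + reC c * y)) *
   (sin \o (fun y => imC z + imC c * y))).
  apply: is_derive_eq; rewrite imCM cexp_re cexp_im Er Ei /GRing.scale /=; ring.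
by apply/funext => y; rewrite cexp_im Er Ei.
Qed.

(** At 0 the remainder is the increment over [0, 1] of [cexp (w s) - w s], whose derivative in s is
    w times a quantity small by continuity. The functional equation moves the result to every
    point. *)
Lemma holo_cexp z : holo_at (@cexp R) z (cexp z).
Proof.
have H0 : holo_at (@cexp R) 0 1.
  apply/holo_atP => e e0.
  have /for_continuousP/(_ (e / 2)) := @cexp_continuous 0.
  rewrite divr_gt0// => /(_ isT)[dl dl0 Hd]; exists dl => // w; rewrite subr0 => wd.
  pose F (s : R) := cexp (0 + w * rC s) - w * rC s.
  have HF s : cderiv F s (w * cexp (0 + w * rC s) - w * 1).
    apply: cderivB (cderiv_cexp w 0 s) _; apply: cderivZ.
    by split => /=; [exact: is_derive_id|exact: is_derive_cst].
  have := @cder_bound R F _ 0 1 (cab w * (e / 2)) ler01 (fun s _ => HF s).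
  rewrite /F rC1 rC0 !mulr1 mulr0 !add0r cexp0 subr0 => K.
  have -> : cexp w - 1 - 1 * w = cexp w - w - 1 by ring.
  apply: (le_trans (K _)); last by rewrite le_eqVlt; apply/orP; left; apply/eqP; field.
  move=> s /andP[s0 s1]; rewrite -[X in _ - X]mulr1 -mulrBr cabM add0r.
  apply: ler_wpM2l; first exact: cab_ge0.
  have := Hd (w * rC s); rewrite subr0 cexp0; apply.
  by rewrite cabM cab_rC gtr0_norm// (le_lt_trans _ wd)// ler_piMr ?cab_ge0// ltW.
have -> : @cexp R = (fun w => cexp z * cexp (w - z)).
  by apply/funext => w; rewrite -cexpD addrC subrK.
have Hs : holo_at (fun w => w - z) z (1 - 0) by exact: holoB (holo_id z) (holo_cst z z).
have := holoZ (cexp z) (holo_comp Hs _); rewrite subrr => /(_ _ _ H0).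
by rewrite subr0 !mulr1 cexp0 mulr1.
Qed.

End Holomorphic.

(** * Cauchy's estimate for the first derivative *)

Section CauchyEstimate.
Variable R : realType.
Local Notation C := R[i].

Lemma cexp_periodic (t : R) : cexp (Complex t (pi *+ 2)) = cexp (Complex t 0) :> C.
Proof.
by apply: complex_eq; rewrite ?cexp_re ?cexp_im /reC /imC /=
  ?cos2pi ?sin2pi ?cos0 ?sin0.
Qed.

(** The difference quotient of f at mu in logarithmic coordinates: circles about mu become vertical
    segments, and the puncture moves to infinity. *)
Let punct f mu (w : C) : C := (f (mu + cexp w) - f mu) * cexp (- w).

Let punct_holo f (mu : C) (rho : R) (w : C) :
  (forall z, cab (z - mu) < rho -> exists d, holo_at f z d) ->
  expR (reC w) < rho -> exists d, holo_at (punct f mu) w d.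
Proof.
move=> Hf wr.
have [d Hd] : exists d, holo_at f (mu + cexp w) d.
  by apply: Hf; rewrite addrAC subrr add0r cab_cexp.
have H1 : holo_at (fun w => mu + cexp w) w (0 + cexp w) by exact: holoD (holo_cst mu w) (holo_cexp w).
have H2 := holoB (holo_comp H1 Hd) (holo_cst (f mu) w).
have H3 : holo_at (fun w : C => - w) w (-1).
  have := holoZ (-1) (holo_id w); rewrite mulr1; congr holo_at.
  by apply/funext => z; rewrite mulN1r.
have H4 := holo_comp H3 (holo_cexp (- w)).
by eexists; exact: holoM H2 H4.
Qed.

Let cab_punct f (mu w : C) (S : R) : cab (f (mu + cexp w)) <= S -> cab (f mu) <= S ->
  cab (punct f mu w) <= 2 * S / expR (reC w).
Proof.
move=> h1 h2; rewrite /punct cabM cab_cexp reCN expRN; apply: ler_wpM2r.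
  by rewrite invr_ge0 expR_ge0.
by have := cabD (f (mu + cexp w)) (- f mu); rewrite cabN; lra.
Qed.

(* In the coordinate z = mu + exp w the difference quotient is 2 pi i-periodic,
   so by Goursat its mean over a vertical period does not depend on Re w; the
   mean tends to d as Re w -> -oo. *)
Lemma cauchy_estimate_re f (mu d : C) (rho r S : R) : 0 < r -> r < rho ->
  (forall z, cab (z - mu) < rho -> exists d, holo_at f z d) ->
  (forall z, cab (z - mu) < rho -> cab (f z) <= S) ->
  holo_at f mu d -> `|reC d| <= 2 * S / r.
Proof.
move=> r0 rrho Hf HS Hd.
pose T := ln r; have eT : expR T = r by rewrite lnK.
pose r' := (r + rho) / 2; have rr' : r < r' by rewrite /r'; lra.
have r'rho : r' < rho by rewrite /r'; lra.
pose T' := ln r'; have eT' : expR T' = r' by rewrite lnK// posrE (lt_trans r0).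
have TT' : T < T' by rewrite -ltr_expR eT eT'.
pose W (t th : R) : C := Complex (Num.min t T') th.
have WT' t th : expR (reC (W t th)) < rho.
  by apply: le_lt_trans r'rho; rewrite -eT' ler_expR /W /reC /= ge_min lexx orbT.
pose G := punct f mu.
have cG t th : {for W t th, continuous G}.
  by have [e He] := punct_holo Hf (WT' t th); exact: holo_continuous He.
(* P dt + Q dth is the imaginary part of G dw; it is closed by the Cauchy-Riemann equations. *)
pose P t th := imC (G (W t th)); pose Q t th := reC (G (W t th)).
have cW1 th : continuous (W^~ th).
  move=> t; apply: cvg_reim; rewrite /W /reC /imC /=; last exact: cvg_cst.
  by apply: (@continuous_min _ _ id (cst T')); [exact: cvg_id|exact: cvg_cst].
have cW2 t : continuous (W t).
  by move=> th; apply: cvg_reim; rewrite /W /reC /imC /=; [exact: cvg_cst|exact: cvg_id].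
have cP th : continuous (P^~ th).
  move=> t; have H := @cvg_comp _ _ _ (W^~ th) G _ _ _ (cW1 th t) (cG t th).
  exact: (cvg_comp _ _ H (@imC_continuous R _)).
have cQ t : continuous (Q t).
  move=> th; have H := @cvg_comp _ _ _ (W t) G _ _ _ (cW2 t th) (cG t th).
  exact: (cvg_comp _ _ H (@reC_continuous R _)).
have cl t th : t < T' -> closed_at P Q t th.
  move=> tT'; have [e /holo_atP He] := punct_holo Hf (WT' t th).
  exists (imC e), (reC e), (- imC e) => eps eps0.
  have [dl dl0 Hdl] := He eps eps0.
  exists (Num.min (dl / 3) (T' - t)); first by rewrite lt_min divr_gt0// subr_gt0.
  move=> t' th'; rewrite !le_min => /andP[t1 t2] /andP[th1 _].
  have t'T' : t' <= T' by have := le_trans (ler_norm (t' - t)) t2; lra.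
  have W1 : W t th = Complex t th by rewrite /W min_l// ltW.
  have W2 : W t' th' = Complex t' th' by rewrite /W min_l.
  have hD : cab (W t' th' - W t th) <= `|t' - t| + `|th' - th|.
    by rewrite W1 W2; apply: le_trans (cab_le _) _; rewrite reCD imCD reCN imCN.
  have hdl : cab (W t' th' - W t th) < dl by apply: (le_lt_trans hD); lra.
  have K : cab (G (W t' th') - G (W t th) - e * (W t' th' - W t th)) <=
      eps * (`|t' - t| + `|th' - th|).
    apply: (le_trans (Hdl _ hdl)); apply: ler_wpM2l => //; exact: ltW.
  split.
    apply: le_trans K; apply: le_trans _ (cab_Im _); rewrite le_eqVlt; apply/orP; left; apply/eqP.
    congr (`|_|); rewrite /P !(imCD, imCN, imCM, reCD, reCN) W1 W2 /imC /reC /=; ring.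
  apply: le_trans K; apply: le_trans _ (cab_Re _); rewrite le_eqVlt; apply/orP; left; apply/eqP.
  congr (`|_|); rewrite /Q !(reCD, reCN, reCM, imCD, imCN) W1 W2 /imC /reC /=; ring.
have per t : P t 0 = P t (pi *+ 2).
  rewrite /P /G /punct /W cexp_periodic; congr (imC (_ * _)).
  have N th : - Complex (Num.min t T') th = Complex (- Num.min t T') (- th) :> C by [].
  rewrite !N; apply: complex_eq; rewrite ?cexp_re ?cexp_im /reC /imC /=.
    by rewrite oppr0 cos0 cosN cos2pi.
  by rewrite oppr0 sin0 sinN sin2pi oppr0.
have pi2 : (0 : R) <= pi *+ 2 by rewrite mulrn_wge0// pi_ge0.
have pi2' : (0 : R) < pi *+ 2 by rewrite mulrn_wgt0// pi_gt0.
have S0 : 0 <= S.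
  apply: le_trans (cab_ge0 (f mu)) (HS mu _); rewrite subrr cab0.
  exact: lt_trans rrho.
have mean (s : R) : s <= T -> rint (Q s) 0 (pi *+ 2) = rint (Q T) 0 (pi *+ 2).
  move=> sT.
  have cl2 x y : s <= x <= T -> 0 <= y <= pi *+ 2 -> closed_at P Q x y.
    by move=> /andP[_ xT] _; apply: cl; exact: le_lt_trans TT'.
  have := goursat sT pi2 cP cQ cl2.
  rewrite /loop (_ : (fun x => P x 0) = (fun x => P x (pi *+ 2))); last exact/funext.
  lra.
have bT : `|rint (Q T) 0 (pi *+ 2)| <= 2 * S / r * (pi *+ 2).
  have D0 (x : R) : is_derive x 1 (fun _ : R => (0 : R)) 0 by exact: is_derive_cst.
  have := @rint_approx R (Q T) (fun=> 0) (fun=> 0) 0 (pi *+ 2) (2 * S / r) (cQ T) pi2 D0.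
  rewrite (subrr (0 : R)) !subr0; apply.
  move=> th _; rewrite subr0 /Q; apply: le_trans (cab_Re _) _.
  have EW : expR (reC (W T th)) = r by rewrite /W /reC /= min_l ?(ltW TT')// eT.
  rewrite -[X in _ / X]EW; apply: cab_punct; apply: HS.
    by rewrite addrAC subrr add0r cab_cexp EW.
  by rewrite subrr cab0 (lt_trans r0).
have key (e : R) : 0 < e -> `|reC d| <= 2 * S / r + e.
  move=> e0; have /holo_atP/(_ e e0)[dl dl0 Hdl] := Hd.
  (* On the circle of radius [expR s < dl] the difference quotient is within e of d, while [s <= T]
     lets [mean] apply. *)
  pose s := Num.min T (ln (dl / 2)).
  have sT : s <= T by rewrite /s ge_min lexx.
  have es : expR s < dl.
    apply: (@le_lt_trans _ _ (dl / 2)); last by lra.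
    by rewrite -[leRHS](@lnK R) ?posrE ?divr_gt0// ler_expR /s ge_min lexx orbT.
  have Ds : `|rint (Q s) 0 (pi *+ 2) - (reC d * (pi *+ 2) - reC d * 0)| <= e * (pi *+ 2 - 0).
    apply: (@rint_approx R (Q s) (fun x => reC d * x) (fun=> reC d)) => //.
      by move=> x; exact: is_derive_linear.
    move=> th _; rewrite /Q -reCN -reCD; apply: le_trans (cab_Re _) _.
    set w := W s th; have ew : cab (cexp w) = expR s.
      by rewrite cab_cexp /w /W /reC /= min_l// (le_trans sT)// ltW.
    have -> : G w - d = (f (mu + cexp w) - f mu - d * (mu + cexp w - mu)) * cexp (- w).
      by rewrite /G /punct [RHS]mulrBl (addrAC mu) subrr add0r -mulrA -cexpD subrr cexp0 mulr1.
    have mw : mu + cexp w - mu = cexp w by rewrite addrAC subrr add0r.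
    have := Hdl (mu + cexp w); rewrite mw ew => /(_ es) K.
    rewrite cabM cab_cexp reCN expRN ler_pdivrMr ?expR_gt0// -cab_cexp ew //.
  rewrite mean// mulr0 !subr0 in Ds.
  have : `|reC d| * (pi *+ 2) <= (2 * S / r + e) * (pi *+ 2).
    rewrite -[X in _ * X <= _](ger0_norm pi2) -normrM mulrDl.
    rewrite -[X in `|X|](subrK (rint (Q T) 0 (pi *+ 2))) addrC.
    by apply: (le_trans (ler_normD _ _)); rewrite lerD// distrC.
  by rewrite ler_pM2r.
by apply/ler_addgt0Pr => e e0; exact: key.
Qed.

(** The imaginary part is reached by applying the real estimate to i f; adding the two doubles the
    constant. *)
Lemma cauchy_estimate f (mu d : C) (rho r S : R) : 0 < r -> r < rho ->
  (forall z, cab (z - mu) < rho -> exists d, holo_at f z d) ->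
  (forall z, cab (z - mu) < rho -> cab (f z) <= S) ->
  holo_at f mu d -> cab d <= 4 * S / r.
Proof.
move=> r0 rrho Hf HS Hd; apply: le_trans (cab_le _) _.
have h1 := cauchy_estimate_re r0 rrho Hf HS Hd.
have h2 : `|reC (Complex 0 1 * d)| <= 2 * S / r.
  apply: (@cauchy_estimate_re (fun z => Complex 0 1 * f z) mu _ rho r S) => //.
  - by move=> z /Hf[e He]; exists (Complex 0 1 * e); exact: holoZ.
  - move=> z zr; rewrite cabM (_ : cab (Complex 0 1) = 1) ?mul1r; first exact: HS.
    by apply/eqP; rewrite -(@eqrXn2 _ 2) ?cab_ge0// sqr_cab /reC /imC /= expr0n add0r.
  - exact: holoZ.
rewrite reCM /reC /imC /= mul0r sub0r mul1r normrN in h2.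
have -> : 4 * S / r = 2 * S / r + 2 * S / r by ring.
exact: lerD.
Qed.

End CauchyEstimate.

(** * Locally uniform limits of holomorphic functions *)

Section UniformLimits.
Variable R : realType.
Local Notation C := R[i].

Lemma cderiv_holo (f : C -> C) (z h d : C) (s : R) :
  holo_at f (z + h * rC s) d -> cderiv (fun s => f (z + h * rC s)) s (h * d).
Proof.
move=> /holo_atP H.
have K (e : R) : 0 < e -> \forall k \near 0^',
    cab (rC k^-1 * (f (z + h * rC (s + k)) - f (z + h * rC s)) - h * d) <= e.
  move=> e0.
  have h1 : 0 < cab h + 1 by rewrite ltr_wpDl ?cab_ge0.
  have [dl dl0 Hd] := H (e / (cab h + 1)) (divr_gt0 e0 h1).
  near=> k.
  have k0 : k != 0 by near: k; exact: nbhs_dnbhs_neq.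
  have kd : `|k| < dl / (cab h + 1) by near: k; apply: dnbhs0_lt; rewrite divr_gt0.
  have k0' : 0 < `|k| by rewrite normr_gt0.
  have E : z + h * rC (s + k) - (z + h * rC s) = h * rC k by rewrite rCD; ring.
  have := Hd (z + h * rC (s + k)); rewrite E cabM cab_rC.
  have -> : cab h * `|k| < dl.
    apply: (@le_lt_trans _ _ ((cab h + 1) * `|k|)); first by rewrite ler_wpM2r// lerDl.
    by rewrite mulrC -ltr_pdivlMr.
  move=> /(_ isT) B.
  have rk : rC k != 0 by rewrite -rC0 (inj_eq (@complexI R)).
  have -> : rC k^-1 * (f (z + h * rC (s + k)) - f (z + h * rC s)) - h * d =
     rC k^-1 * (f (z + h * rC (s + k)) - f (z + h * rC s) - d * (h * rC k)).
    by rewrite [RHS]mulrBr rCV; congr (_ - _); field.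
  rewrite cabM cab_rC normfV mulrC ler_pdivrMr//; apply: (le_trans B).
  rewrite mulrA ler_wpM2r// mulrAC ler_pdivrMr// ler_wpM2l ?(ltW e0)// lerDl.
  exact: ler01.
split; apply/is_derive1P => e e0; have := K e e0; apply: filterS => k Hk;
  apply: le_trans Hk.
  apply: le_trans (cab_Re _); by rewrite reCD reCN [reC (rC _ * _)]reCM reC_rC imC_rC mul0r subr0 [reC (f _ - f _)]reCD reCN.
apply: le_trans (cab_Im _); by rewrite imCD imCN [imC (rC _ * _)]imCM reC_rC imC_rC mul0r addr0 [imC (f _ - f _)]imCD imCN.
Unshelve. all: by end_near. Qed.

Lemma holo_increment (f : C -> C) (la : C) (rho K : R) :
  (forall z, cab (z - la) < rho -> exists2 d, holo_at f z d & cab d <= K) ->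
  forall z, cab (z - la) < rho -> cab (f z - f la) <= 2 * K * cab (z - la).
Proof.
move=> H z zr; pose h := z - la.
have /choice[D HD] (s : R) : exists d, 0 <= s <= 1 ->
    holo_at f (la + h * rC s) d /\ cab d <= K.
  have [s01|s01] := boolP (0 <= s <= 1); last by exists 0.
  have [] := H (la + h * rC s); last by move=> d; exists d.
  rewrite addrAC subrr add0r cabM cab_rC; case/andP: s01 => s0 s1.
  by rewrite ger0_norm// (le_lt_trans _ zr)// ler_piMr ?cab_ge0.
have := @cder_bound R (fun s => f (la + h * rC s)) (fun s => h * D s) 0 1 (cab h * K) ler01.
rewrite rC1 rC0 mulr1 mulr0 addr0 (addrC la) subrK subr0 mulr1.
have -> : 2 * (cab h * K) = 2 * K * cab h by ring.
apply; first by move=> s s01; apply: cderiv_holo; exact: (HD s s01).1.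
move=> s /andP[s0 s1]; rewrite cabM; apply: ler_wpM2l; first exact: cab_ge0.
by apply: (HD s _).2; rewrite !ltW.
Qed.

(** Cauchy's estimate for [F k - F j] makes the derivatives at la a Cauchy sequence and the
    increments of [F k - G] Lipschitz with small constant; the limit of the derivatives is then the
    derivative of G. *)
Lemma holo_uniform_limit (F : nat -> C -> C) (G : C -> C) (la : C) (rho : R) : 0 < rho ->
  (forall k z, cab (z - la) < rho -> exists d, holo_at (F k) z d) ->
  (forall k z, cab (z - la) < rho -> cab (F k z - G z) <= 1 / 2 ^+ k) ->
  exists d, holo_at G la d.
Proof.
move=> rho0 HF HG.
(* Cauchy's estimate on circles of radius rho / 4 gives 16 / rho = c / 4 times the sup bound; the
   remaining factors leave room for later doublings. *)
pose c := 64 / rho; have c0 : 0 < c by rewrite divr_gt0.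
pose eps k : R := 1 / 2 ^+ k.
have eps0 k : 0 < eps k by rewrite divr_gt0 ?exprn_gt0.
have dbound k j z d : cab (z - la) < rho / 2 -> holo_at (fun z => F k z - F j z) z d ->
    cab d <= c / 4 * (eps k + eps j).
  move=> zr Hd.
  have sub w : cab (w - z) < rho / 2 -> cab (w - la) < rho.
    by move=> wz; have := cabD (w - z) (z - la); rewrite addrA subrK; lra.
  have -> : c / 4 * (eps k + eps j) = 4 * (eps k + eps j) / (rho / 4).
    by rewrite /c; field; rewrite gt_eqF.
  apply: (@cauchy_estimate R (fun z => F k z - F j z) z d (rho / 2)) => //.
  - by rewrite divr_gt0.
  - by lra.
  - move=> w /sub wr; have [d1 H1] := HF k w wr; have [d2 H2] := HF j w wr.
    by exists (d1 - d2); exact: holoB.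
  - move=> w /sub wr; have -> : F k w - F j w = (F k w - G w) - (F j w - G w) by ring.
    by apply: le_trans (cabD _ _) _; rewrite cabN; apply: lerD; exact: HG.
have incr k j z : cab (z - la) < rho / 2 ->
    cab ((F k z - F j z) - (F k la - F j la)) <= c / 2 * (eps k + eps j) * cab (z - la).
  move=> zr; have -> : c / 2 * (eps k + eps j) = 2 * (c / 4 * (eps k + eps j)) by field.
  apply: (@holo_increment (fun z => F k z - F j z) la (rho / 2)) => // w wr.
  have wr' : cab (w - la) < rho by lra.
  have [d1 H1] := HF k w wr'; have [d2 H2] := HF j w wr'.
  by exists (d1 - d2); [exact: holoB|apply: (dbound k j w) => //; exact: holoB].
have la0 : cab (la - la) < rho / 2 by rewrite subrr cab0 divr_gt0.
have la0' : cab (la - la) < rho by rewrite subrr cab0.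
have /choice[D HD] k := HF k la la0'.
have [d Hd] : exists d, forall k, cab (d - D k) <= 4 * c / 2 ^+ k.
  apply: geometric_limit => k.
  have := dbound k.+1 k la (D k.+1 - D k) la0 (holoB (HD k.+1) (HD k)).
  have : eps k.+1 <= eps k.
    by rewrite /eps exprS invfM !mul1r ler_piMl ?invr_ge0 ?exprn_ge0// invf_le1// ler1n.
  have -> : c / 2 ^+ k = c * eps k by rewrite /eps mul1r.
  have := eps0 k; have := eps0 k.+1; nra.
(* The bound for [F k - F j] passes to G as j grows, the error being of order 2^-j. *)
have lim k z : cab (z - la) < rho / 2 ->
    cab ((F k z - G z) - (F k la - G la)) <= c / 2 * eps k * cab (z - la).
  move=> zr; have zr' : cab (z - la) < rho by lra.
  rewrite -subr_le0; apply: (@le0_geometric R _ (c / 2 * cab (z - la) + 2)) => j.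
  have -> : F k z - G z - (F k la - G la) = ((F k z - F j z) - (F k la - F j la)) +
    ((F j z - G z) - (F j la - G la)) by ring.
  have h1 := incr k j z zr; have h2 := HG j z zr'; have h3 := HG j la la0'.
  have h4 := cabD (F j z - G z) (- (F j la - G la)); rewrite cabN in h4.
  have h5 := cabD ((F k z - F j z) - (F k la - F j la)) ((F j z - G z) - (F j la - G la)).
  have -> : (c / 2 * cab (z - la) + 2) / 2 ^+ j = c / 2 * eps j * cab (z - la) + 2 * eps j.
    by rewrite /eps; ring.
  rewrite -/(eps j) in h2 h3; nra.
exists d; apply/holo_atP => e e0.
(* Of the 5, four parts pay for the error in the derivative and one covers the increment of
   [F k - G]. *)
have [k Hk] : exists k, 5 * c / 2 ^+ k <= e / 2.
  apply: contrapT => /forallNP Hk.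
  have : e / 2 <= 0 by apply: (@le0_geometric R _ (5 * c)) => k; rewrite ltW// ltNge; apply/negP/Hk.
  lra.
have e2 : 0 < e / 2 by rewrite divr_gt0.
have /holo_atP/(_ _ e2)[dl dl0 Hdl] := HD k.
exists (Num.min dl (rho / 2)); first by rewrite lt_min dl0 divr_gt0.
move=> z; rewrite lt_min => /andP[zd zr].
have h1 := Hdl z zd; have h2 := lim k z zr; have h3 := Hd k.
have -> : G z - G la - d * (z - la) = (F k z - F k la - D k * (z - la)) +
   (- (F k z - G z - (F k la - G la)) - (d - D k) * (z - la)) by ring.
have h4 := cabD (F k z - F k la - D k * (z - la))
   (- (F k z - G z - (F k la - G la)) - (d - D k) * (z - la)).
have h5 := cabD (- (F k z - G z - (F k la - G la))) (- ((d - D k) * (z - la))).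
rewrite !cabN cabM in h5.
have h6 := ler_wpM2r (cab_ge0 (z - la)) h3.
have h7 := ler_wpM2r (cab_ge0 (z - la)) Hk.
have E5 : 5 * c / 2 ^+ k * cab (z - la) = 4 * c / 2 ^+ k * cab (z - la) +
   c * eps k * cab (z - la) by rewrite /eps; ring.
have c20 : 0 <= c / 2 by rewrite divr_ge0 ?(ltW c0).
have h8 := mulr_ge0 (mulr_ge0 c20 (ltW (eps0 k))) (cab_ge0 (z - la)).
have E6 : c * eps k * cab (z - la) = c / 2 * eps k * cab (z - la) + c / 2 * eps k * cab (z - la).
  by field.
lra.
Qed.

End UniformLimits.

(** * Euler products and holomorphic dependence of the propagator *)

Section EulerScheme.
Variable R : realType.
Local Notation C := R[i].

(** A polynomial in finitely many values of B, hence holomorphic in any parameter in which B is. *)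
Fixpoint euler n (B : R -> 'M[C]_n) (h : R) (k : nat) : 'M[C]_n :=
  if k is k'.+1 then euler B h k' + rC h *: (B (h * k'%:R) *m euler B h k') else 1%:M.

Lemma fundamental_cderiv n (B M : R -> 'M[C]_n) (x : R) :
  (forall v, has_deriv (fun y => M y *m v) x (B x *m (M x *m v))) ->
  forall i j, cderiv (fun y => M y i j) x ((B x *m M x) i j).
Proof.
move=> H i j; have /has_derivP/(_ i) := H (delta_mx j 0).
have E (X : 'M[C]_n) : (X *m delta_mx j (0 : 'I_1)) i 0 = X i j.
  by rewrite -colE mxE.
rewrite mulmxA E; congr cderiv; apply/funext => y; exact: E.
Qed.

Lemma fundamental_bound n (B M : R -> 'M[C]_n) (L b : R) : 0 <= b ->
  M 0 = 1%:M ->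
  (forall x, 0 <= x <= L -> forall i j, cderiv (fun y => M y i j) x ((B x *m M x) i j)) ->
  (forall x i j, 0 <= x <= L -> cab (B x i j) <= b) ->
  forall x i j, 0 <= x <= L -> cab (M x i j) <= expR (3 * b * n%:R * L).
Proof.
move=> b0 M0 HM HB x i j /andP[x0 xL].
pose U y := col j (M y).
have HU y : 0 <= y <= L -> has_deriv U y (B y *m U y).
  move=> yL; apply/has_derivP => k.
  have -> : B y *m U y = col j (B y *m M y) by rewrite /U !colE mulmxA.
  rewrite (_ : (fun y => _) = (fun y => M y k j)); last by apply/funext => w; rewrite mxE.
  by rewrite [X in cderiv _ _ X]mxE; exact: HM.
have cU : {within `[0, x], continuous U}.
  apply: within_mx => k l.
  rewrite (_ : (fun y => _) = (fun y => M y k j)); last by apply/funext => w; rewrite mxE.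
  apply: (@within_cderiv R _ (fun y => (B y *m M y) k j)) => y /andP[y0 yx].
  by apply: HM; rewrite y0 (le_trans yx).
have := @ode_growth R n B U 0 x b b0 x0 cU.
have -> : energy (fun i x => U x i 0) 0 = 1.
  rewrite /energy (bigD1 j)//= big1 ?addr0 => [|k kj]; rewrite /U M0 !mxE ?eqxx ?cab1 ?expr1n//.
  by rewrite (negbTE kj) cab0 expr0n.
rewrite subr0 mul1r => H.
have {}H : energy (fun i x => U x i 0) x <= expR (3 * b * n%:R * L).
  apply: (le_trans (H _ _)).
  - by move=> y /andP[y0 yx]; apply: HU; rewrite (ltW y0) (le_trans (ltW yx)).
  - by move=> y k l /andP[y0 yx]; apply: HB; rewrite (ltW y0) (le_trans (ltW yx)).
  - by rewrite ler_expR ler_wpM2l// !mulr_ge0.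
have := le_trans (cab_le_energy (fun i x => U x i 0) x i) H; rewrite /U mxE => K.
(* The energy bounds the square of the entry; an entry above 1 lies below its square, and any other
   lies below the exponential. *)
have [c1|c1] := leP (cab (M x i j)) 1.
  by apply: (le_trans c1); rewrite -expR0 ler_expR !mulr_ge0// (le_trans x0).
by apply: le_trans K; rewrite expr2 ler_peMl ?cab_ge0// ltW.
Qed.

(** Discrete Gronwall. [tau] bounds the change of B U within one step: w comes from the modulus of
    continuity of B in x, the other term from the Lipschitz bound for U. Accumulated local errors
    grow by [1 + h * n%:R * M] per step. *)
Lemma euler_error n (B U : R -> 'M[C]_n) (L M w Ku h : R) (N : nat) :
  0 <= M -> 0 <= w -> 0 <= Ku -> 0 < h -> h * N%:R = L ->
  U 0 = 1%:M ->
  (forall x, 0 <= x <= L -> forall i j, cderiv (fun y => U y i j) x ((B x *m U x) i j)) ->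
  (forall x i j, 0 <= x <= L -> cab (B x i j) <= M) ->
  (forall x i j, 0 <= x <= L -> cab (U x i j) <= Ku) ->
  (forall x y i j, 0 <= x <= L -> 0 <= y <= L -> `|x - y| <= h -> cab (B x i j - B y i j) <= w) ->
  let tau := n%:R * (w * Ku + M * (2 * (n%:R * M * Ku) * h)) in
  forall k i j, (k <= N)%N ->
    cab (U (h * k%:R) i j - euler B h k i j) <= 2 * tau * h * k%:R * (1 + h * n%:R * M) ^+ k.
Proof.
move=> M0 w0 Ku0 h0 hN U0 HU HB HKu Hw tau.
have in_int k : (k <= N)%N -> 0 <= h * k%:R <= L.
  by move=> kN; rewrite mulr_ge0 ?(ltW h0)//= -hN ler_pM2l// ler_nat.
have mulb (x y : R) (X : 'M[C]_n) (b : R) i j : 0 <= x <= L -> (forall i j, cab (X i j) <= b) ->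
    cab ((B x *m X) i j) <= n%:R * M * b.
  move=> xL HX; rewrite mxE; apply: le_trans (cab_sum _ _) _.
  have -> : n%:R * M * b = \sum_(l < n) (M * b) by rewrite sumr_const card_ord -(mulr_natl (M * b)) mulrA.
  by apply: ler_sum => l _; rewrite cabM; apply: ler_pM; rewrite ?cab_ge0 ?HB ?HX.
have tau0 : 0 <= tau by rewrite /tau mulr_ge0// addr_ge0 ?mulr_ge0// ltW.
have step k i j : (k < N)%N ->
    cab (U (h * k.+1%:R) i j - U (h * k%:R) i j - rC h * (B (h * k%:R) *m U (h * k%:R)) i j)
      <= 2 * tau * h.
  move=> kN; set x := h * k%:R; have E : h * k.+1%:R = x + h by rewrite -natr1 mulrDr mulr1.
  rewrite E; have xL : 0 <= x <= L by apply: in_int; exact: ltnW.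
  have xhL : x + h <= L by have := in_int k.+1 kN; rewrite E => /andP[].
  have x0 : 0 <= x by case/andP: xL.
  have inL s : x <= s <= x + h -> 0 <= s <= L.
    by move=> /andP[? ?]; apply/andP; split; lra.
  pose q := (B x *m U x) i j.
  pose F s := U s i j - q * rC s.
  have HF s : x <= s <= x + h -> cderiv F s ((B s *m U s) i j - q * 1).
    move=> sL; apply: cderivB (HU s (inL s sL) i j) _; apply: cderivZ.
    by split => /=; [exact: is_derive_id|exact: is_derive_cst].
  have -> : U (x + h) i j - U x i j - rC h * q = F (x + h) - F x.
    by rewrite /F rCD; ring.
  have := @cder_bound R F _ x (x + h) tau _ HF.
  rewrite (addrC x) addrK; apply; first by rewrite lerDr ltW.
  move=> s /andP[xs sh]; have sI : x <= s <= x + h by rewrite (ltW xs) addrC ltW.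
  have sL := inL s sI.
  rewrite mulr1 /q !mxE -sumrB; apply: le_trans (cab_sum _ _) _.
  rewrite /tau mulr_natl -[n in _ *+ n]card_ord -sumr_const; apply: ler_sum => l _.
  have -> : B s i l * U s l j - B x i l * U x l j =
    (B s i l - B x i l) * U s l j + B x i l * (U s l j - U x l j) by ring.
  apply: le_trans (cabD _ _) _; rewrite !cabM; apply: lerD; apply: ler_pM; rewrite ?cab_ge0//.
  - by apply: Hw => //; rewrite ger0_norm; lra.
  - exact: HKu.
  - exact: HB.
  - have D : cab (U s l j - U x l j) <= 2 * (n%:R * M * Ku) * (s - x).
      apply: (@cder_bound R (fun s => U s l j) (fun s => (B s *m U s) l j) x s) => //.
      + exact: ltW.
      + by move=> y /andP[xy ys]; apply: HU; apply: inL; rewrite xy/=; lra.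
      + move=> y /andP[xy ys]; have yL : 0 <= y <= L by apply: inL; rewrite (ltW xy)/=; lra.
        by apply: mulb => // a b; exact: HKu.
    apply: (le_trans D); apply: ler_wpM2l; first by rewrite !mulr_ge0.
    lra.
set g := 1 + h * n%:R * M.
have g1 : 1 <= g by rewrite /g lerDl !mulr_ge0// ltW.
elim=> [|k IH] i j kN.
  by rewrite mulr0 U0 subrr cab0 mulr0 mul0r.
have kN' := ltnW kN; have IHk a b := IH a b kN'.
set bnd := 2 * tau * h * k%:R * g ^+ k in IHk.
have -> : U (h * k.+1%:R) i j - euler B h k.+1 i j =
   (U (h * k.+1%:R) i j - U (h * k%:R) i j - rC h * (B (h * k%:R) *m U (h * k%:R)) i j) +
   ((U (h * k%:R) i j - euler B h k i j) +
     rC h * (B (h * k%:R) *m (U (h * k%:R) - euler B h k)) i j).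
  rewrite mulmxBr /=.
  have -> : (euler B h k + rC h *: (B (h * k%:R) *m euler B h k)) i j =
    euler B h k i j + rC h * (B (h * k%:R) *m euler B h k) i j by rewrite 2!mxE.
  have -> : (B (h * k%:R) *m U (h * k%:R) - B (h * k%:R) *m euler B h k) i j =
    (B (h * k%:R) *m U (h * k%:R)) i j - (B (h * k%:R) *m euler B h k) i j.
    by rewrite [LHS]mxE [X in _ + X]mxE.
  by ring.
have h1 := step k i j kN; have h2 := IHk i j.
have h3 : cab (rC h * (B (h * k%:R) *m (U (h * k%:R) - euler B h k)) i j) <= h * (n%:R * M * bnd).
  rewrite cabM cab_rC (gtr0_norm h0); apply: ler_wpM2l; first exact: ltW.
  apply: mulb => //; first exact: in_int.
  move=> a b; rewrite [X in cab X]mxE [X in _ + X]mxE; exact: IHk.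
apply: (le_trans (cabD _ _)).
have h4 := cabD (U (h * k%:R) i j - euler B h k i j)
   (rC h * (B (h * k%:R) *m (U (h * k%:R) - euler B h k)) i j).
have : 2 * tau * h + bnd * g <= 2 * tau * h * k.+1%:R * g ^+ k.+1.
  have -> : 2 * tau * h * k.+1%:R * g ^+ k.+1 = bnd * g + 2 * tau * h * g ^+ k.+1.
    by rewrite /bnd -natr1 exprSr; ring.
  rewrite addrC lerD2l ler_peMr ?exprn_ege1//.
  by rewrite mulr_ge0 ?(ltW h0)// mulr_ge0.
have -> : bnd * g = bnd + h * (n%:R * M * bnd) by rewrite /g; ring.
lra.
Qed.

Lemma euler_holo n (B : R -> C -> 'M[C]_n) (h L : R) (N : nat) (z : C) :
  0 < h -> h * N%:R = L ->
  (forall x i j, 0 <= x <= L -> exists d, holo_at (fun z => B x z i j) z d) ->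
  forall k, (k <= N)%N -> forall i j, exists d, holo_at (fun z => euler (B^~ z) h k i j) z d.
Proof.
move=> h0 hN HB; elim=> [|k IH] kN i j; first by exists 0; exact: holo_cst.
have kL : 0 <= h * k%:R <= L.
  by rewrite mulr_ge0 ?(ltW h0)//= -hN ler_pM2l// ler_nat ltnW.
have {}IH := IH (ltnW kN).
have mulH l : exists d, holo_at (fun z => B (h * k%:R) z i l * euler (B^~ z) h k l j) z d.
  have [d1 H1] := HB _ i l kL; have [d2 H2] := IH l j.
  by eexists; exact: holoM H1 H2.
have /choice[D HD] := mulH.
have [d Hd] := IH i j.
exists (d + rC h * \sum_l D l).
have := holoD Hd (holoZ (rC h) (holo_sum (index_enum 'I_n) HD)).
by congr holo_at; apply/funext => w /=; rewrite !mxE.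
Qed.

(** The mesh is tuned to a modulus of continuity in x valid for all z in the disk, so the Euler
    products reach accuracy 2^-k there uniformly. *)
Lemma fundamental_holo n (B : R -> C -> 'M[C]_n) (U : C -> R -> 'M[C]_n)
    (la : C) (rho L M : R) : 0 < rho -> 0 < L -> 0 <= M ->
  (forall z x i j, cab (z - la) < rho -> 0 <= x <= L -> exists d, holo_at (fun z => B x z i j) z d) ->
  (forall z x i j, cab (z - la) < rho -> 0 <= x <= L -> cab (B x z i j) <= M) ->
  (forall e : R, 0 < e -> exists2 d : R, 0 < d & forall x y, 0 <= x <= L -> 0 <= y <= L ->
     `|x - y| <= d -> forall z i j, cab (z - la) < rho -> cab (B x z i j - B y z i j) <= e) ->
  (forall z, cab (z - la) < rho -> U z 0 = 1%:M /\ forall x, 0 <= x <= L ->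
     forall v, has_deriv (fun y => U z y *m v) x (B x z *m (U z x *m v))) ->
  forall i j, exists d, holo_at (fun z => U z L i j) la d.
Proof.
move=> rho0 L0 M0 HB HM Hu HU i j.
(* [Ku] bounds the propagator; [c2] and [c3] are the coefficients for which the total Euler error is
   [c2 * w + c3 * h], each summand being made at most e / 2. *)
pose Ku := expR (3 * M * n%:R * L).
have Ku0 : 0 <= Ku by exact: expR_ge0.
pose c1 := 2 * L * expR (L * n%:R * M) * n%:R.
pose c2 := c1 * Ku; pose c3 := c1 * (M * (2 * (n%:R * M * Ku))).
have c10 : 0 <= c1 by rewrite /c1 !mulr_ge0 ?expR_ge0// ltW.
have c20 : 0 <= c2 by rewrite mulr_ge0.
have c30 : 0 <= c3 by rewrite mulr_ge0// mulr_ge0// mulr_ge0// mulr_ge0// mulr_ge0.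
have ex_h e : 0 < e -> exists Nh : nat * R, [/\ 0 < Nh.2, Nh.2 * Nh.1%:R = L &
    forall z, cab (z - la) < rho -> cab (euler (B^~ z) Nh.2 Nh.1 i j - U z L i j) <= e].
  move=> e0; pose w := e / (2 * (c2 + 1)).
  have w0 : 0 < w by rewrite divr_gt0// mulr_gt0// ltr_wpDl.
  have [dl dl0 Hdl] := Hu w w0.
  pose m := Num.min dl (e / (2 * (c3 + 1))).
  have m0 : 0 < m by rewrite lt_min dl0 divr_gt0// mulr_gt0// ltr_wpDl.
  pose N := (Num.bound (L / m)).+1; pose h := L / N%:R.
  have N0 : (0 : R) < N%:R by rewrite ltr0n.
  have h0 : 0 < h by rewrite divr_gt0.
  have hN : h * N%:R = L by rewrite divfK// gt_eqF.
  have hm : h <= m.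
    rewrite /h ler_pdivrMr// mulrC -ler_pdivrMr//.
    apply: ltW; apply: (lt_le_trans (archi_boundP _)); first by rewrite divr_ge0 ?ltW.
    by rewrite ler_nat.
  have [hdl he] : h <= dl /\ h <= e / (2 * (c3 + 1)) by move: hm; rewrite le_min => /andP[].
  exists (N, h); split => // z zr /=.
  have [U0 DU] := HU z zr.
  have DU' x : 0 <= x <= L -> forall i j, cderiv (fun y => U z y i j) x ((B x z *m U z x) i j).
    by move=> xL; exact: (@fundamental_cderiv n (B^~ z) (U z) x (DU x xL)).
  have HBz x a b : 0 <= x <= L -> cab (B x z a b) <= M by exact: HM.
  have HKu := @fundamental_bound n (B^~ z) (U z) L M M0 U0 DU' HBz.
  have Hw x y a b : 0 <= x <= L -> 0 <= y <= L -> `|x - y| <= h -> cab (B x z a b - B y z a b) <= w.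
    by move=> xL yL xy; apply: Hdl => //; exact: le_trans hdl.
  have := @euler_error n (B^~ z) (U z) L M w Ku h N M0 (ltW w0) Ku0 h0 hN U0 DU' HBz HKu Hw
    N i j (leqnn N).
  rewrite hN cabB => K; apply: (le_trans K).
  set tau := n%:R * _.
  have tau0 : 0 <= tau.
    apply: mulr_ge0 => //; apply: addr_ge0; first exact: mulr_ge0 (ltW w0) Ku0.
    apply: mulr_ge0 => //; apply: mulr_ge0 (ltW h0); apply: mulr_ge0 => //.
    by apply: mulr_ge0 => //; exact: mulr_ge0.
  have -> : 2 * tau * h * N%:R = 2 * tau * L by rewrite -mulrA hN.
  have gE : (1 + h * n%:R * M) ^+ N <= expR (L * n%:R * M).
    have -> : L * n%:R * M = N%:R * (h * n%:R * M) by rewrite -hN; ring.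
    rewrite expRM_natl; apply: lerXn2r; rewrite ?nnegrE ?expR_ge0 ?expR_ge1Dx//.
    by rewrite addr_ge0// !mulr_ge0// ltW.
  apply: (@le_trans _ _ (2 * tau * L * expR (L * n%:R * M))).
    by apply: ler_wpM2l => //; rewrite mulr_ge0 ?(ltW L0)// mulr_ge0.
  have -> : 2 * tau * L * expR (L * n%:R * M) = c2 * w + c3 * h.
    by rewrite /tau /c2 /c3 /c1; ring.
  have half (c x : R) : 0 <= c -> x <= e / (2 * (c + 1)) -> c * x <= e / 2.
    move=> cp xe; apply: (le_trans (ler_wpM2l cp xe)).
    have -> : c * (e / (2 * (c + 1))) = e / 2 * (c / (c + 1)).
      by field; rewrite gt_eqF// ltr_wpDl.
    rewrite ler_piMr ?divr_ge0 ?(ltW e0)// ler_pdivrMr ?ltr_wpDl//.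
    by rewrite mul1r lerDl.
  have h1 := half c2 w c20 (lexx _); have h2 := half c3 h c30 he; lra.
have /choice[Nh HNh] (k : nat) := ex_h (1 / 2 ^+ k) (divr_gt0 ltr01 (exprn_gt0 k (ltr0Sn _ 1))).
apply: (@holo_uniform_limit R (fun k z => euler (B^~ z) (Nh k).2 (Nh k).1 i j)
  (fun z => U z L i j) la rho rho0).
  move=> k z zr; have [h0 hN _] := HNh k.
  apply: (@euler_holo n B (Nh k).2 L (Nh k).1 z h0 hN) => //.
  by move=> x a b xL; exact: HB.
by move=> k z zr; have [_ _] := HNh k; exact.
Qed.

End EulerScheme.

(** * Gram-Schmidt coefficients and biorthogonal eigenbases *)

Section Hermitian.
Variable R : realType.
Local Notation C := R[i].

Lemma ipE n (U V : 'cV[C]_n) : ip U V = \sum_i conjc (U i 0) * V i 0.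
Proof. by rewrite /ip mxE; apply: eq_bigr => i _; rewrite !mxE. Qed.

Lemma ctrM m n p (A : 'M[C]_(m, n)) (B : 'M[C]_(n, p)) : ctr (A *m B) = ctr B *m ctr A.
Proof. by rewrite /ctr map_mxM trmx_mul. Qed.

Lemma ip_mulmxl m n (A : 'M[C]_(m, n)) (U : 'cV[C]_n) (V : 'cV[C]_m) :
  ip (A *m U) V = ip U (ctr A *m V).
Proof. by rewrite /ip ctrM mulmxA. Qed.

Lemma conjcM_cab (z : C) : conjc z * z = rC (cab z ^+ 2).
Proof. by rewrite sqr_cab; case: z => a b; apply: complex_eq; rewrite /reC /imC /=; ring. Qed.

Lemma ip_eq0 n (U : 'cV[C]_n) : ip U U = 0 -> U = 0.
Proof.
rewrite ipE => H.
have {}H : \sum_i cab (U i 0) ^+ 2 = 0.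
  apply: (@complexI R); rewrite -[RHS]H rmorph_sum /=.
  by apply: eq_bigr => i _; rewrite conjcM_cab.
apply/colP => i; rewrite mxE; apply/eqP; rewrite -cab_eq0 -sqrf_eq0.
by move/eqP: H; rewrite psumr_eq0 => [/allP/(_ i)|j _]; rewrite ?mem_index_enum ?sqr_ge0//; apply.
Qed.

Lemma ipZr n (U V : 'cV[C]_n) c : ip U (c *: V) = c * ip U V.
Proof. by rewrite /ip -scalemxAr mxE. Qed.

Lemma ipZl n (U V : 'cV[C]_n) c : ip (c *: U) V = conjc c * ip U V.
Proof. by rewrite !ipE mulr_sumr; apply: eq_bigr => i _; rewrite mxE rmorphM mulrA. Qed.

Lemma unitmx_ker (F : fieldType) n (A : 'M[F]_n) :
  (forall c : 'cV_n, A *m c = 0 -> c = 0) -> A \in unitmx.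
Proof.
move=> H; rewrite unitmxE unitfE; apply/negP; rewrite -det_tr => /det0P[v v0 vA].
have : v^T = 0 by apply: H; rewrite -[A]trmxK -trmx_mul vA trmx0.
by move/(congr1 trmx); rewrite trmxK trmx0 => /eqP; rewrite (negbTE v0).
Qed.

Section GramSchmidt.
Variables (n r : nat) (G : 'M[C]_(n, r)).
Hypothesis Ginj : forall c : 'cV[C]_r, G *m c = 0 -> c = 0.
Let gram := ctr G *m G.

(** G d is a combination of the first j columns and orthogonal to each of them, hence orthogonal to
    itself. *)
Lemma gram_supp_eq0 (j : nat) (d : 'cV[C]_r) : (forall i : 'I_r, (j <= i)%N -> d i 0 = 0) ->
  (forall k : 'I_r, (k < j)%N -> (gram *m d) k 0 = 0) -> d = 0.
Proof.
move=> d0 gd; apply: Ginj; apply: ip_eq0; rewrite ip_mulmxl mulmxA ipE big1// => k _.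
have [kj|jk] := ltnP k j; first by rewrite gd// mulr0.
by rewrite d0// rmorph0 mul0r.
Qed.

(** Coefficients, in the columns of G, of the unnormalised j-th Gram-Schmidt vector. The unit
    leading coefficient makes the change of basis unitriangular. *)
Definition gs_vec (j : 'I_r) (t : 'cV[C]_r) : Prop :=
  [/\ t j 0 = 1, forall i : 'I_r, (j < i)%N -> t i 0 = 0 &
      forall k : 'I_r, (k < j)%N -> (gram *m t) k 0 = 0].

Lemma gs_exists (j : 'I_r) : exists t, gs_vec j t.
Proof.
(* The leading j x j block of the Gram matrix, padded by the identity to size r so that a single
   inverse can be taken. *)
pose S := \matrix_(k < r, i < r) if (k < j)%N then (if (i < j)%N then gram k i else 0)
                                 else (k == i)%:R.
have Srow (c : 'cV[C]_r) (k : 'I_r) : (j <= k)%N -> (S *m c) k 0 = c k 0.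
  move=> jk; rewrite mxE (bigD1 k)//= mxE ltnNge jk /= eqxx mul1r big1 ?addr0// => i ik.
  by rewrite mxE ltnNge jk /= eq_sym (negbTE ik) mul0r.
have Slow (c : 'cV[C]_r) (k : 'I_r) : (k < j)%N -> (forall i : 'I_r, (j <= i)%N -> c i 0 = 0) ->
    (S *m c) k 0 = (gram *m c) k 0.
  move=> kj c0; rewrite [LHS]mxE [RHS]mxE; apply: eq_bigr => i _; rewrite mxE kj.
  by case: ltnP => // ji; rewrite c0// !mulr0.
have uS : S \in unitmx.
  apply: unitmx_ker => c Sc.
  have c0 (i : 'I_r) : (j <= i)%N -> c i 0 = 0 by move=> ji; rewrite -Srow// Sc mxE.
  by apply: (gram_supp_eq0 c0) => k kj; rewrite -Slow// Sc mxE.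
pose b := \col_(k < r) if (k < j)%N then - gram k j else 0.
pose c := invmx S *m b.
have Sc : S *m c = b by rewrite mulKVmx.
have c0 (i : 'I_r) : (j <= i)%N -> c i 0 = 0 by move=> ji; rewrite -Srow// Sc mxE ltnNge ji.
exists (c + delta_mx j 0); split.
- by rewrite mxE c0// mxE !eqxx add0r.
- move=> i ji; have ij : (i == j) = false by apply/negP => /eqP E; rewrite E ltnn in ji.
  by rewrite mxE c0 ?(ltnW ji)// mxE add0r ij.
- by move=> k kj; rewrite mulmxDr -colE mxE -Slow// Sc [X in X + _]mxE kj [X in _ + X]mxE addNr.
Qed.

Lemma gs_unique (j : 'I_r) t t' : gs_vec j t -> gs_vec j t' -> t = t'.
Proof.
move=> [t1 t2 t3] [t1' t2' t3']; apply/eqP; rewrite -subr_eq0; apply/eqP.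
apply: (@gram_supp_eq0 j).
  move=> i; rewrite leq_eqVlt => /predU1P[ji|ji]; last by rewrite !mxE t2// t2'// subrr.
  by have -> : i = j by [exact/val_inj]; rewrite !mxE t1 t1' subrr.
by move=> k kj; rewrite mulmxBr mxE t3// mxE t3'// subrr.
Qed.

(** The boundary conditions demand orthogonality to the earlier solutions, [gs_vec] to the earlier
    columns; a unitriangular substitution passes between the two. *)
Lemma gs_orth (T : 'M[C]_r) (j : 'I_r) (t : 'cV[C]_r) :
  (forall k, gs_vec k (col k T)) ->
  (forall k : 'I_r, (k < j)%N -> ip (G *m col k T) (G *m t) = 0) <->
  (forall k : 'I_r, (k < j)%N -> (gram *m t) k 0 = 0).
Proof.
move=> HT.
have E k : ip (G *m col k T) (G *m t) = (gram *m t) k 0 +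
    \sum_(i < r | (i < k)%N) conjc (T i k) * (gram *m t) i 0.
  rewrite ip_mulmxl mulmxA ipE (bigD1 k)//=; have [Tk T0 _] := HT k.
  rewrite Tk rmorph1 mul1r; congr (_ + _).
  rewrite big_mkcond [RHS]big_mkcond; apply: eq_bigr => i _.
  rewrite mxE; case: (ltngtP i k) => [ik|ki|/val_inj ->]; last by rewrite eqxx.
    have -> : (i == k) = false by apply/negP => /eqP E; rewrite E ltnn in ik.
    by [].
  have -> : (i == k) = false by apply/negP => /eqP E; rewrite E ltnn in ki.
  have := T0 i ki; rewrite mxE => ->.
  by rewrite rmorph0 mul0r.
split=> H k kj; last first.
  by rewrite E H// big1 ?addr0// => i ik; rewrite H ?mulr0// (ltn_trans ik).
move: {2}(k : nat) (leqnn k) kj => m; elim: m k => [|m IH] k km kj.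
  have := H k kj; rewrite E big1 ?addr0// => i ik.
  by move: (leq_trans ik km).
have := H k kj; rewrite E big1 ?addr0// => i ik.
rewrite IH ?mulr0//; first by rewrite -ltnS (leq_trans ik).
exact: ltn_trans kj.
Qed.

Lemma det_gs (T : 'M[C]_r) : (forall k, gs_vec k (col k T)) -> \det T = 1.
Proof.
move=> HT; rewrite -det_tr det_trig.
  by rewrite big1// => i _; rewrite mxE; have [] := HT i; rewrite mxE.
apply/is_trig_mxP => i j ij; rewrite mxE.
by have [_ /(_ j ij)] := HT i; rewrite mxE.
Qed.

End GramSchmidt.

Section Eigenbasis.
Variables (n : nat) (A : 'M[C]_n) (nu : 'I_n -> C) (V W : 'I_n -> 'cV[C]_n).
Hypotheses (nuinj : injective nu) (V0 : forall j, V j != 0) (W0 : forall j, W j != 0)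
  (AV : forall j, A *m V j = nu j *: V j) (AW : forall j, ctr A *m W j = conjc (nu j) *: W j).

(** Induction on the support of a vanishing combination: applying A - nu_k removes the last term and
    keeps the others nonzero. *)
Lemma eigenbasis_unit : cols V \in unitmx.
Proof.
have colsE (c : 'cV[C]_n) : cols V *m c = \sum_i c i 0 *: V i.
  apply/colP => k; rewrite mxE summxE; apply: eq_bigr => i _.
  by rewrite !mxE mulrC.
apply: unitmx_ker => c; rewrite colsE.
suff H m : forall c : 'I_n -> C, (forall i : 'I_n, (m <= i)%N -> c i = 0) ->
    \sum_i c i *: V i = 0 -> forall i, c i = 0.
  move=> /(H n) Hc; apply/colP => i; rewrite mxE; apply: Hc => k.
  by rewrite leqNgt ltn_ord.
elim: m => [|m IH] {}c c0 Hc i; first exact: c0.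
have [nm|mn] := leqP n m; first by apply: IH => // k mk; move: (leq_trans nm mk); rewrite leqNgt ltn_ord.
pose k := Ordinal mn.
have cl l : l != k -> c l = 0.
  move=> lk.
  have H2 : \sum_i (c i * (nu i - nu k)) *: V i = 0.
    have -> : \sum_i (c i * (nu i - nu k)) *: V i =
        A *m (\sum_i c i *: V i) - nu k *: \sum_i c i *: V i.
      rewrite mulmx_sumr scaler_sumr -sumrB; apply: eq_bigr => j _.
      by rewrite -scalemxAr AV !scalerA -scalerBl; congr (_ *: _); ring.
    by rewrite Hc mulmx0 scaler0 subrr.
  have := IH (fun i => c i * (nu i - nu k)) _ H2 l.
  move=> /(_ _)/eqP; rewrite mulf_eq0 subr_eq0 (inj_eq nuinj) (negbTE lk) orbF => H3.
  apply/eqP; apply: H3 => j; rewrite leq_eqVlt => /predU1P[mj|mj].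
    by have -> : j = k by [exact/val_inj]; rewrite subrr mulr0.
  by rewrite c0// mul0r.
have [->|] := eqVneq i k; last exact: cl.
move: Hc; rewrite (bigD1 k)//= big1 ?addr0 => [/eqP|j jk]; last by rewrite cl// scale0r.
by rewrite scaler_eq0 (negbTE (V0 k)) orbF => /eqP.
Qed.

Lemma eigen_orth k j : k != j -> ip (W k) (V j) = 0.
Proof.
move=> kj; have : nu j * ip (W k) (V j) = nu k * ip (W k) (V j).
  rewrite -ipZr -AV -[LHS]/(ip (W k) (A *m V j)).
  have -> : ip (W k) (A *m V j) = ip (ctr A *m W k) (V j).
    have ctrK : ctr (ctr A) = A by apply/matrixP => a b; rewrite !mxE conjcK.
    by rewrite ip_mulmxl ctrK.
  by rewrite AW ipZl conjcK.
move=> /eqP; rewrite -subr_eq0 -mulrBl mulf_eq0 subr_eq0 (inj_eq nuinj) eq_sym (negbTE kj) /=.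
by move/eqP.
Qed.

(** By biorthogonality the conditions at L read off single coordinates in the eigenbasis. *)
Lemma ip_eigen_expand k (v : 'cV[C]_n) :
  ip (W k) v = ip (W k) (V k) * (invmx (cols V) *m v) k 0.
Proof.
have -> : ip (W k) v = (ctr (W k) *m cols V *m (invmx (cols V) *m v)) 0 0.
  by rewrite -mulmxA mulKVmx ?eigenbasis_unit.
rewrite [LHS]mxE (bigD1 k)//= big1 ?addr0 => [|j jk].
  congr (_ * _); rewrite /ip [LHS]mxE [RHS]mxE; apply: eq_bigr => i _.
  by rewrite !mxE.
have -> : (ctr (W k) *m cols V) 0 j = ip (W k) (V j).
  by rewrite /ip [LHS]mxE [RHS]mxE; apply: eq_bigr => i _; rewrite !mxE.
by rewrite eigen_orth ?mul0r// eq_sym.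
Qed.

Lemma eigen_pairing_neq0 k : ip (W k) (V k) != 0.
Proof.
apply/negP => /eqP H; have := W0 k; have -> : W k = 0; last by rewrite eqxx.
by apply: ip_eq0; rewrite ip_eigen_expand H mul0r.
Qed.

Lemma eigenbasis_diag : A *m cols V = cols V *m diag_mx (\row_i nu i).
Proof.
apply/matrixP => i j; rewrite mul_mx_diag !mxE.
have /(congr1 (fun v : 'cV_n => v i 0)) := AV j; rewrite !mxE mulrC => <-.
by apply: eq_bigr => k _; rewrite !mxE.
Qed.

(** Identifies the exponents in the definition of the Evans function with the eigenvalue sums
    produced by the rescaled solutions. *)
Lemma trace_spectral (r : nat) (hr : (r <= n)%N) (P : 'M[C]_n) :
  (forall j : 'I_n, P *m V j = if (j < r)%N then V j else 0) ->
  \tr (A *m P) = \sum_(j < r) nu (widen_ord hr j).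
Proof.
move=> HP; pose D : 'M[C]_n := diag_mx (\row_(i < n) (i < r)%N%:R).
have u := eigenbasis_unit.
have PV : P *m cols V = cols V *m D.
  apply/matrixP => i j; rewrite mul_mx_diag !mxE.
  have /(congr1 (fun v : 'cV_n => v i 0)) := HP j; rewrite !mxE => E.
  under eq_bigr do rewrite mxE; rewrite E; case: ifP => _; rewrite ?mulr1 ?mulr0 ?mxE//.
have -> : A *m P = cols V *m (diag_mx (\row_i nu i) *m D *m invmx (cols V)).
  by rewrite !mulmxA -eigenbasis_diag -(mulmxA A) -PV mulmxA mulmxK.
rewrite mxtrace_mulC mulmxKV// mulmx_diag mxtrace_diag -(big_ord_narrow hr) [RHS]big_mkcond /=.
apply: eq_bigr => i _; rewrite !mxE.
by case: ifP => _; rewrite ?mulr1 ?mulr0.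
Qed.

End Eigenbasis.

End Hermitian.

(** * Explicit solution of the boundary-value problems on a half line *)

Section HalfLineBVP.
Variable R : realType.
Local Notation C := R[i].
Variables (n r : nat) (hr : (r <= n)%N) (A : R -> 'M[C]_n) (A0 : 'M[C]_n) (nu : 'I_n -> C)
  (V W : 'I_n -> 'cV[C]_n) (Psi : R -> 'M[C]_n) (L M : R).
Hypotheses (L0 : 0 < L) (M0 : 0 <= M) (HM : forall x i j, 0 <= x <= L -> cab (A x i j) <= M)
  (PsiL : Psi L = 1%:M)
  (DPsi : forall x, 0 <= x <= L -> forall v, has_deriv (fun y => Psi y *m v) x (A x *m (Psi x *m v)))
  (nuinj : injective nu) (V0 : forall j, V j != 0) (W0 : forall j, W j != 0)
  (AV : forall j, A0 *m V j = nu j *: V j) (AW : forall j, ctr A0 *m W j = conjc (nu j) *: W j).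
Local Notation fst_ j := (widen_ord hr j).
Local Notation Vi := (invmx (cols V)).
Local Notation Vr := (top_sub hr (cols V)).

Let oc x : 0 < x < L -> 0 <= x <= L.
Proof. by move=> /andP[/ltW -> /ltW ->]. Qed.

(** The factor e^{c (L - x)} turning solutions of U' = A U into solutions of V' = (A - c) V with the
    same value at L. *)
Definition expo (c : C) (x : R) : C := cexp (c * rC L + (- c) * rC x).

Lemma expoL c : expo c L = 1.
Proof. by rewrite /expo mulNr subrr cexp0. Qed.
Lemma expo0 c : expo c 0 = cexp (c * rC L).
Proof. by rewrite /expo rC0 mulr0 addr0. Qed.
Lemma expo_neq0 c x : expo c x != 0.
Proof. exact: cexp_neq0. Qed.

Definition weighted_sol (c : C) (v : 'cV[C]_n) (x : R) : 'cV[C]_n := expo c x *: (Psi x *m v).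

Lemma weighted_sol_deriv c v x : 0 <= x <= L ->
  has_deriv (weighted_sol c v) x ((A x - c%:M) *m weighted_sol c v x).
Proof.
move=> xL; apply/has_derivP => i.
rewrite (_ : (fun y => _) = (fun y => expo c y * (Psi y *m v) i 0)); last first.
  by apply/funext => y; rewrite mxE.
have /has_derivP/(_ i) D := @DPsi x xL v.
apply: cderiv_eq (cderivM (cderiv_cexp (- c) (c * rC L) x) D) _.
rewrite /weighted_sol mulmxBl mul_scalar_mx -scalemxAr scalerA.
rewrite [RHS]mxE [X in _ = X + _]mxE [X in _ = _ + X]mxE [X in _ = _ - X]mxE -/(expo c x).
by ring.
Qed.

Lemma weighted_sol_within c v : {within `[0, L], continuous (weighted_sol c v)}.
Proof.
apply: within_mx => i j; rewrite (ord1 j).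
apply: (@within_cderiv R _ (fun x => ((A x - c%:M) *m weighted_sol c v x) i 0)) => x xL.
by have /has_derivP := @weighted_sol_deriv c v x xL; exact.
Qed.

Lemma weighted_sol_unique c (U : R -> 'cV[C]_n) : {within `[0, L], continuous U} ->
  (forall x, 0 < x < L -> has_deriv U x ((A x - c%:M) *m U x)) ->
  forall x, 0 <= x <= L -> U x = weighted_sol c (U L) x.
Proof.
move=> cU DU; apply: (@ode_unique R n (fun x => A x - c%:M) U (weighted_sol c (U L)) 0 L (M + cab c) L).
- by rewrite addr_ge0 ?cab_ge0.
- by rewrite lexx ltW.
- exact: cU.
- exact: weighted_sol_within.
- exact: DU.
- by move=> x /oc xL; exact: weighted_sol_deriv.
- move=> x i j /oc xL; rewrite !mxE; apply: le_trans (cabD _ _) _.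
  apply: lerD; first exact: HM.
  by rewrite cabN; case: eqP => _; rewrite ?cab0 ?mulr1n ?cab_ge0.
- by rewrite /weighted_sol expoL PsiL mul1mx scale1r.
Qed.

Lemma weighted_sol0 v x : weighted_sol 0 v x = Psi x *m v.
Proof. by rewrite /weighted_sol /expo oppr0 !mul0r addr0 cexp0 scale1r. Qed.

Lemma Psi0_inj (v : 'cV[C]_n) : Psi 0 *m v = 0 -> v = 0.
Proof.
move=> H; rewrite -[v]mul1mx -PsiL.
have D x : 0 <= x <= L -> has_deriv (fun y => Psi y *m v) x (A x *m (Psi x *m v)).
  by move=> xL; exact: (@DPsi x xL v).
apply: (@ode_unique R n A (fun x => Psi x *m v) (fun=> 0) 0 L M 0).
- exact: M0.
- by rewrite lexx ltW.
- apply: within_mx => i j; rewrite (ord1 j).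
  apply: (@within_cderiv R _ (fun x => (A x *m (Psi x *m v)) i 0)) => x xL.
  by have /has_derivP := D x xL; exact.
- by move=> x; exact: cvg_cst.
- by move=> x /oc; exact: D.
- by move=> x _; apply/has_derivP => i; rewrite mulmx0 mxE; exact: cderiv_cst.
- by move=> x i j /oc; exact: HM.
- exact: H.
- by rewrite lexx ltW.
Qed.

Let uV : cols V \in unitmx. Proof. exact: eigenbasis_unit nuinj V0 AV. Qed.

Lemma ViVr : Vi *m Vr = top_sub hr (1%:M : 'M[C]_n).
Proof.
by rewrite -(mulVmx uV); apply/matrixP => i j; rewrite !mxE; apply: eq_bigr => k _; rewrite !mxE.
Qed.

Lemma top_sub1_mul p (X : 'M[C]_(r, p)) (i : 'I_n) j :
  (top_sub hr (1%:M : 'M[C]_n) *m X) i j = \sum_(k < r) (if i == fst_ k then X k j else 0).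
Proof.
rewrite mxE; apply: eq_bigr => k _; rewrite top_sub1E.
by case: eqP => _; rewrite ?mul1r ?mul0r.
Qed.

Lemma top_sub1_mul_fst p (X : 'M[C]_(r, p)) (i : 'I_r) j :
  (top_sub hr (1%:M : 'M[C]_n) *m X) (fst_ i) j = X i j.
Proof.
rewrite top_sub1_mul (bigD1 i)//= eqxx big1 ?addr0// => k ki.
by case: eqP => // /(congr1 val) /= ik; move: ki; rewrite (val_inj ik) eqxx.
Qed.

Lemma top_sub1_mul_high p (X : 'M[C]_(r, p)) (i : 'I_n) j : (r <= i)%N ->
  (top_sub hr (1%:M : 'M[C]_n) *m X) i j = 0.
Proof.
move=> ri; rewrite top_sub1_mul big1// => k _; case: eqP => // ik.
by move: ri; rewrite ik /= leqNgt ltn_ord.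
Qed.

Lemma top_sub1_factor p (X : 'M[C]_(n, p)) : (forall i : 'I_n, (r <= i)%N -> forall j, X i j = 0) ->
  X = top_sub hr (1%:M : 'M[C]_n) *m rowsub (widen_ord hr) X.
Proof.
move=> HX; apply/matrixP => i j; have [ir|ri] := ltnP i r; last first.
  by rewrite HX// top_sub1_mul_high.
have -> : i = fst_ (Ordinal ir) by exact: val_inj.
by rewrite top_sub1_mul_fst mxE.
Qed.

Lemma Vr_top p (X : 'M[C]_(n, p)) : (forall i : 'I_n, (r <= i)%N -> forall j, X i j = 0) ->
  cols V *m X = Vr *m rowsub (widen_ord hr) X.
Proof.
move=> HX; rewrite [X in LHS](top_sub1_factor HX) mulmxA; congr (_ *m _).
by rewrite -ViVr mulKVmx.
Qed.

Lemma Vr_inj p (X Y : 'M[C]_(r, p)) : Vr *m X = Vr *m Y -> X = Y.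
Proof.
move=> H; apply/matrixP => i j; rewrite -(top_sub1_mul_fst X) -(top_sub1_mul_fst Y).
by rewrite -ViVr -!mulmxA H.
Qed.

(** Values at 0 of the solutions that start at L in the first r eigenvectors: the family to which
    Gram-Schmidt is applied. *)
Let G := Psi 0 *m Vr.

Let Ginj (c : 'cV[C]_r) : G *m c = 0 -> c = 0.
Proof.
by rewrite /G -mulmxA => /Psi0_inj H; apply: Vr_inj; rewrite H mulmx0.
Qed.

Lemma gs_matrix_exists : exists T : 'M[C]_r, forall k, gs_vec G k (col k T).
Proof.
have /choice[t Ht] := @gs_exists R n r G Ginj.
exists (\matrix_(i, k) t k i 0) => k; have -> : col k (\matrix_(i, k) t k i 0) = t k.
  by apply/colP => i; rewrite !mxE.
exact: Ht.
Qed.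

Variable T : 'M[C]_r.
Hypothesis HT : forall k, gs_vec G k (col k T).

Definition bvp_sol (j : 'I_r) : R -> 'cV[C]_n := weighted_sol (nu (fst_ j)) (Vr *m col j T).

Let bvp_sol0 j : bvp_sol j 0 = expo (nu (fst_ j)) 0 *: (G *m col j T).
Proof. by rewrite /bvp_sol /weighted_sol /G mulmxA. Qed.

Let bvp_solL j : bvp_sol j L = Vr *m col j T.
Proof. by rewrite /bvp_sol /weighted_sol expoL scale1r PsiL mul1mx. Qed.

Let VijE (t : 'cV[C]_r) (i : 'I_r) : (Vi *m (Vr *m t)) (fst_ i) 0 = t i 0.
Proof. by rewrite mulmxA ViVr top_sub1_mul_fst. Qed.

Let pairing k v := ip_eigen_expand nuinj V0 AV AW k v.

Lemma bvp_sol_correct (j : 'I_r) :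
  bvp_plus A (nu (fst_ j)) (V (fst_ j)) (W (fst_ j)) W j (fun k => bvp_sol k 0) L (bvp_sol j).
Proof.
have [Tj Tup Torth] := HT j.
split; first exact: weighted_sol_within.
split; first by move=> x /oc xL; exact: weighted_sol_deriv.
split.
  move=> k kj; rewrite !bvp_sol0 ipZr ipZl.
  by rewrite ((@gs_orth R n r G T j (col j T) HT).2 Torth k kj) !mulr0.
rewrite bvp_solL; split.
  rewrite pairing VijE Tj mulr1 //.
move=> k jk; rewrite pairing; have [kr|rk] := ltnP k r; last first.
  by rewrite mulmxA ViVr top_sub1_mul_high// mulr0.
have -> : k = fst_ (Ordinal kr) by exact: val_inj.
by rewrite VijE Tup ?mulr0.
Qed.

(** The conditions at L force the value there to be v_j plus a combination of earlier eigenvectors;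
    those at 0 then make its coefficients a [gs_vec], which is unique. The weights [expo] never
    vanish and so do not affect orthogonality. *)
Lemma bvp_sol_unique (j : 'I_r) (U : R -> 'cV[C]_n) :
  bvp_plus A (nu (fst_ j)) (V (fst_ j)) (W (fst_ j)) W j (fun k => bvp_sol k 0) L U ->
  forall x, 0 <= x <= L -> U x = bvp_sol j x.
Proof.
move=> [cU [DU [orth [norm high]]]] x xL.
have EU := weighted_sol_unique cU DU.
have W1 k : ip (W k) (V k) != 0 by exact: eigen_pairing_neq0 nuinj V0 W0 AV AW k.
pose c := Vi *m U L.
have c1 : c (fst_ j) 0 = 1.
  by apply: (mulfI (W1 (fst_ j))); rewrite mulr1 -[RHS]norm [RHS]pairing.
have c2 (k : 'I_n) : (j < k)%N -> c k 0 = 0.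
  move=> jk; apply: (mulfI (W1 k)); rewrite mulr0 -(high k jk) [RHS]pairing //.
pose t := rowsub (widen_ord hr) c.
have UL : U L = Vr *m t.
  rewrite -Vr_top; first by rewrite mulKVmx.
  by move=> i ri a; rewrite (ord1 a) c2// (leq_trans (ltn_ord j)).
have Ht : gs_vec G j t.
  split; first by rewrite mxE.
    by move=> i ji; rewrite mxE c2.
  apply/(@gs_orth R n r G T j t HT) => k kj; have := orth k kj.
  rewrite bvp_sol0 ipZl EU ?lexx ?ltW// /weighted_sol ipZr UL mulmxA.
  move/eqP; rewrite mulf_eq0 conjc_eq0 (negbTE (expo_neq0 _ _)) orFb.
  by rewrite mulf_eq0 (negbTE (expo_neq0 _ _)) orFb => /eqP.
by rewrite (EU x xL) UL (gs_unique Ginj Ht (HT j)).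
Qed.

Variables (Ps : 'M[C]_n) (Z : 'M[C]_(n, r)).
Hypotheses (HPs : forall j : 'I_n, Ps *m V j = if (j < r)%N then V j else 0)
  (HZ : Ps *m Z = Z).

Let D : 'M[C]_n := diag_mx (\row_(i < n) (i < r)%N%:R).

Let ViPs : Vi *m Ps = D *m Vi.
Proof.
have PV : Ps *m cols V = cols V *m D.
  apply/matrixP => i j; rewrite mul_mx_diag !mxE.
  have /(congr1 (fun v : 'cV_n => v i 0)) := HPs j; rewrite !mxE => E.
  under eq_bigr do rewrite mxE; rewrite E; case: ifP => _; rewrite ?mulr1 ?mulr0 ?mxE//.
by rewrite -[LHS](mulmxK uV) -(mulmxA Vi) PV mulKmx.
Qed.

Definition coef_mx : 'M[C]_r := rowsub (widen_ord hr) (Vi *m Z).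

Lemma Z_coef : Z = Vr *m coef_mx.
Proof.
rewrite -Vr_top; first by rewrite mulKVmx.
move=> i ri j; rewrite -HZ mulmxA ViPs -mulmxA mul_diag_mx !mxE.
by rewrite ltnNge ri mul0r.
Qed.

Let uT : T \in unitmx.
Proof. by rewrite unitmxE (det_gs HT) unitr1. Qed.

(** Since T has determinant 1, this has the same determinant as [coef_mx], the coordinates of Z in
    the leading eigenvectors. *)
Definition tilde_coef : 'M[C]_r := invmx T *m coef_mx.

Lemma cols_bvp_solL : cols (fun j => bvp_sol j L) = Vr *m T.
Proof.
apply/matrixP => i j; rewrite mxE bvp_solL !mxE; apply: eq_bigr => k _; by rewrite [col j T k 0]mxE.
Qed.

Lemma tilde_coefP X : cols (fun j => bvp_sol j L) *m X = Z <-> X = tilde_coef.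
Proof.
rewrite cols_bvp_solL -mulmxA; split=> [H|->].
  by have /Vr_inj E := etrans H Z_coef; rewrite /tilde_coef -E mulKmx.
by rewrite /tilde_coef mulKVmx// -Z_coef.
Qed.

(** Undoes the weights e^{nu_j L} that the rescaled solutions carry at x = 0. *)
Definition decay_mx : 'M[C]_r := diag_mx (\row_j cexp (- (nu (fst_ j) * rC L))).

Let expo_decay (F : 'I_r -> 'cV[C]_n) (S : 'M[C]_(n, r)) :
  (forall j, F j = expo (nu (fst_ j)) 0 *: col j S) -> cols F *m decay_mx = S.
Proof.
move=> HF; apply/matrixP => i j; rewrite mul_mx_diag !mxE HF mxE [col j S i 0]mxE expo0.
by rewrite mulrAC -cexpD subrr cexp0 mul1r.
Qed.

(** T cancels against its inverse in [tilde_coef], which leaves the propagated basis; analyticity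
    rests on this identity. *)
Lemma Psi0_Z : Psi 0 *m Z = cols (fun j => bvp_sol j 0) *m decay_mx *m tilde_coef.
Proof.
rewrite (@expo_decay _ (G *m T)); last first.
  by move=> j; rewrite bvp_sol0 !colE mulmxA.
by rewrite /tilde_coef -mulmxA mulKVmx// /G -mulmxA -Z_coef.
Qed.

Variables (Vx Zx : 'I_r -> R -> 'cV[C]_n) (Cp : 'M[C]_r).
Hypotheses (cVx : forall j, {within `[0, L], continuous (Vx j)})
  (DVx : forall j x, 0 < x < L -> has_deriv (Vx j) x ((A x - (nu (fst_ j))%:M) *m Vx j x))
  (DZx : forall j x, has_deriv (Zx j) x (A x *m Zx j x))
  (HZx : forall j, exists w, (1%:M - Ps) *m w = Zx j L - col j Z)
  (HCp : cols (fun j => Vx j L) *m Cp = cols (fun j => Zx j L)).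

Lemma Zx0E : cols (fun j => Zx j 0) = cols (fun j => Vx j 0) *m decay_mx *m Cp.
Proof.
have I0 : (0 : R) <= 0 <= L by rewrite lexx ltW.
rewrite (@expo_decay _ (Psi 0 *m cols (fun j => Vx j L))); last first.
  move=> j; rewrite (weighted_sol_unique (@cVx j) (@DVx j) I0) /weighted_sol.
  by rewrite !colE -mulmxA -colE; congr (_ *: (_ *m _)); apply/colP => i; rewrite !mxE.
rewrite -mulmxA HCp; apply/matrixP => i j; rewrite mxE.
have cZ : {within `[0, L], continuous (Zx j)}.
  apply: within_mx => k l; rewrite (ord1 l).
  apply: (@within_cderiv R _ (fun x => (A x *m Zx j x) k 0)) => x xL.
  by have /has_derivP := @DZx j x; exact.
have DZ x : 0 < x < L -> has_deriv (Zx j) x ((A x - 0%:M) *m Zx j x).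
  by move=> _; rewrite raddf0 subr0; exact: DZx.
rewrite (weighted_sol_unique cZ DZ I0) weighted_sol0 !mxE; apply: eq_bigr => k _.
by rewrite mxE.
Qed.

(** [Zx j L] differs from Z by an element of the complementary eigenspace, which has no leading
    coordinates; the leading rows therefore see only [coef_mx]. *)
Lemma det_coef_exact :
  mnr Vi Vx L [ffun j => fst_ j] * \det Cp = \det coef_mx.
Proof.
have -> : mnr Vi Vx L [ffun j => fst_ j] = \det (rowsub (widen_ord hr) (Vi *m cols (fun j => Vx j L))).
  by congr (\det _); apply/matrixP => i j; rewrite !mxE ffunE.
rewrite -det_mulmx mul_rowsub_mx -mulmxA HCp; congr (\det _).
apply/matrixP => i j; rewrite [LHS]mxE [RHS]mxE.
have [w Hw] := HZx j.
have Ez : cols (fun j => Zx j L) = cols (fun j => Zx j L) - Z + Z by rewrite subrK.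
rewrite Ez mulmxDr mxE -[RHS]add0r; congr (_ + _).
have -> : (Vi *m (cols (fun j => Zx j L) - Z)) (fst_ i) j = (Vi *m ((1%:M - Ps) *m w)) (fst_ i) 0.
  by rewrite Hw [LHS]mxE [RHS]mxE; apply: eq_bigr => k _; rewrite !mxE.
rewrite mulmxA mulmxBr mulmx1 ViPs mulmxBl mxE [X in _ + X]mxE -mulmxA mul_diag_mx [X in _ - X]mxE mxE /=.
by rewrite [X in X * _]mxE /= ltn_ord mul1r subrr.
Qed.

End HalfLineBVP.

(** * Uniformity over the compact parameter set *)

Section CompactParameters.
Variable R : realType.
Local Notation C := R[i].

Lemma compact_closure (Om : set C) : bounded_set Om -> compact (closure Om).
Proof.
move=> [M [Mreal HM]].
have [m Em] : exists m, M = rC m by have /complex_realP[m ->] := Mreal; exists m.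
pose b := m + 2.
have Hb z : Om z -> cab z <= m + 1.
  move=> Oz; have : M < rC (m + 1) by rewrite Em rC_lt ltrDl.
  by move=> /HM/(_ z Oz); rewrite /= cabE rC_le.
pose Q := (fun p : R * R => Complex p.1 p.2) @` (`[- b, b] `*` `[- b, b]).
have cQ : compact Q.
  apply: continuous_compact; last by apply: compact_setX; exact: segment_compact.
  apply: continuous_subspaceT => p; apply: cvg_reim; rewrite /reC /imC /=.
    exact: cvg_fst.
  exact: cvg_snd.
apply: (subclosed_compact _ cQ); first exact: closed_closure.
move=> z Hz.
have : nbhs z [set w : C | cab (w - z) < 1] by exact: near_cab_lt.
move=> /Hz[w [Ow /= wz]].
have zb : cab z <= b.
  have := cabD (z - w) w; rewrite subrK => h1.
  have := Hb w Ow; rewrite cabB in wz; rewrite /b; lra.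
exists (reC z, imC z); last by case: z {Hz wz zb}.
have := cab_Re z; have := cab_Im z => hi hr.
split; rewrite /= in_itv /= -ler_norml; exact: (le_trans _ zb).
Qed.

(** Compactness of the product of the segment with K, in its near-covering form, yields one d for
    all parameters; y may leave the segment. *)
Lemma uniform_modulus n (A : R -> C -> 'M[C]_n) (K : set C) (a b e : R) : compact K ->
  {within [set p : R * C | K p.2], continuous (fun p => A p.1 p.2)} -> 0 < e ->
  exists2 d : R, 0 < d & forall x y, a <= x <= b -> `|x - y| <= d ->
    forall z i j, K z -> cab (A x z i j - A y z i j) <= e.
Proof.
move=> cK /subspace_continuousP cA e0.
pose S := `[a, b] `*` K.
have cS : compact S by apply: compact_setX => //; exact: segment_compact.
pose P (d : R) (p : R * C) := forall y, `|p.1 - y| <= d -> forall i j,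
  cab (A p.1 p.2 i j - A y p.2 i j) <= e.
have : \forall d \near 0^'+, S `<=` P d.
  move/compact_near_coveringP/near_covering_withinP : cS; apply.
  move=> [x z] [/= xab Kz].
  have /cvgrPdist_le/(_ (rC (e / 2))) := cA (x, z) Kz.
  rewrite rC_gt0 divr_gt0// => /(_ isT).
  move=> [[U V] /= [/nbhs_ballP[r r0 HU] HV] HUV].
  exists ([set p : R * C | `|x - p.1| < r / 2 /\ V p.2], [set d : R | d < r / 2]).
    split => /=; last by apply: nbhs_right_lt; rewrite divr_gt0.
    exists ([set x' | `|x - x'| < r / 2], V).
      by split => //=; apply/nbhs_ballP; exists (r / 2); rewrite /= ?divr_gt0.
    by move=> [p1 p2] [].
  move=> [[x' z'] d] /= [[x'r Vz'] dr] [_ /= Kz'] y xy i j.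
  have h1 : cab (A x z i j - A x' z' i j) <= e / 2.
    have U1 : U x' by apply: HU; rewrite /ball /= (lt_trans x'r)// ltr_pdivrMr// ltr_pMr// ltr1n.
    have := HUV (x', z') (conj U1 Vz') Kz'.
    by move/mxnorm_leP => /(_ (ltW (divr_gt0 e0 (ltr0Sn _ 1))) i j); rewrite !mxE.
  have h2 : cab (A x z i j - A y z' i j) <= e / 2.
    have U1 : U y.
      apply: HU; rewrite /ball /=; have := ler_normD (x - x') (x' - y).
      by rewrite addrA subrK => h; apply: (le_lt_trans h); rewrite (splitr r) ltrD// (le_lt_trans xy).
    have := HUV (y, z') (conj U1 Vz') Kz'.
    by move/mxnorm_leP => /(_ (ltW (divr_gt0 e0 (ltr0Sn _ 1))) i j); rewrite !mxE.
  have -> : A x' z' i j - A y z' i j = (A x z i j - A y z' i j) - (A x z i j - A x' z' i j) by ring.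
  apply: (le_trans (cabD _ _)); rewrite cabN; lra.
move=> H; have [d [Hd d0]] : exists d : R, S `<=` P d /\ 0 < d.
  apply: (@filter_ex _ (0^'+)); apply: filterI; first exact: H.
  exact: nbhs_right_gt.
exists d => // x y xab xy z i j Kz.
by apply: (Hd (x, z) _ y xy i j); split => //=; rewrite in_itv.
Qed.

Lemma joint_bound n (A : R -> C -> 'M[C]_n) (K : set C) (a b : R) : compact K ->
  {within [set p : R * C | K p.2], continuous (fun p => A p.1 p.2)} ->
  exists2 M : R, 0 < M & forall x z i j, a <= x <= b -> K z -> cab (A x z i j) <= M.
Proof.
move=> cK cA; pose S := `[a, b] `*` K.
have cS : compact S by apply: compact_setX => //; exact: segment_compact.
have cA' : {within S, continuous (fun p : R * C => A p.1 p.2)}.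
  by apply: continuous_subspaceW cA => p [].
have cij (ij : 'I_n * 'I_n) : {within S, continuous (fun p : R * C => A p.1 p.2 ij.1 ij.2)}.
  exact: within_coord cA'.
have [M M0 HM] := compact_cab_bounded_fin cS cij.
by exists M => // x z i j xab Kz; apply: (HM (i, j) (x, z)).
Qed.

Lemma slice_continuous n (A : R -> C -> 'M[C]_n) (K : set C) (z : C) : K z ->
  {within [set p : R * C | K p.2], continuous (fun p => A p.1 p.2)} ->
  forall i j, continuous (fun x => A x z i j).
Proof.
move=> Kz cA i j x.
have /subspace_continuousP/(_ (x, z) Kz) H :=
  @within_coord R _ _ n n (fun p : R * C => A p.1 p.2) i j cA.
apply: (cvg_comp (fun y => (y, z)) (fun p : R * C => A p.1 p.2 i j) _ H).
move=> W /= [[U U'] /= [HU HU'] HUU'].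
apply: filterS HU => y Uy; apply: (HUU' (y, z)) => //.
by split => //; exact: nbhs_singleton HU'.
Qed.

(** Cramer's rule: the entries are minors divided by a determinant that does not vanish on K. *)
Lemma within_invmx n (M : C -> 'M[C]_n) (K : set C) : {within K, continuous M} ->
  (forall l, K l -> M l \in unitmx) -> {within K, continuous (fun l => invmx (M l))}.
Proof.
move=> cM uM; apply: within_mx => i j.
have cdet : {within K, continuous (fun l => (\det (M l))^-1)}.
  apply/subspace_continuousP => l Kl; apply: cvgV.
    by have := uM l Kl; rewrite unitmxE unitfE.
  by have /subspace_continuousP := within_det cM; exact.
have cadj : {within K, continuous (fun l => (\adj (M l)) i j)}.
  rewrite (_ : (fun l => _) = (fun l => (-1) ^+ (j + i) * \det (row' j (col' i (M l))))).
    apply: within_cM; first exact: within_ccst.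
    apply: within_det; apply: within_mx => a b.
    rewrite (_ : (fun l => _) = (fun l => M l (lift j a) (lift i b))); first exact: within_coord.
    by apply/funext => l; rewrite !mxE.
  by apply/funext => l; rewrite mxE.
have cE := within_cM cdet cadj.
apply/subspace_continuousP => l Kl.
have H : (fun l => (\det (M l))^-1 * (\adj (M l)) i j) @ within K (nbhs l) --> invmx (M l) i j.
  have -> : invmx (M l) i j = (\det (M l))^-1 * (\adj (M l)) i j by rewrite /invmx uM// mxE.
  by have /subspace_continuousP/(_ l Kl) := cE.
apply: cvg_trans H; apply: near_eq_cvg.
rewrite near_withinE; near=> x => Kx.
by rewrite -[RHS]/(invmx (M x) i j) /invmx uM// [RHS]mxE.
Unshelve. all: by end_near. Qed.

End CompactParameters.

(** * Quantitative bounds on a half line with explicit constants *)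

Section HalfLineEstimates.
Variable R : realType.
Local Notation C := R[i].
Variables (n r : nat) (kap K alpha cz : R).
Local Notation idx := {ffun 'I_r -> 'I_n}.
Local Notation mc := (minor_const n r kap K alpha).

Definition comparison_const : R := Num.sqrt (expR (qconst n r kap K alpha) * #|{: idx}|%:R) * mc.
(** Returning from eigenbasis coordinates by [det_rowsub_mulmx] costs one term per index function,
    each with r entries of V bounded by kap. *)
Definition minor_bound : R := #|{: idx}|%:R * (kap ^+ r * (#|'S_r|%:R + mc + comparison_const)).
Definition coef_bound : R := #|'S_r|%:R * (n%:R * (kap * cz)) ^+ r.
Definition half_const : R := minor_bound + coef_bound * (1 + 2 * mc).
(** Beyond this length the leading minor at L is within 1/2 of its limit 1, so it can be divided
    by. *)
Definition half_length : R := 4 * mc / alpha + 1.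

Hypotheses (kap0 : 0 <= kap) (K0 : 0 <= K) (alpha0 : 0 < alpha) (cz0 : 0 <= cz).

Let mc0 : 0 <= mc.
Proof. by rewrite /minor_const sqrtr_ge0. Qed.
Let cmp0 : 0 <= comparison_const.
Proof. by rewrite /comparison_const mulr_ge0// sqrtr_ge0. Qed.
Let minor_bound0 : 0 <= minor_bound.
Proof.
apply: mulr_ge0; first exact: ler0n.
apply: mulr_ge0; first exact: exprn_ge0.
by apply: addr_ge0 => //; apply: addr_ge0 => //; exact: ler0n.
Qed.
Let coef_bound0 : 0 <= coef_bound.
Proof.
apply: mulr_ge0; first exact: ler0n.
by apply: exprn_ge0; apply: mulr_ge0; [exact: ler0n|exact: mulr_ge0].
Qed.

Lemma half_const_ge0 : 0 <= half_const.
Proof.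
rewrite /half_const; apply: addr_ge0 => //; apply: mulr_ge0 => //.
by apply: addr_ge0 => //; apply: mulr_ge0.
Qed.

Lemma half_length_gt0 : 0 < half_length.
Proof. by rewrite /half_length ltr_wpDl// divr_ge0 ?(ltW alpha0)// mulr_ge0. Qed.

Lemma half_length_small (L : R) : half_length <= L -> mc * expR (- (alpha / 2) * L) <= 1 / 2.
Proof.
move=> HL; have H1 : 2 * mc <= expR (alpha / 2 * L).
  apply: le_trans (expR_ge1Dx _).
  have : alpha / 2 * half_length <= alpha / 2 * L by apply: ler_wpM2l => //; rewrite divr_ge0// ltW.
  have -> : alpha / 2 * half_length = 2 * mc + alpha / 2.
    by rewrite /half_length; field; rewrite gt_eqF.
  have := alpha0; lra.
rewrite mulNr expRN ler_pdivrMr ?expR_gt0//; lra.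
Qed.

Lemma cab_minor_mulmx (V Vi : 'M[C]_n) (Y : 'M[C]_(n, r)) (b : R) (f : 'I_r -> 'I_n) :
  V *m Vi = 1%:M -> (forall i j, cab (V i j) <= kap) ->
  (forall g : idx, cab (\det (rowsub g (Vi *m Y))) <= b) ->
  cab (\det (rowsub f Y)) <= #|{: idx}|%:R * (kap ^+ r * b).
Proof.
move=> VVi HV Hb; rewrite -[Y]mul1mx -VVi -mulmxA det_rowsub_mulmx.
apply: le_trans (cab_sum _ _) _; rewrite mulr_natl -sumr_const.
apply: ler_sum => g _; rewrite cabM cab_prod.
apply: ler_pM; [by apply: prodr_ge0 => i _; exact: cab_ge0|exact: cab_ge0| |exact: Hb].
rewrite -[r in _ ^+ r]card_ord -prodr_const; apply: ler_prod => i _.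
by rewrite cab_ge0 HV.
Qed.

Variables (hr : (r <= n)%N) (A : R -> 'M[C]_n) (A0 : 'M[C]_n) (nu : 'I_n -> C)
  (V W : 'I_n -> 'cV[C]_n) (Psi : R -> 'M[C]_n) (L M : R).
Hypotheses (L0 : 0 < L) (M0 : 0 <= M) (HM : forall x i j, 0 <= x <= L -> cab (A x i j) <= M)
  (PsiL : Psi L = 1%:M)
  (DPsi : forall x, 0 <= x <= L -> forall v, has_deriv (fun y => Psi y *m v) x (A x *m (Psi x *m v)))
  (nuinj : injective nu) (V0 : forall j, V j != 0)
  (AV : forall j, A0 *m V j = nu j *: V j)
  (HV : forall i j, cab (cols V i j) <= kap) (HVi : forall i j, cab (invmx (cols V) i j) <= kap)
  (HA : forall x i j, 0 <= x -> cab ((A x - A0) i j) <= K * expR (- alpha * x))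
  (nu_mono : forall i j : 'I_n, (i <= j)%N -> reC (nu i) <= reC (nu j)).
Local Notation fst_ j := (widen_ord hr j).
Local Notation Vi := (invmx (cols V)).
Local Notation VL T := (bvp_sol hr nu V Psi L T).
Local Notation ex := (expR (- (alpha / 2) * L)).

Variables (T : 'M[C]_r) (Vx : 'I_r -> R -> 'cV[C]_n).
Hypotheses (detT : \det T = 1)
  (DVx : forall j x, 0 < x -> has_deriv (Vx j) x ((A x - (nu (fst_ j))%:M) *m Vx j x))
  (cVx : forall j X, {within `[0, X], continuous (Vx j)})
  (lVx : forall j, Vx j x @[x --> +oo] --> V (fst_ j)).

Let uV : cols V \in unitmx. Proof. exact: eigenbasis_unit nuinj V0 AV. Qed.
Let VVi : cols V *m Vi = 1%:M. Proof. exact: mulmxV. Qed.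
Let ViV : Vi *m cols V = 1%:M. Proof. exact: mulVmx. Qed.
Let diagV := eigenbasis_diag AV.
Let lVx' j : Vx j x @[x --> +oo] --> col (fst_ j) (cols V).
Proof.
have -> : col (fst_ j) (cols V) = V (fst_ j) by apply/colP => i; rewrite !mxE.
exact: lVx.
Qed.

(** Exact equality: at L the approximate solutions are the leading eigenvectors times T, and T has
    determinant 1. *)
Let mnr_VL f : mnr Vi (VL T) L f = mnr_lim R hr f.
Proof.
rewrite /mnr (cols_bvp_solL hr nu V PsiL T) mulmxA (ViVr hr nuinj V0 AV) -mul_rowsub_mx.
by rewrite det_mulmx detT mulr1.
Qed.

Let mnr_near x f : 0 <= x ->
  cab (mnr Vi Vx x f - mnr_lim R hr f) <= mc * expR (- (alpha / 2) * x).
Proof. exact: (mnr_limit diagV VVi ViV kap0 K0 alpha0 HV HVi HA nu_mono DVx cVx lVx'). Qed.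

Let oc x : 0 < x < L -> 0 <= x <= L.
Proof. by move=> /andP[/ltW -> /ltW ->]. Qed.

Let mnr_diff f : cab (mnr Vi Vx 0 f - mnr Vi (VL T) 0 f) <= comparison_const * ex.
Proof.
apply: (mnr_compare diagV VVi ViV kap0 K0 alpha0 HV HVi HA nu_mono (ltW L0) DVx cVx lVx').
- by move=> j x /oc xL; exact: (weighted_sol_deriv DPsi).
- by move=> j; exact: (weighted_sol_within DPsi).
- exact: mnr_VL.
Qed.

Let ex1 : ex <= 1.
Proof. by rewrite -[leRHS]expR0 ler_expR mulNr oppr_le0 mulr_ge0 ?divr_ge0 ?ltW. Qed.

Let mnr_exact_le f : cab (mnr Vi Vx 0 f) <= #|'S_r|%:R + mc.
Proof.
have := mnr_near f (lexx 0); rewrite mulr0 expR0 mulr1 => H.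
rewrite -[X in cab X](subrK (mnr_lim R hr f)) addrC.
by apply: le_trans (cabD _ _) _; apply: lerD => //; exact: mnr_lim_le.
Qed.

Lemma exact_minor_le (f : 'I_r -> 'I_n) : cab (\det (rowsub f (cols (fun j => Vx j 0)))) <= half_const.
Proof.
apply: (@le_trans _ _ minor_bound); last first.
  by rewrite lerDl mulr_ge0// addr_ge0// mulr_ge0.
apply: (cab_minor_mulmx f VVi HV) => g.
by apply: (le_trans (mnr_exact_le g)); rewrite lerDl.
Qed.

Lemma approx_minor_le (f : 'I_r -> 'I_n) : cab (\det (rowsub f (cols (fun j => VL T j 0)))) <= half_const.
Proof.
apply: (@le_trans _ _ minor_bound); last first.
  by rewrite lerDl mulr_ge0// addr_ge0// mulr_ge0.
apply: (cab_minor_mulmx f VVi HV) => g.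
rewrite -[X in cab X]/(mnr Vi (VL T) 0 g) -[mnr Vi (VL T) 0 g](subKr (mnr Vi Vx 0 g)).
apply: le_trans (cabD _ _) _; rewrite cabN; apply: lerD; first exact: mnr_exact_le.
apply: (le_trans (mnr_diff g)); exact: ler_piMr.
Qed.

Lemma minor_diff_le (f : 'I_r -> 'I_n) :
  cab (\det (rowsub f (cols (fun j => Vx j 0))) - \det (rowsub f (cols (fun j => VL T j 0))))
    <= half_const * ex.
Proof.
have E (Y : 'M[C]_(n, r)) : \det (rowsub f Y) =
    \sum_(g : idx) (\prod_i cols V (f i) (g i)) * \det (rowsub g (Vi *m Y)).
  by rewrite -[Y in LHS]mul1mx -VVi -mulmxA det_rowsub_mulmx.
rewrite !E -sumrB; apply: le_trans (cab_sum _ _) _.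
apply: (@le_trans _ _ (minor_bound * ex)); last first.
  by apply: ler_wpM2r; [exact: expR_ge0|rewrite lerDl mulr_ge0// addr_ge0// mulr_ge0].
rewrite /minor_bound -mulrA mulr_natl -sumr_const; apply: ler_sum => g _.
rewrite -mulrBr cabM cab_prod -mulrA.
apply: ler_pM; [by apply: prodr_ge0 => i _; exact: cab_ge0|exact: cab_ge0| |].
  rewrite -[r in _ ^+ r]card_ord -prodr_const; apply: ler_prod => i _.
  by rewrite cab_ge0 HV.
apply: (le_trans (mnr_diff g)); apply: ler_wpM2r; first exact: expR_ge0.
by rewrite lerDr addr_ge0// ler0n.
Qed.

Variables (Ps : 'M[C]_n) (Z : 'M[C]_(n, r)).
Hypotheses (HPs : forall j : 'I_n, Ps *m V j = if (j < r)%N then V j else 0)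
  (HZ : Ps *m Z = Z) (HZc : forall i j, cab (Z i j) <= cz).

Let det_coef_le : cab (\det (coef_mx hr V Z)) <= coef_bound.
Proof.
apply: cab_det_le => i j; rewrite !mxE; apply: le_trans (cab_sum _ _) _.
rewrite mulr_natl -[n in _ *+ n]card_ord -sumr_const; apply: ler_sum => k _.
by rewrite cabM; apply: ler_pM; rewrite ?cab_ge0.
Qed.

Lemma det_tilde_coef_le : cab (\det (tilde_coef hr V T Z)) <= half_const.
Proof.
rewrite /tilde_coef det_mulmx det_inv detT invr1 mul1r.
apply: (le_trans det_coef_le); rewrite /half_const mulrDr mulr1 addrCA lerDl.
by rewrite addr_ge0// mulr_ge0// mulr_ge0.
Qed.

Variables (Zx : 'I_r -> R -> 'cV[C]_n) (Cp : 'M[C]_r).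
Hypotheses (HZx : forall j, exists w, (1%:M - Ps) *m w = Zx j L - col j Z)
  (HCp : cols (fun j => Vx j L) *m Cp = cols (fun j => Zx j L)) (HL : half_length <= L).

(** The two determinants differ only by division by the leading minor m of the exact solutions at L,
    which is exponentially close to 1. *)
Lemma det_coef_diff_le : cab (\det Cp - \det (tilde_coef hr V T Z)) <= half_const * ex.
Proof.
set m := mnr Vi Vx L [ffun j => fst_ j].
have Em : m * \det Cp = \det (coef_mx hr V Z).
  exact: (det_coef_exact hr nuinj V0 AV HPs HZx HCp).
have m1 : cab (m - 1) <= mc * ex.
  by have := mnr_near [ffun j => fst_ j] (ltW L0); rewrite mnr_lim_fst.
have m2 : 1 / 2 <= cab m.
  have := half_length_small HL => h; have := cabD m (1 - m); rewrite subrKC cab1 cabB => h1.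
  lra.
have -> : \det (tilde_coef hr V T Z) = \det (coef_mx hr V Z).
  by rewrite /tilde_coef det_mulmx det_inv detT invr1 mul1r.
have m0 : m != 0 by rewrite -cab_gt0; lra.
have ECp : \det Cp = m^-1 * \det (coef_mx hr V Z) by rewrite -Em mulKf.
have -> : \det Cp - \det (coef_mx hr V Z) = - (m - 1) * m^-1 * \det (coef_mx hr V Z).
  by rewrite ECp; field.
rewrite !cabM cabN cabV.
have ex0 : 0 <= ex := expR_ge0 _.
apply: (@le_trans _ _ (coef_bound * (2 * mc) * ex)); last first.
  apply: ler_wpM2r => //; rewrite /half_const mulrDr mulr1 addrA lerDr.
  by apply: addr_ge0.
have mV : (cab m)^-1 <= 2.
  rewrite -[leRHS]invrK lef_pV2 ?posrE//; first by rewrite -div1r.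
  by lra.
apply: (@le_trans _ _ (mc * ex * 2 * coef_bound)); last first.
  by rewrite le_eqVlt; apply/orP; left; apply/eqP; ring.
apply: ler_pM => //; [|exact: cab_ge0|].
  by apply: mulr_ge0; rewrite ?invr_ge0 cab_ge0.
by apply: ler_pM => //; rewrite ?invr_ge0 cab_ge0.
Qed.

End HalfLineEstimates.

(** * Holomorphic dependence of eigenvalues and propagators on the parameter *)

Section ParameterDependence.
Variable R : realType.
Local Notation C := R[i].

Lemma for_csum (I : Type) (s : seq I) (F : I -> C -> C) z :
  (forall i, {for z, continuous (F i)}) -> {for z, continuous (fun w => \sum_(i <- s) F i w)}.
Proof.
move=> H.
exact: (@cvg_csum R _ _ (nbhs z) (nbhs_filter z) s F (fun i => F i z) H).
Qed.

(** [holo_at] asks for a factorisation at every point; where the local identity fails, the factor is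
    patched by the difference quotient. *)
Lemma holo_near (f phi : C -> C) z : (\forall w \near z, f w - f z = phi w * (w - z)) ->
  {for z, continuous phi} -> holo_at f z (phi z).
Proof.
move=> Hf cphi.
pose psi w := if `[< f w - f z = phi w * (w - z) >] then phi w else (f w - f z) / (w - z).
have psiz : psi z = phi z.
  by rewrite /psi asboolT// !subrr mulr0.
exists psi; split.
- apply/for_continuousP => e e0; have [d d0 Hd] := (for_continuousP _ _).1 cphi e e0.
  have [d' d'0 Hd'] := near_cab_ex Hf.
  exists (Num.min d d') => [|w]; first by rewrite lt_min d0.
  by rewrite lt_min psiz => /andP[/Hd Hw /Hd' Ew]; rewrite /psi asboolT.
- exact: psiz.
- move=> w; rewrite /psi; case: asboolP => // H.
  have [->|wz] := eqVneq w z; first by rewrite !subrr mulr0.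
  by rewrite divfK// subr_eq0.
Qed.

Lemma derivable_mx_holo m n (M : C -> 'M[C]_(m, n)) z : derivable M z 1 ->
  forall i j, exists d, holo_at (fun w => M w i j) z d.
Proof.
move=> /cvg_ex[D HD] i j; apply: derivable_holo; apply/cvg_ex; exists (D i j).
have /(@mxcvgP R C (dnbhs (0 : C)) _ m n)/(_ i j) := HD.
rewrite (_ : (fun x => _) = (fun h : C => h^-1 *: (((fun w => M w i j) \o shift z) (h *: 1) - M z i j))) //.
by apply/funext => h; rewrite /= !mxE.
Qed.

(* (nu l - nu z) <w, V l> = <w, (A l - A z) V l> for a left eigenvector w at z, so
   mere continuity of the eigenvector V suffices. *)
Lemma eigenvalue_holo n (A : C -> 'M[C]_n) (nu : C -> C) (V : C -> 'cV[C]_n) (w : 'cV[C]_n) z :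
  (forall i j, exists d, holo_at (fun l => A l i j) z d) ->
  (\forall l \near z, A l *m V l = nu l *: V l) ->
  (forall i, {for z, continuous (fun l => V l i 0)}) ->
  ctr (A z) *m w = conjc (nu z) *: w -> ip w (V z) != 0 ->
  exists d, holo_at nu z d.
Proof.
move=> HA HV cV Hw wV.
have /choice[phi Hphi] (ij : 'I_n * 'I_n) : exists phi : C -> C, {for z, continuous phi} /\
    forall l, A l ij.1 ij.2 - A z ij.1 ij.2 = phi l * (l - z).
  by have [d [phi [H1 _ H2]]] := HA ij.1 ij.2; exists phi.
pose g l := \sum_i \sum_j conjc (w i 0) * (phi (i, j) l * V l j 0).
have cg : {for z, continuous g}.
  apply: for_csum => i.
  apply: for_csum => j.
  apply: for_cM; first exact: for_cst.
  by apply: for_cM; [exact: (Hphi (i, j)).1|exact: cV].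
have cip : {for z, continuous (fun l => ip w (V l))}.
  rewrite (_ : (fun l => _) = (fun l => \sum_i conjc (w i 0) * V l i 0)); last first.
    by apply/funext => l; rewrite ipE.
  apply: for_csum => i.
  by apply: for_cM; [exact: for_cst|exact: cV].
have cV1 : {for z, continuous (fun l => (ip w (V l))^-1)}.
  exact: (@cvgV _ _ (nbhs z) (nbhs_filter z) _ _ wV cip).
have key l : A l *m V l = nu l *: V l -> (nu l - nu z) * ip w (V l) = g l * (l - z).
  move=> Hl; have -> : g l * (l - z) = ip w ((A l - A z) *m V l).
    rewrite ipE mulr_suml; apply: eq_bigr => i _.
    rewrite mulr_suml [X in _ * X]mxE mulr_sumr; apply: eq_bigr => j _.
    rewrite [(A l - A z) i j]mxE [(- A z) i j]mxE (Hphi (i, j)).2; ring.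
  have ctrK : ctr (ctr (A z)) = A z by apply/matrixP => a b; rewrite !mxE conjcK.
  have Ez : ip w (A z *m V l) = nu z * ip w (V l).
    by rewrite -[A z in LHS]ctrK -ip_mulmxl Hw ipZl conjcK.
  rewrite mulmxBl Hl mulrBl -Ez -ipZr /ip mulmxBr [RHS]mxE.
  by rewrite [X in _ = _ + X]mxE.
exists (g z * (ip w (V z))^-1).
apply: (@holo_near nu (fun l => g l * (ip w (V l))^-1) z _ (for_cM cg cV1)).
have nip : \forall l \near z, ip w (V l) != 0.
  have e0 : 0 < cab (ip w (V z)) / 2 by rewrite divr_gt0// cab_gt0.
  have := (@ccvgP R C (nbhs z) (nbhs_filter z) (fun l => ip w (V l)) _).1 cip _ e0.
  apply: (@filterS _ (nbhs z) (nbhs_filter z)) => l Hl.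
  rewrite -cab_gt0; have := cabD (ip w (V l)) (ip w (V z) - ip w (V l)).
  rewrite subrKC cabB => H; have : 0 < cab (ip w (V z)) by rewrite cab_gt0.
  lra.
apply: (@filterS2 _ (nbhs z) (nbhs_filter z) _ _ _ _ HV nip) => l Hl Nl.
by rewrite mulrAC -(key l Hl) mulfK.
Qed.

Lemma has_deriv_flip n (U : R -> 'cV[C]_n) (c x : R) d : has_deriv U (c - x) d ->
  has_deriv (fun y => U (c - y)) x (- d).
Proof.
move=> H; apply: (@has_deriv_Nid R n (fun y => U (c + y)) x d).
rewrite /has_deriv (_ : (fun h => _) = (fun h => (rC h)^-1 *: (U (c - x + h) - U (c - x)))).
  exact: H.
by apply/funext => h; rewrite addrA.
Qed.

(* Psi l x maps the value at L of a solution to its value at x. *)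
Lemma half_propagator n (Om : set C) (A : R -> C -> 'M[C]_n) (L : R) :
  open Om -> compact (closure Om) ->
  {within [set p : R * C | closure Om p.2], continuous (fun p => A p.1 p.2)} ->
  (forall x l, Om l -> derivable (A x) l 1) -> 0 < L ->
  exists Psi : C -> R -> 'M[C]_n,
   (forall l, closure Om l -> Psi l L = 1%:M /\ forall x, 0 <= x <= L -> forall v,
       has_deriv (fun y => Psi l y *m v) x (A x l *m (Psi l x *m v))) /\
   (forall l, Om l -> forall i j, exists d, holo_at (fun z => Psi z 0 i j) l d).
Proof.
(* Reversing time about L turns data at L into initial data at 0; [Psi l 0] becomes the fundamental
   matrix at time L. *)
move=> oOm cK cA dA L0; pose B x l := - A (L - x) l.
have OK l : Om l -> closure Om l by move=> Ol; exact: subset_closure.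
have /choice[U HU] l : exists U : R -> 'M[C]_n, closure Om l -> U 0 = 1%:M /\
    forall x, 0 <= x <= L -> forall v, has_deriv (fun y => U y *m v) x (B x l *m (U x *m v)).
  have [Kl|Kl] := pselect (closure Om l); last by exists (fun=> 0).
  have [|U HU] := @fundamental_exists R n (fun x => B x l) L _ (ltW L0); last by exists U.
  move=> i j x; rewrite (_ : (fun x => _) = (fun x => - A (L - x) l i j)); last first.
    by apply/funext => y; rewrite mxE.
  apply: (@cvgN C C R (nbhs x)).
  apply: (@continuous_comp _ _ _ (fun y : R => L - y) (fun y => A y l i j)); last first.
    exact: (slice_continuous Kl cA).
  by apply: cvgB; [exact: cvg_cst|exact: cvg_id].
exists (fun l x => U l (L - x)); split=> [l Kl|l Ol i j].
  have [U0 DU] := HU l Kl; split; first by rewrite subrr.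
  move=> x xL v; have xL' : 0 <= L - x <= L by move: xL; lra.
  have := has_deriv_flip (DU _ xL' v).
  by rewrite /B subKr mulNmx opprK.
rewrite subr0; have [rho rho0 Hrho] : exists2 rho : R, 0 < rho & forall z, cab (z - l) < rho -> Om z.
  by apply: near_cab_ex; exact: open_nbhs_nbhs.
have [M M0 HM] := @joint_bound R n A (closure Om) 0 L cK cA.
apply: (@fundamental_holo R n B U l rho L M rho0 L0 (ltW M0)).
- move=> z x a b /Hrho Oz xL; have [d Hd] := derivable_mx_holo (dA (L - x) z Oz) a b.
  exists (-1 * d); rewrite (_ : (fun z => _) = (fun z => -1 * A (L - x) z a b)); first exact: holoZ.
  by apply/funext => w; rewrite mxE mulN1r.
- move=> z x a b /Hrho Oz xL; rewrite mxE cabN; apply: HM; last exact: OK.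
  by move: xL; lra.
- move=> e e0; have [d d0 Hd] := @uniform_modulus R n A (closure Om) 0 L e cK cA e0.
  exists d => // x y xL yL xy z a b /Hrho Oz; rewrite mxE [X in _ - X]mxE -opprD cabN.
  apply: Hd; [by move: xL; lra| |exact: OK].
  by have -> : L - x - (L - y) = y - x by [ring]; rewrite distrC.
- by move=> z /Hrho Oz; exact: HU (OK z Oz).
Qed.

End ParameterDependence.

(** * Approximation on the right half line, uniformly in the parameter *)

Section HalfLinePackage.
Variable R : realType.
Local Notation C := R[i].

Lemma within_right_limit n (U dU : R -> 'cV[C]_n) (X : R) :
  (forall x, 0 < x -> has_deriv U x (dU x)) -> U y @[y --> 0^'+] --> U 0 ->
  {within `[0, X], continuous U}.
Proof.
(* The interval is enlarged to positive length, since X may be nonpositive. *)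
move=> DU U0; have Xle : X <= Num.max X 1 by rewrite le_max lexx.
apply: (@within_sub R _ U 0 (Num.max X 1) 0 X (lexx 0) Xle).
have cU x i : 0 < x -> {for x, continuous (fun y => U y i 0)}.
  by move=> x0; have /has_derivP/(_ i) := DU x x0; exact: cderiv_continuous.
apply: within_mx => i j; rewrite (ord1 j).
have X0 : 0 < Num.max X 1 by rewrite lt_max ltr01 orbT.
apply/(continuous_within_itvP _ X0); split.
- by move=> x; rewrite in_itv /= => /andP[x0 _]; exact: cU.
- by have /mxcvgP := U0; exact.
- by apply: cvg_at_left_filter; exact: cU.
Qed.

Variables (n r : nat) (hr : (r <= n)%N) (Om : set C) (A : R -> C -> 'M[C]_n) (A0 : C -> 'M[C]_n)
  (nu : 'I_n -> C -> C) (V W : 'I_n -> C -> 'cV[C]_n) (Ps : C -> 'M[C]_n) (Z : C -> 'M[C]_(n, r))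
  (Vx : 'I_r -> R -> C -> 'cV[C]_n) (K alpha : R).
Local Notation fst_ j := (widen_ord hr j).
Hypotheses (oOm : open Om) (cK : compact (closure Om))
  (cA : {within [set p : R * C | closure Om p.2], continuous (fun p => A p.1 p.2)})
  (dA : forall x l, Om l -> derivable (A x) l 1)
  (K0 : 0 <= K) (alpha0 : 0 < alpha)
  (HA : forall l, closure Om l -> forall x i j, 0 <= x -> cab ((A x l - A0 l) i j) <= K * expR (- alpha * x))
  (nuinj : forall l, closure Om l -> injective (nu ^~ l))
  (nu_mono : forall l, closure Om l -> forall i j : 'I_n, (i <= j)%N -> reC (nu i l) <= reC (nu j l))
  (cV : forall j, {within closure Om, continuous (V j)})
  (V0 : forall l, closure Om l -> forall j, V j l != 0)
  (W0 : forall l, closure Om l -> forall j, W j l != 0)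
  (AV : forall l, closure Om l -> forall j, A0 l *m V j l = nu j l *: V j l)
  (AW : forall l, closure Om l -> forall j, ctr (A0 l) *m W j l = conjc (nu j l) *: W j l)
  (HPs : forall l, closure Om l -> forall j : 'I_n, Ps l *m V j l = if (j < r)%N then V j l else 0)
  (cZ : {within closure Om, continuous Z})
  (HZ : forall l, closure Om l -> Ps l *m Z l = Z l)
  (DVx : forall l, closure Om l -> forall j x, 0 < x ->
     has_deriv (fun y => Vx j y l) x ((A x l - (nu (fst_ j) l)%:M) *m Vx j x l))
  (rVx : forall l, closure Om l -> forall j, Vx j y l @[y --> 0^'+] --> Vx j 0 l)
  (lVx : forall l, closure Om l -> forall j, Vx j y l @[y --> +oo] --> V (fst_ j) l).

(** Collects what one half line contributes to the estimates and to analyticity. The constants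
    precede L and the parameter, and [P0] carries the holomorphic information that [VL] and [Ct]
    individually do not. *)
Lemma half_line_approximation : exists c L0 : R, 0 <= c /\ 0 < L0 /\ forall L, L0 <= L ->
  exists (VL : C -> 'I_r -> R -> 'cV[C]_n) (Ct : C -> 'M[C]_r) (P0 : C -> 'M[C]_n),
  (forall l, closure Om l ->
    (forall j : 'I_r,
       bvp_plus (fun x => A x l) (nu (fst_ j) l) (V (fst_ j) l) (W (fst_ j) l) (fun k => W k l)
         j (fun k => VL l k 0) L (VL l j) /\
       forall U, bvp_plus (fun x => A x l) (nu (fst_ j) l) (V (fst_ j) l) (W (fst_ j) l)
           (fun k => W k l) j (fun k => VL l k 0) L U ->
         forall x, 0 <= x <= L -> U x = VL l j x) /\
    (forall X, cols (fun j => VL l j L) *m X = Z l <-> X = Ct l) /\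
    P0 l *m Z l = cols (fun j => VL l j 0) *m decay_mx hr (nu ^~ l) L *m Ct l /\
    cab (\det (Ct l)) <= c /\
    (forall f : 'I_r -> 'I_n, [/\ cab (\det (rowsub f (cols (fun j => Vx j 0 l)))) <= c,
        cab (\det (rowsub f (cols (fun j => VL l j 0)))) <= c &
        cab (\det (rowsub f (cols (fun j => Vx j 0 l))) - \det (rowsub f (cols (fun j => VL l j 0))))
          <= c * expR (- (alpha / 2) * L)]) /\
    forall (Zx : 'I_r -> R -> 'cV[C]_n) (Cp : 'M[C]_r),
      (forall j x, has_deriv (Zx j) x (A x l *m Zx j x)) ->
      (forall j, exists w, (1%:M - Ps l) *m w = Zx j L - col j (Z l)) ->
      cols (fun j => Vx j L l) *m Cp = cols (fun j => Zx j L) ->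
      cols (fun j => Zx j 0) = cols (fun j => Vx j 0 l) *m decay_mx hr (nu ^~ l) L *m Cp /\
      cab (\det Cp - \det (Ct l)) <= c * expR (- (alpha / 2) * L)) /\
  (forall l, Om l -> forall i j, exists d, holo_at (fun z => P0 z i j) l d).
Proof.
have uV l : closure Om l -> cols (V ^~ l) \in unitmx.
  by move=> Kl; exact: (eigenbasis_unit (nuinj Kl) (V0 Kl) (AV Kl)).
have cVm : {within closure Om, continuous (fun l => cols (V ^~ l))}.
  apply: within_mx => i j; rewrite (_ : (fun l => _) = (fun l => V j l i 0)).
    exact: (@within_coord R _ (closure Om) n 1 (V j) i 0 (@cV j)).
  by apply/funext => l; rewrite mxE.
have [k1 k10 Hk1] := @compact_cab_bounded_fin R _ (closure Om) _
  (fun (ij : 'I_n * 'I_n) l => cols (V ^~ l) ij.1 ij.2) cK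
  (fun ij => @within_coord R _ _ n n _ ij.1 ij.2 cVm).
have [k2 k20 Hk2] := @compact_cab_bounded_fin R _ (closure Om) _
  (fun (ij : 'I_n * 'I_n) l => invmx (cols (V ^~ l)) ij.1 ij.2) cK
  (fun ij => @within_coord R _ _ n n _ ij.1 ij.2 (@within_invmx R n _ _ cVm uV)).
have [cz cz0 Hcz] := @compact_cab_bounded_fin R _ (closure Om) _
  (fun (ij : 'I_n * 'I_r) l => Z l ij.1 ij.2) cK (fun ij => @within_coord R _ _ n r _ ij.1 ij.2 cZ).
pose kap := k1 + k2.
have kap0 : 0 <= kap by rewrite addr_ge0 ?(ltW k10) ?(ltW k20).
have HV l i j : closure Om l -> cab (cols (V ^~ l) i j) <= kap.
  by move=> Kl; apply: (le_trans (Hk1 (i, j) l Kl)); rewrite lerDl ltW.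
have HVi l i j : closure Om l -> cab (invmx (cols (V ^~ l)) i j) <= kap.
  by move=> Kl; apply: (le_trans (Hk2 (i, j) l Kl)); rewrite lerDr ltW.
have HZc l i j : closure Om l -> cab (Z l i j) <= cz by exact: (Hcz (i, j) l).
exists (half_const n r kap K alpha cz), (half_length n r kap K alpha).
split; first exact: half_const_ge0 kap0 (ltW cz0).
split; first exact: half_length_gt0 alpha0.
move=> L HL; have L0 : 0 < L by apply: lt_le_trans HL; exact: half_length_gt0.
have [M M0 HM] := @joint_bound R n A (closure Om) 0 L cK cA.
have [Psi [HPsi hPsi]] := half_propagator oOm cK cA dA L0.
(* The Gram-Schmidt coefficients are chosen for each parameter separately; no regularity in l is
   asserted for them. *)
have /choice[T HT] l : exists T : 'M[C]_r, closure Om l ->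
    forall k, gs_vec (Psi l 0 *m top_sub hr (cols (V ^~ l))) k (col k T).
  have [Kl|Kl] := pselect (closure Om l); last by exists 0.
  have [PL DP] := HPsi l Kl.
  have [T HT] := @gs_matrix_exists R n r hr (fun x => A x l) (A0 l) (nu ^~ l) (V ^~ l) (Psi l) L M
    L0 (ltW M0) (fun x i j xL => HM x l i j xL Kl) PL DP (nuinj Kl) (V0 Kl) (AV Kl).
  by exists T.
exists (fun l => bvp_sol hr (nu ^~ l) (V ^~ l) (Psi l) L (T l)),
  (fun l => tilde_coef hr (V ^~ l) (T l) (Z l)), (fun l => Psi l 0).
split; last exact: hPsi.
move=> l Kl; have [PL DP] := HPsi l Kl.
have HMl x i j : 0 <= x <= L -> cab (A x l i j) <= M by move=> xL; exact: HM.
have detT : \det (T l) = 1 := det_gs (HT l Kl).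
have cVx j X : {within `[0, X], continuous (fun y => Vx j y l)}.
  exact: (@within_right_limit n (fun y => Vx j y l) (fun x => (A x l - (nu (fst_ j) l)%:M) *m Vx j x l) X
    (@DVx l Kl j) (@rVx l Kl j)).
have HVl i j := HV l i j Kl; have HVil i j := HVi l i j Kl; have HZl i j := HZc l i j Kl.
split; [|split; [|split; [|split; [|split]]]].
- move=> j; split.
    exact: (bvp_sol_correct PL DP (@nuinj l Kl) (@V0 l Kl) (@AV l Kl) (@AW l Kl) (HT l Kl) j).
  move=> U HU x xL.
  exact: (bvp_sol_unique L0 (ltW M0) HMl PL DP (@nuinj l Kl) (@V0 l Kl) (@W0 l Kl) (@AV l Kl) (@AW l Kl) (HT l Kl) HU xL).
- exact: (tilde_coefP (nu := nu ^~ l) PL (@nuinj l Kl) (@V0 l Kl) (@AV l Kl) (HT l Kl) (@HPs l Kl) (HZ Kl)).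
- exact: (Psi0_Z L (@nuinj l Kl) (@V0 l Kl) (@AV l Kl) (HT l Kl) (@HPs l Kl) (HZ Kl)).
- exact: (det_tilde_coef_le K alpha kap0 (ltW cz0) hr HVil detT HZl).
- move=> f; split.
  + exact: (exact_minor_le kap0 K0 alpha0 (ltW cz0) (@nuinj l Kl) (@V0 l Kl) (@AV l Kl) HVl HVil (@HA l Kl)
      (@nu_mono l Kl) (@DVx l Kl) cVx (@lVx l Kl) f).
  + exact: (approx_minor_le kap0 K0 alpha0 (ltW cz0) L0 PL DP (@nuinj l Kl) (@V0 l Kl) (@AV l Kl) HVl HVil
      (@HA l Kl) (@nu_mono l Kl) detT (@DVx l Kl) cVx (@lVx l Kl) f).
  + exact: (minor_diff_le kap0 K0 alpha0 (ltW cz0) L0 PL DP (@nuinj l Kl) (@V0 l Kl) (@AV l Kl) HVl HVil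
      (@HA l Kl) (@nu_mono l Kl) detT (@DVx l Kl) cVx (@lVx l Kl) f).
- move=> Zx Cp DZ Zw HCp; split.
    apply: (Zx0E L0 (ltW M0) HMl PL DP (fun j => cVx j L) _ DZ HCp) => j x /andP[x0 _].
    exact: DVx.
  exact: (det_coef_diff_le kap0 K0 alpha0 (ltW cz0) L0 (@nuinj l Kl) (@V0 l Kl) (@AV l Kl) HVl HVil
      (@HA l Kl) (@nu_mono l Kl) detT (@DVx l Kl) cVx (@lVx l Kl) (@HPs l Kl) HZl Zw HCp HL).
Qed.

End HalfLinePackage.

(** * The left half line, by reflection *)

Section Reflection.
Variable R : realType.
Local Notation C := R[i].

Lemma bvp_plus_reflect n m (A : R -> 'M[C]_n) (nu : C) (Vj Wj : 'cV[C]_n) (W : 'I_n -> 'cV[C]_n)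
    (j : nat) (prev : 'I_m -> 'cV[C]_n) (L : R) (U : R -> 'cV[C]_n) :
  bvp_plus (fun x => - A (- x)) (- nu) Vj Wj W j prev L U ->
  bvp_minus A nu Vj Wj W j prev L (fun x => U (- x)).
Proof.
move=> [cU [DU [H0 [Hj Hk]]]]; split.
  have := @within_continuous_compN _ _ _ U (- L) 0; rewrite oppr0 opprK => H; exact: H cU.
split.
  move=> x xL; have xL' : 0 < - x < L by move: xL; lra.
  have := has_deriv_Nid (DU _ xL').
  rewrite opprK [(- nu)%:M]raddfN -opprD mulNmx opprK; exact.
by rewrite oppr0 opprK.
Qed.

Lemma bvp_minus_reflect n m (A : R -> 'M[C]_n) (nu : C) (Vj Wj : 'cV[C]_n) (W : 'I_n -> 'cV[C]_n)
    (j : nat) (prev : 'I_m -> 'cV[C]_n) (L : R) (U : R -> 'cV[C]_n) :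
  bvp_minus A nu Vj Wj W j prev L U ->
  bvp_plus (fun x => - A (- x)) (- nu) Vj Wj W j prev L (fun x => U (- x)).
Proof.
move=> [cU [DU [H0 [Hj Hk]]]]; split.
  have := @within_continuous_compN _ _ _ U 0 L; rewrite oppr0 => H; exact: H cU.
split.
  move=> x xL; have xL' : - L < - x < 0 by move: xL; lra.
  have := has_deriv_Nid (DU _ xL').
  rewrite [(- nu)%:M]raddfN -opprD mulNmx; exact.
by rewrite oppr0.
Qed.

Lemma within_reflect n (A : R -> C -> 'M[C]_n) (K : set C) :
  {within [set p : R * C | K p.2], continuous (fun p => A p.1 p.2)} ->
  {within [set p : R * C | K p.2], continuous (fun p => - A (- p.1) p.2)}.
Proof.
move=> /subspace_continuousP H; apply/subspace_continuousP => -[x z] /= Kz.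
apply: cvgN; apply: (@cvg_comp _ _ _ (fun p : R * C => (- p.1, p.2)) (fun p => A p.1 p.2) _ _ _ _
  (H (- x, z) Kz)).
move=> S HS; have cg : (fun p : R * C => (- p.1, p.2)) @ (x, z) --> (- x, z).
  apply: (@cvg_pair _ _ _ (nbhs (x, z)) (nbhs (- x)) (nbhs z) _ _ _ (fun p => - p.1) snd).
    exact: (cvgN cvg_fst).
  exact: cvg_snd.
by have := cg _ HS.
Qed.

Variables (n r : nat) (hr : (r <= n)%N) (Om : set C) (A : R -> C -> 'M[C]_n) (A0 : C -> 'M[C]_n)
  (nu : 'I_n -> C -> C) (V W : 'I_n -> C -> 'cV[C]_n) (Ps : C -> 'M[C]_n) (Z : C -> 'M[C]_(n, r))
  (Vx : 'I_r -> R -> C -> 'cV[C]_n) (K alpha : R).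
Local Notation fst_ j := (widen_ord hr j).
Hypotheses (oOm : open Om) (cK : compact (closure Om))
  (cA : {within [set p : R * C | closure Om p.2], continuous (fun p => A p.1 p.2)})
  (dA : forall x l, Om l -> derivable (A x) l 1)
  (K0 : 0 <= K) (alpha0 : 0 < alpha)
  (HA : forall l, closure Om l -> forall x i j, x <= 0 -> cab ((A x l - A0 l) i j) <= K * expR (alpha * x))
  (nuinj : forall l, closure Om l -> injective (nu ^~ l))
  (nu_mono : forall l, closure Om l -> forall i j : 'I_n, (i <= j)%N -> reC (nu j l) <= reC (nu i l))
  (cV : forall j, {within closure Om, continuous (V j)})
  (V0 : forall l, closure Om l -> forall j, V j l != 0)
  (W0 : forall l, closure Om l -> forall j, W j l != 0)
  (AV : forall l, closure Om l -> forall j, A0 l *m V j l = nu j l *: V j l)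
  (AW : forall l, closure Om l -> forall j, ctr (A0 l) *m W j l = conjc (nu j l) *: W j l)
  (HPs : forall l, closure Om l -> forall j : 'I_n, Ps l *m V j l = if (j < r)%N then V j l else 0)
  (cZ : {within closure Om, continuous Z})
  (HZ : forall l, closure Om l -> Ps l *m Z l = Z l)
  (DVx : forall l, closure Om l -> forall j x, x < 0 ->
     has_deriv (fun y => Vx j y l) x ((A x l - (nu (fst_ j) l)%:M) *m Vx j x l))
  (rVx : forall l, closure Om l -> forall j, Vx j y l @[y --> 0^'-] --> Vx j 0 l)
  (lVx : forall l, closure Om l -> forall j, Vx j y l @[y --> -oo] --> V (fst_ j) l).

(** Under x -> -x the coefficient becomes - A(-x) and the eigenvalues - nu, so decreasing real parts
    become increasing; eigenvectors and projections stay the same. *)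
Lemma left_half_line_approximation : exists c L0 : R, 0 <= c /\ 0 < L0 /\ forall L, L0 <= L ->
  exists (VL : C -> 'I_r -> R -> 'cV[C]_n) (Ct : C -> 'M[C]_r) (P0 : C -> 'M[C]_n),
  (forall l, closure Om l ->
    (forall j : 'I_r,
       bvp_minus (fun x => A x l) (nu (fst_ j) l) (V (fst_ j) l) (W (fst_ j) l) (fun k => W k l)
         j (fun k => VL l k 0) L (VL l j) /\
       forall U, bvp_minus (fun x => A x l) (nu (fst_ j) l) (V (fst_ j) l) (W (fst_ j) l)
           (fun k => W k l) j (fun k => VL l k 0) L U ->
         forall x, - L <= x <= 0 -> U x = VL l j x) /\
    (forall X, cols (fun j => VL l j (- L)) *m X = Z l <-> X = Ct l) /\
    P0 l *m Z l = cols (fun j => VL l j 0) *m decay_mx hr (fun j => - nu j l) L *m Ct l /\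
    cab (\det (Ct l)) <= c /\
    (forall f : 'I_r -> 'I_n, [/\ cab (\det (rowsub f (cols (fun j => Vx j 0 l)))) <= c,
        cab (\det (rowsub f (cols (fun j => VL l j 0)))) <= c &
        cab (\det (rowsub f (cols (fun j => Vx j 0 l))) - \det (rowsub f (cols (fun j => VL l j 0))))
          <= c * expR (- (alpha / 2) * L)]) /\
    forall (Zx : 'I_r -> R -> 'cV[C]_n) (Cp : 'M[C]_r),
      (forall j x, has_deriv (Zx j) x (A x l *m Zx j x)) ->
      (forall j, exists w, (1%:M - Ps l) *m w = Zx j (- L) - col j (Z l)) ->
      cols (fun j => Vx j (- L) l) *m Cp = cols (fun j => Zx j (- L)) ->
      cols (fun j => Zx j 0) = cols (fun j => Vx j 0 l) *m decay_mx hr (fun j => - nu j l) L *m Cp /\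
      cab (\det Cp - \det (Ct l)) <= c * expR (- (alpha / 2) * L)) /\
  (forall l, Om l -> forall i j, exists d, holo_at (fun z => P0 z i j) l d).
Proof.
have [|||||||||c [L0 [c0 [L00 H]]]] := @half_line_approximation R n r hr Om
  (fun x l => - A (- x) l) (fun l => - A0 l) (fun j l => - nu j l) V W Ps Z
  (fun j x l => Vx j (- x) l) K alpha oOm cK (within_reflect cA) _ K0 alpha0 _ _ _ cV V0 W0 _ _ HPs cZ HZ.
- by move=> x l Ol; apply: derivableN; exact: dA.
- move=> l Kl x i j x0; rewrite -opprD mxE cabN mulNr -mulrN.
  by apply: HA => //; rewrite oppr_le0.
- by move=> l Kl i j /oppr_inj; exact: nuinj.
- by move=> l Kl i j ij; rewrite !reCN lerN2; exact: nu_mono.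
- by move=> l Kl j; rewrite mulNmx AV// scaleNr.
- move=> l Kl j; have -> : ctr (- A0 l) = - ctr (A0 l) by apply/matrixP => a b; rewrite !mxE rmorphN.
  by rewrite mulNmx AW// rmorphN scaleNr.
- move=> l Kl j x x0; have x0' : - x < 0 by rewrite oppr_lt0.
  have := has_deriv_Nid (@DVx l Kl j _ x0').
  rewrite [(- nu _ _)%:M]raddfN -opprD mulNmx; exact.
- move=> l Kl j; rewrite oppr0.
  have := (cvg_at_leftNP (fun y => Vx j y l) 0 (Vx j 0 l)).1 (@rVx l Kl j).
  rewrite oppr0; exact.
- move=> l Kl j; exact: ((cvgNy_compNP (fun y => Vx j y l) _).1 (@lVx l Kl j)).
exists c, L0; split; [exact: c0|split; [exact: L00|]] => L HL.
have [VL [Ct [P0 [H1 H2]]]] := H L HL.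
exists (fun l j x => VL l j (- x)), Ct, P0; split; last exact: H2.
move=> l /H1[Hbvp [HCt [HP0 [Ct_le [Hmin Hex]]]]]; rewrite !oppr0 !opprK.
split; [|split; [exact: HCt|split; [exact: HP0|split; [exact: Ct_le|split]]]].
- move=> j; have [Hj Uj] := Hbvp j; split; first exact: (bvp_plus_reflect Hj).
  move=> U HU x xL; have xL' : 0 <= - x <= L by move: xL; lra.
  by have := Uj _ (bvp_minus_reflect HU) _ xL'; rewrite opprK.
- move=> f; have := Hmin f; rewrite !oppr0; exact.
move=> Zx Cp DZ Zw HCp; have := Hex (fun j x => Zx j (- x)) Cp; rewrite !oppr0; apply.
- move=> j x; have := has_deriv_Nid (DZ j (- x)); rewrite -mulNmx; exact.
- exact: Zw.
- exact: HCp.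
Qed.

End Reflection.

(** * Determinants built from the two half lines *)

Section ConcatenatedDeterminants.
Variable R : realType.
Local Notation C := R[i].

Lemma detcat_mul n r (hr : (r <= n)%N) (M : 'M[C]_(n, n - r)) (N : 'M[C]_(n, r)) X Y :
  detcat hr (M *m X) (N *m Y) = detcat hr M N * (\det X * \det Y).
Proof.
(* Generalising n - r and eliminating the equation m + r = n reduces the cast to the identity. *)
rewrite /detcat; move: (n - r)%N (subnK hr) M X => m e; case: n / e {hr} N => N M X.
rewrite !castmx_id (_ : row_mx (M *m X) (N *m Y) = row_mx M N *m block_mx X 0 0 Y).
  by rewrite det_mulmx det_ublock.
by rewrite mul_row_block !mulmx0 addr0 add0r.
Qed.

(** The Laplace expansion bounds m! r! times the difference; this factor is at least 1 and can be
    discarded. *)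
Lemma detcat_diff_le n r (hr : (r <= n)%N) (M M' : 'M[C]_(n, n - r)) (N N' : 'M[C]_(n, r)) (c d e : R) :
  (forall f, cab (\det (rowsub f M)) <= c) -> (forall f, cab (\det (rowsub f N')) <= d) ->
  (forall f, cab (\det (rowsub f M) - \det (rowsub f M')) <= c * e) ->
  (forall f, cab (\det (rowsub f N) - \det (rowsub f N')) <= d * e) ->
  cab (detcat hr M N - detcat hr M' N') <= #|'S_n|%:R * (2 * (c * d) * e).
Proof.
rewrite /detcat; move: (n - r)%N (subnK hr) M M' => m em; case: n / em {hr} N N' => N N' M M'.
rewrite !castmx_id => HM HN' HMM HNN.
set k := (m`! * r`!)%N; have k1 : (1 <= k)%N by rewrite muln_gt0 !fact_gt0.
set D := \det _ - _.
have : cab (k%:R * D) <= #|'S_(m + r)|%:R * (2 * (c * d) * e).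
  rewrite /D mulrBr !laplace_row_mx -sumrB.
  apply: le_trans (cab_sum _ _) _; rewrite mulr_natl -sumr_const; apply: ler_sum => s _.
  rewrite -mulrBr cabM cabX cabN cab1 expr1n mul1r.
  set a := \det _; set b := \det _; set a' := \det _; set b' := \det _.
  have -> : a * b - a' * b' = a * (b - b') + (a - a') * b' by ring.
  apply: le_trans (cabD _ _) _; rewrite !cabM.
  have -> : 2 * (c * d) * e = c * (d * e) + c * e * d by ring.
  by apply: lerD; apply: ler_pM; rewrite ?cab_ge0//; [exact: HM|exact: HNN|exact: HMM|exact: HN'].
apply: le_trans; rewrite cabM -[leLHS]mul1r; apply: ler_wpM2r; first exact: cab_ge0.
have -> : (k%:R : C) = rC k%:R by rewrite /rC rmorph_nat.
by rewrite cab_rC ger0_norm ?ler0n// ler1n.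
Qed.

Lemma cab_detcat_le n r (hr : (r <= n)%N) (M : 'M[C]_(n, n - r)) (N : 'M[C]_(n, r)) (c d : R) :
  (forall f, cab (\det (rowsub f M)) <= c) -> (forall f, cab (\det (rowsub f N)) <= d) ->
  cab (detcat hr M N) <= #|'S_n|%:R * (c * d).
Proof.
rewrite /detcat; move: (n - r)%N (subnK hr) M => m em; case: n / em {hr} N => N M.
rewrite castmx_id => HM HN.
set k := (m`! * r`!)%N; have k1 : (1 <= k)%N by rewrite muln_gt0 !fact_gt0.
set D := \det _.
have : cab (k%:R * D) <= #|'S_(m + r)|%:R * (c * d).
  rewrite /D laplace_row_mx.
  apply: le_trans (cab_sum _ _) _; rewrite mulr_natl -sumr_const; apply: ler_sum => s _.
  rewrite cabM cabX cabN cab1 expr1n mul1r cabM.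
  by apply: ler_pM; [exact: cab_ge0|exact: cab_ge0|exact: HM|exact: HN].
apply: le_trans; rewrite cabM -[leLHS]mul1r; apply: ler_wpM2r; first exact: cab_ge0.
have -> : (k%:R : C) = rC k%:R by rewrite /rC rmorph_nat.
by rewrite cab_rC ger0_norm ?ler0n// ler1n.
Qed.

Lemma cexp_sum (I : finType) (F : I -> C) : \prod_i cexp (F i) = cexp (\sum_i F i).
Proof. by apply/esym; apply: (big_morph (@cexp R)); [exact: cexpD|exact: cexp0]. Qed.

Lemma det_decay n r (hr : (r <= n)%N) (nu : 'I_n -> C) L :
  \det (decay_mx hr nu L) = cexp (- (\sum_(j < r) nu (widen_ord hr j)) * rC L).
Proof.
rewrite det_diag -sumrN mulr_suml -cexp_sum; apply: eq_bigr => j _.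
by rewrite mxE mulNr.
Qed.

Lemma holo_det n (M : C -> 'M[C]_n) z : (forall i j, exists d, holo_at (fun w => M w i j) z d) ->
  exists d, holo_at (fun w => \det (M w)) z d.
Proof.
move=> HM; have Hs (s : 'S_n) : exists d, holo_at (fun w => (-1) ^+ s * \prod_i M w i (s i)) z d.
  have [d Hd] := @holo_prod R _ (index_enum 'I_n) (fun i w => M w i (s i)) z (fun i => HM i (s i)).
  by exists ((-1) ^+ s * d); exact: (holoZ ((-1) ^+ s) Hd).
have /choice[d Hd] := Hs.
by exists (\sum_s d s); exact: (@holo_sum R _ (index_enum 'S_n) (fun s w => (-1) ^+ s * \prod_i M w i (s i)) z d Hd).
Qed.

Lemma holo_detcat n r (hr : (r <= n)%N) (M : C -> 'M[C]_(n, n - r)) (N : C -> 'M[C]_(n, r)) z :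
  (forall i j, exists d, holo_at (fun w => M w i j) z d) ->
  (forall i j, exists d, holo_at (fun w => N w i j) z d) ->
  exists d, holo_at (fun w => detcat hr (M w) (N w)) z d.
Proof.
rewrite /detcat; move: (n - r)%N (subnK hr) M => m em; case: n / em {hr} N => N M HM HN.
apply: holo_det => i j.
have [k ->|k ->] := split_ordP j.
  have [d Hd] := HM i k; exists d.
  rewrite (_ : (fun w => _) = (fun w => M w i k)); first exact: Hd.
  by apply/funext => w; rewrite castmx_id row_mxEl.
have [d Hd] := HN i k; exists d.
rewrite (_ : (fun w => _) = (fun w => N w i k)); first exact: Hd.
by apply/funext => w; rewrite castmx_id row_mxEr.
Qed.

Lemma holo_mulmx m n p (M : C -> 'M[C]_(m, n)) (N : C -> 'M[C]_(n, p)) z :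
  (forall i j, exists d, holo_at (fun w => M w i j) z d) ->
  (forall i j, exists d, holo_at (fun w => N w i j) z d) ->
  forall i j, exists d, holo_at (fun w => (M w *m N w) i j) z d.
Proof.
move=> HM HN i j.
have /choice[d Hd] k : exists d, holo_at (fun w => M w i k * N w k j) z d.
  by have [a Ha] := HM i k; have [b Hb] := HN k j; eexists; exact: (holoM Ha Hb).
exists (\sum_k d k); rewrite (_ : (fun w => _) = (fun w => \sum_k M w i k * N w k j)).
  exact: (@holo_sum R _ (index_enum 'I_n) (fun k w => M w i k * N w k j) z d Hd).
by apply/funext => w; rewrite mxE.
Qed.

Lemma holo_eq_near (f g : C -> C) z d : (\forall w \near z, f w = g w) -> holo_at g z d -> holo_at f z d.
Proof.
move=> fg /holo_atP Hg; have [e e0 He] := near_cab_ex fg.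
apply/holo_atP => eps eps0; have [dl dl0 Hd] := Hg _ eps0.
exists (Num.min dl e) => [|w]; first by rewrite lt_min dl0.
rewrite lt_min => /andP[/Hd wd /He ->].
by rewrite (He z)// subrr cab0.
Qed.

End ConcatenatedDeterminants.

(** * Combination of the half-line estimates into the Evans function estimate *)

Section Assembly.
Variable R : realType.
Local Notation C := R[i].

Lemma within_open_for (Om : set C) (f : C -> C) z : open Om -> Om z ->
  {within closure Om, continuous f} -> {for z, continuous f}.
Proof.
move=> oOm Oz /subspace_continuousP cf S HS.
have nO : nbhs z Om by exact: open_nbhs_nbhs.
have H := cf z (subset_closure Oz) S HS.
apply: (@filterS2 _ (nbhs z) (nbhs_filter z) _ _ _ _ nO H) => w Ow Sw.
by apply: Sw; exact: subset_closure.
Qed.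

(** Distinct eigenvalues make the left and right eigenvectors pair to a nonzero number, which is
    what [eigenvalue_holo] needs. *)
Lemma holo_eigen_factor n r (hr : (r <= n)%N) (Om : set C) (A : C -> 'M[C]_n) (nu : 'I_n -> C -> C)
    (V W : 'I_n -> C -> 'cV[C]_n) (L : R) z : open Om -> Om z ->
  derivable A z 1 -> (forall j, {within closure Om, continuous (V j)}) ->
  (forall l, closure Om l -> injective (nu ^~ l)) ->
  (forall l, closure Om l -> forall j, V j l != 0) ->
  (forall l, closure Om l -> forall j, W j l != 0) ->
  (forall l, closure Om l -> forall j, A l *m V j l = nu j l *: V j l) ->
  (forall l, closure Om l -> forall j, ctr (A l) *m W j l = conjc (nu j l) *: W j l) ->
  exists d, holo_at (fun l => cexp ((\sum_(j < r) nu (widen_ord hr j) l) * rC L)) z d.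
Proof.
move=> oOm Oz dA cV nuinj V0 W0 AV AW.
have Kz : closure Om z by exact: subset_closure.
have hnu j : exists d, holo_at (nu j) z d.
  apply: (@eigenvalue_holo R n A (nu j) (V j) (W j z) z).
  - exact: derivable_mx_holo.
  - have nO : nbhs z Om by exact: open_nbhs_nbhs.
    apply: (@filterS _ (nbhs z) (nbhs_filter z) _ _ _ nO) => w Ow.
    by apply: AV; exact: subset_closure.
  - move=> i; apply: (within_open_for oOm Oz).
    exact: (@within_coord R _ (closure Om) n 1 (V j) i 0 (cV j)).
  - exact: AW.
  - exact: (eigen_pairing_neq0 (@nuinj z Kz) (V0 z Kz) (W0 z Kz) (AV z Kz) (AW z Kz)).
have /choice[d Hd] := fun j : 'I_r => hnu (widen_ord hr j).
have Hs := @holo_sum R _ (index_enum 'I_r) (fun j => nu (widen_ord hr j)) z d Hd.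
have Hm := holoM Hs (holo_cst (rC L) z).
eexists; exact: (@holo_comp R (@cexp R) (fun l => (\sum_(j < r) nu (widen_ord hr j) l) * rC L) z _ _ Hm
  (holo_cexp _)).
Qed.

(** The terms bound in turn the error of the determinant, that of the coefficients, and that of
    their product, with 5 = 3 + 2; the 1 ensures positivity. *)
Definition evans_const (n : nat) (q : R) : R :=
  2 * (#|'S_n|%:R * q) + 3 * q + 5 * (#|'S_n|%:R * q ^+ 2) + 1.

(** The scalars sm and sp cancel the decay determinants, so the exact Evans function factors as the
    determinant times the coefficient product, and the product rule for errors applies. *)
Lemma evans_error n r (hr : (r <= n)%N) (Vm VLm Zm : 'M[C]_(n, n - r)) (Vp VLp Zp : 'M[C]_(n, r))
    (Dm Cm Ctm : 'M[C]_(n - r)) (Dp Cp Ctp : 'M[C]_r) (sm sp : C) (cm cp e : R) :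
  0 <= cm -> 0 <= cp -> 0 <= e -> e <= 1 ->
  Zm = Vm *m Dm *m Cm -> Zp = Vp *m Dp *m Cp -> \det Dm * sm = 1 -> \det Dp * sp = 1 ->
  cab (\det Ctm) <= cm -> cab (\det Ctp) <= cp ->
  cab (\det Cm - \det Ctm) <= cm * e -> cab (\det Cp - \det Ctp) <= cp * e ->
  (forall f, [/\ cab (\det (rowsub f Vm)) <= cm, cab (\det (rowsub f VLm)) <= cm &
     cab (\det (rowsub f Vm) - \det (rowsub f VLm)) <= cm * e]) ->
  (forall f, [/\ cab (\det (rowsub f Vp)) <= cp, cab (\det (rowsub f VLp)) <= cp &
     cab (\det (rowsub f Vp) - \det (rowsub f VLp)) <= cp * e]) ->
  `|detcat hr Vm Vp - detcat hr VLm VLp| + `|\det Cp * \det Cm - \det Ctm * \det Ctp|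
     <= rC (evans_const n (cm * cp) * e) /\
  `|detcat hr Zm Zp * sm * sp - detcat hr VLm VLp * (\det Ctm * \det Ctp)|
     <= rC (evans_const n (cm * cp) * e).
Proof.
move=> cm0 cp0 e0 e1 -> -> Dm1 Dp1 Ctm_le Ctp_le Cm_d Cp_d Hm Hp.
rewrite detcat_mul detcat_mul.
set E := detcat hr Vm Vp; set EL := detcat hr VLm VLp.
set q := cm * cp; set N : R := #|'S_n|%:R.
have q0 : 0 <= q by rewrite mulr_ge0.
have N0 : 0 <= N by rewrite ler0n.
have E_le : cab E <= N * q.
  by apply: cab_detcat_le => f; [have [] := Hm f|have [] := Hp f].
have E_d : cab (E - EL) <= N * (2 * q * e).
  by apply: detcat_diff_le => f; [have [] := Hm f|have [] := Hp f|have [] := Hm f|have [] := Hp f].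
have Ct_le : cab (\det Ctm * \det Ctp) <= q by rewrite cabM; apply: ler_pM; rewrite ?cab_ge0.
have C_d : cab (\det Cp * \det Cm - \det Ctm * \det Ctp) <= 3 * q * e.
  (* The first summand is quadratic in the error; [e <= 1] makes it no larger than the linear
     ones. *)
  have -> : \det Cp * \det Cm - \det Ctm * \det Ctp =
      (\det Cp - \det Ctp) * (\det Cm - \det Ctm) + (\det Cp - \det Ctp) * \det Ctm +
      (\det Cm - \det Ctm) * \det Ctp by ring.
  apply: le_trans (cabD _ _) _; rewrite cabM.
  have -> : 3 * q * e = (cp * e * cm + cp * e * cm) + cm * e * cp by rewrite /q; ring.
  apply: lerD; last by apply: ler_pM; rewrite ?cab_ge0.
  apply: le_trans (cabD _ _) _; rewrite !cabM.
  apply: lerD; last by apply: ler_pM; rewrite ?cab_ge0.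
  apply: ler_pM; rewrite ?cab_ge0//.
  by apply: (le_trans Cm_d); exact: ler_piMr.
have Nq0 : 0 <= N * q * e by rewrite !mulr_ge0.
have qe0 : 0 <= q * e by rewrite mulr_ge0.
have Nqq0 : 0 <= N * q ^+ 2 * e by rewrite !mulr_ge0.
split.
  rewrite !cabE -rCD rC_le; apply: (le_trans (lerD E_d C_d)).
  by rewrite /evans_const -/N; lra.
have -> : E * (\det Dm * \det Dp) * (\det Cm * \det Cp) * sm * sp - EL * (\det Ctm * \det Ctp) =
    E * (\det Cp * \det Cm - \det Ctm * \det Ctp) + (E - EL) * (\det Ctm * \det Ctp).
  have -> : E * (\det Dm * \det Dp) * (\det Cm * \det Cp) * sm * sp =
     E * (\det Dm * sm) * (\det Dp * sp) * (\det Cm * \det Cp) by ring.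
  rewrite Dm1 Dp1; ring.
rewrite cabE rC_le; apply: le_trans (cabD _ _) _; rewrite [cab (E * _)]cabM [cab ((E - EL) * _)]cabM.
apply: (@le_trans _ _ (N * q * (3 * q * e) + N * (2 * q * e) * q)).
  apply: lerD; apply: ler_pM; rewrite ?cab_ge0//.
by rewrite /evans_const -/N; lra.
Qed.

End Assembly.

(** * Convergence and analyticity of the approximate Evans function *)

Theorem theorem1 (R : realType) (n r : nat) (hr : (r <= n)%N)
  (Om : set R[i])
  (A : R -> R[i] -> 'M[R[i]]_n) (Ap Am : R[i] -> 'M[R[i]]_n)
  (nup num : 'I_n -> R[i] -> R[i])
  (Vp Wp Vm Wm : 'I_n -> R[i] -> 'cV[R[i]]_n)
  (Psp Pum : R[i] -> 'M[R[i]]_n)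
  (Zp : R[i] -> 'M[R[i]]_(n, r)) (Zm : R[i] -> 'M[R[i]]_(n, n - r))
  (Vxp : 'I_r -> R -> R[i] -> 'cV[R[i]]_n)
  (Vxm : 'I_(n - r) -> R -> R[i] -> 'cV[R[i]]_n) :
  (* (H1): Omega open, bounded, simply connected *)
  open Om -> bounded_set Om -> simply_connected Om ->
  (* (H1)(i): continuity on R x closure Omega, analyticity in Omega *)
  {within [set p : R * R[i] | closure Om p.2], continuous (fun p => A p.1 p.2)} ->
  {within closure Om, continuous Ap} ->
  {within closure Om, continuous Am} ->
  (forall x l, Om l -> derivable (A x) l 1) ->
  (forall l, Om l -> derivable Ap l 1) ->
  (forall l, Om l -> derivable Am l 1) ->
  (* (H1)(ii): exponential convergence, uniformly in lambda *)
  (exists K alpha : R, 0 < K /\ 0 < alpha /\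
     forall x l, closure Om l ->
       (0 <= x -> `|A x l - Ap l| <= rC (K * expR (- alpha * x))) /\
       (x <= 0 -> `|A x l - Am l| <= rC (K * expR (alpha * x)))) ->
  (* (H1)(iii), (H2): eigenvalues of A_+, simple, ordered by increasing real
     part, hyperbolic, exactly r (indices j < r) with negative real part *)
  (forall j, {within closure Om, continuous (nup j)}) ->
  (forall l, closure Om l ->
     char_poly (Ap l) = \prod_(j < n) ('X - (nup j l)%:P) /\
     injective (nup ^~ l) /\
     (forall i j : 'I_n, (i <= j)%N -> reC (nup i l) <= reC (nup j l)) /\
     (forall j : 'I_n, (reC (nup j l) < 0) = (j < r)%N) /\
     (forall j : 'I_n, reC (nup j l) != 0)) ->
  (* eigenvalues of A_-, simple, ordered by decreasing real part, hyperbolic,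
     exactly r with negative real part (indices j < n - r have positive) *)
  (forall j, {within closure Om, continuous (num j)}) ->
  (forall l, closure Om l ->
     char_poly (Am l) = \prod_(j < n) ('X - (num j l)%:P) /\
     injective (num ^~ l) /\
     (forall i j : 'I_n, (i <= j)%N -> reC (num j l) <= reC (num i l)) /\
     (forall j : 'I_n, (0 < reC (num j l)) = (j < n - r)%N) /\
     (forall j : 'I_n, reC (num j l) != 0)) ->
  (* continuously varying eigenvectors of A_pm and of A_pm^* *)
  (forall j, {within closure Om, continuous (Vp j)}) ->
  (forall j, {within closure Om, continuous (Wp j)}) ->
  (forall j, {within closure Om, continuous (Vm j)}) ->
  (forall j, {within closure Om, continuous (Wm j)}) ->
  (forall j l, closure Om l ->
     Vp j l != 0 /\ Ap l *m Vp j l = nup j l *: Vp j l /\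
     Wp j l != 0 /\ ctr (Ap l) *m Wp j l = conjc (nup j l) *: Wp j l /\
     Vm j l != 0 /\ Am l *m Vm j l = num j l *: Vm j l /\
     Wm j l != 0 /\ ctr (Am l) *m Wm j l = conjc (num j l) *: Wm j l) ->
  (* spectral projections P^s_+ and P^u_- *)
  (forall l, closure Om l -> forall j : 'I_n,
     Psp l *m Vp j l = (if (j < r)%N then Vp j l else 0) /\
     Pum l *m Vm j l = (if (j < n - r)%N then Vm j l else 0)) ->
  (* bases Z^pm of Rg P^s_+ and Rg P^u_-, analytic in Omega, continuous on
     its closure *)
  (forall l, Om l -> derivable Zp l 1) ->
  (forall l, Om l -> derivable Zm l 1) ->
  {within closure Om, continuous Zp} ->
  {within closure Om, continuous Zm} ->
  (forall l, closure Om l ->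
     Psp l *m Zp l = Zp l /\ \rank (Zp l) = r /\
     Pum l *m Zm l = Zm l /\ \rank (Zm l) = (n - r)%N) ->
  (* the solutions V^+_j(x,lambda), x >= 0 *)
  (forall (j : 'I_r) x, 0 <= x -> {within closure Om, continuous (Vxp j x)}) ->
  (forall (j : 'I_r) l, closure Om l ->
     (forall x, 0 < x -> has_deriv (fun y => Vxp j y l) x
        ((A x l - (nup (widen_ord hr j) l)%:M) *m Vxp j x l)) /\
     Vxp j y l @[y --> 0^'+] --> Vxp j 0 l /\
     Vxp j y l @[y --> +oo] --> Vp (widen_ord hr j) l) ->
  (* the solutions V^-_j(x,lambda), x <= 0 *)
  (forall (j : 'I_(n - r)) x, x <= 0 -> {within closure Om, continuous (Vxm j x)}) ->
  (forall (j : 'I_(n - r)) l, closure Om l ->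
     (forall x, x < 0 -> has_deriv (fun y => Vxm j y l) x
        ((A x l - (num (widen_ord (leq_subr r n) j) l)%:M) *m Vxm j x l)) /\
     Vxm j y l @[y --> 0^'-] --> Vxm j 0 l /\
     Vxm j y l @[y --> -oo] --> Vm (widen_ord (leq_subr r n) j) l) ->
  (* CONCLUSION *)
  exists eta c L0 : R, 0 < eta /\ 0 < c /\ 0 < L0 /\
  forall L : R, L0 <= L ->
  exists (VLp : R[i] -> 'I_r -> R -> 'cV[R[i]]_n)
         (VLm : R[i] -> 'I_(n - r) -> R -> 'cV[R[i]]_n)
         (Ctp : R[i] -> 'M[R[i]]_r) (Ctm : R[i] -> 'M[R[i]]_(n - r)),
    (forall l, closure Om l ->
      (* (BVP^+_j) successively uniquely solvable, VLp l j its solution *)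
      (forall j : 'I_r,
         bvp_plus (fun x => A x l) (nup (widen_ord hr j) l)
           (Vp (widen_ord hr j) l) (Wp (widen_ord hr j) l) (fun k => Wp k l)
           j (fun k => VLp l k 0) L (VLp l j) /\
         forall V, bvp_plus (fun x => A x l) (nup (widen_ord hr j) l)
           (Vp (widen_ord hr j) l) (Wp (widen_ord hr j) l) (fun k => Wp k l)
           j (fun k => VLp l k 0) L V ->
         forall x, 0 <= x <= L -> V x = VLp l j x) /\
      (* (BVP^-_j) successively uniquely solvable, VLm l j its solution *)
      (forall j : 'I_(n - r),
         bvp_minus (fun x => A x l) (num (widen_ord (leq_subr r n) j) l)
           (Vm (widen_ord (leq_subr r n) j) l) (Wm (widen_ord (leq_subr r n) j) l)
           (fun k => Wm k l) j (fun k => VLm l k 0) L (VLm l j) /\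
         forall V, bvp_minus (fun x => A x l) (num (widen_ord (leq_subr r n) j) l)
           (Vm (widen_ord (leq_subr r n) j) l) (Wm (widen_ord (leq_subr r n) j) l)
           (fun k => Wm k l) j (fun k => VLm l k 0) L V ->
         forall x, - L <= x <= 0 -> V x = VLm l j x) /\
      (* tilde C^pm_L(lambda) uniquely determined *)
      (forall X, cols (fun j => VLp l j L) *m X = Zp l <-> X = Ctp l) /\
      (forall X, cols (fun j => VLm l j (- L)) *m X = Zm l <-> X = Ctm l) /\
      (* error estimates against the exact quantities *)
      (forall (Zxp : 'I_r -> R -> 'cV[R[i]]_n) (Zxm : 'I_(n - r) -> R -> 'cV[R[i]]_n)
              (Cp : 'M[R[i]]_r) (Cm : 'M[R[i]]_(n - r)),
         Zplus_def (fun x => A x l) (Psp l) (Zp l) L Zxp ->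
         Zminus_def (fun x => A x l) (Pum l) (Zm l) L Zxm ->
         cols (fun j => Vxp j L l) *m Cp = cols (fun j => Zxp j L) ->
         cols (fun j => Vxm j (- L) l) *m Cm = cols (fun j => Zxm j (- L)) ->
         `|detcat hr (cols (fun j => Vxm j 0 l)) (cols (fun j => Vxp j 0 l))
           - detcat hr (cols (fun j => VLm l j 0)) (cols (fun j => VLp l j 0))|
         + `|\det Cp * \det Cm - \det (Ctm l) * \det (Ctp l)|
           <= rC (c * expR (- eta * L)) /\
         `|detcat hr (cols (fun j => Zxm j 0)) (cols (fun j => Zxp j 0))
             * cexp (- \tr (Am l *m Pum l) * rC L) * cexp (\tr (Ap l *m Psp l) * rC L)
           - detcat hr (cols (fun j => VLm l j 0)) (cols (fun j => VLp l j 0))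
             * (\det (Ctm l) * \det (Ctp l))|
           <= rC (c * expR (- eta * L)))) /\
    (* tilde E_L is analytic in Omega *)
    (forall l, Om l ->
       derivable (fun mu => detcat hr (cols (fun j => VLm mu j 0)) (cols (fun j => VLp mu j 0))
                            * (\det (Ctm mu) * \det (Ctp mu))) l 1).
Proof.
move=> oOm bOm _ cA _ _ dA dAp dAm [K [alpha [K0 [alpha0 HA]]]] _ Hnup _ Hnum cVp cWp cVm cWm HVW HPs
  dZp dZm cZp cZm HZ _ HVxp _ HVxm.
have cK : compact (closure Om) := compact_closure bOm.
have inp l (Kl : closure Om l) : injective (nup ^~ l) by have [_ []] := Hnup l Kl.
have inm l (Kl : closure Om l) : injective (num ^~ l) by have [_ []] := Hnum l Kl.
have Vp0 l (Kl : closure Om l) j : Vp j l != 0 by have [] := HVW j l Kl.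
have AVp l (Kl : closure Om l) j : Ap l *m Vp j l = nup j l *: Vp j l by have [_ []] := HVW j l Kl.
have Wp0 l (Kl : closure Om l) j : Wp j l != 0 by have [_ [_ []]] := HVW j l Kl.
have AWp l (Kl : closure Om l) j : ctr (Ap l) *m Wp j l = conjc (nup j l) *: Wp j l.
  by have [_ [_ [_ []]]] := HVW j l Kl.
have Vm0 l (Kl : closure Om l) j : Vm j l != 0 by have [_ [_ [_ [_ []]]]] := HVW j l Kl.
have AVm l (Kl : closure Om l) j : Am l *m Vm j l = num j l *: Vm j l.
  by have [_ [_ [_ [_ [_ []]]]]] := HVW j l Kl.
have Wm0 l (Kl : closure Om l) j : Wm j l != 0 by have [_ [_ [_ [_ [_ [_ []]]]]]] := HVW j l Kl.
have AWm l (Kl : closure Om l) j : ctr (Am l) *m Wm j l = conjc (num j l) *: Wm j l.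
  by have [_ [_ [_ [_ [_ [_ [_]]]]]]] := HVW j l Kl.
have PVp l (Kl : closure Om l) (j : 'I_n) : Psp l *m Vp j l = if (j < r)%N then Vp j l else 0.
  by have [] := HPs l Kl j.
have PVm l (Kl : closure Om l) (j : 'I_n) : Pum l *m Vm j l = if (j < n - r)%N then Vm j l else 0.
  by have [] := HPs l Kl j.
have [||||||cp [Lp [cp0 [Lp0 Hp]]]] := @half_line_approximation R n r hr Om A Ap nup Vp Wp Psp Zp Vxp
  K alpha oOm cK cA dA (ltW K0) alpha0 _ inp _ cVp Vp0 Wp0 AVp AWp PVp cZp _ _ _ _.
- move=> l Kl x i j x0; apply: (mxnorm_leP (A x l - Ap l) _).1; first by rewrite mulr_ge0 ?expR_ge0 ?ltW.
  by have [H _] := HA x l Kl; exact: H.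
- by move=> l Kl; have [_ [_ []]] := Hnup l Kl.
- by move=> l Kl; have [] := HZ l Kl.
- by move=> l Kl j x x0; have [H _] := HVxp j l Kl; exact: H.
- by move=> l Kl j; have [_ [H _]] := HVxp j l Kl; exact: H.
- by move=> l Kl j; have [_ [_ H]] := HVxp j l Kl; exact: H.
have [||||||cm [Lm [cm0 [Lm0 Hm]]]] := @left_half_line_approximation R n (n - r) (leq_subr r n) Om A Am
  num Vm Wm Pum Zm Vxm K alpha oOm cK cA dA (ltW K0) alpha0 _ inm _ cVm Vm0 Wm0 AVm AWm PVm cZm _ _ _ _.
- move=> l Kl x i j x0; apply: (mxnorm_leP (A x l - Am l) _).1; first by rewrite mulr_ge0 ?expR_ge0 ?ltW.
  by have [_ H] := HA x l Kl; exact: H.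
- by move=> l Kl; have [_ [_ []]] := Hnum l Kl.
- by move=> l Kl; have [_ [_ []]] := HZ l Kl.
- by move=> l Kl j x x0; have [H _] := HVxm j l Kl; exact: H.
- by move=> l Kl j; have [_ [H _]] := HVxm j l Kl; exact: H.
- by move=> l Kl j; have [_ [_ H]] := HVxm j l Kl; exact: H.
(* Both half lines have the error rate alpha / 2; the larger of the two threshold lengths serves
   both. *)
exists (alpha / 2), (evans_const n (cm * cp)), (Num.max Lp Lm).
split; first by rewrite divr_gt0.
split.
  have q0 : 0 <= cm * cp by rewrite mulr_ge0.
  rewrite /evans_const ltr_wpDl// !addr_ge0// !mulr_ge0//.
split; first by rewrite lt_max Lp0.
move=> L; rewrite ge_max => /andP[Lp_le Lm_le].
have L0 : 0 < L := lt_le_trans Lp0 Lp_le.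
have [VLp [Ctp [P0p [H1p holop]]]] := Hp L Lp_le.
have [VLm [Ctm [P0m [H1m holom]]]] := Hm L Lm_le.
exists VLp, VLm, Ctp, Ctm.
(* The trace factor is the exponential of the leading eigenvalue sum, the inverse of the determinant
   of [decay_mx]. *)
have detp l : closure Om l -> \det (decay_mx hr (nup ^~ l) L) * cexp (\tr (Ap l *m Psp l) * rC L) = 1.
  move=> Kl; rewrite det_decay -cexpD (trace_spectral (@inp l Kl) (Vp0 l Kl) (AVp l Kl) hr (PVp l Kl)).
  by rewrite mulNr addNr cexp0.
have detm l : closure Om l -> \det (decay_mx (leq_subr r n) (fun j => - num j l) L) *
    cexp (- \tr (Am l *m Pum l) * rC L) = 1.
  move=> Kl; rewrite det_decay -cexpD.
  rewrite (trace_spectral (@inm l Kl) (Vm0 l Kl) (AVm l Kl) (leq_subr r n) (PVm l Kl)).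
  by rewrite sumrN opprK mulNr addrN cexp0.
split=> [l Kl|l Ol].
  have [Bp [Xp [P0Zp [Ctp_le [Mp Ep]]]]] := H1p l Kl.
  have [Bm [Xm [P0Zm [Ctm_le [Mm Em]]]]] := H1m l Kl.
  split; [exact: Bp|split; [exact: Bm|split; [exact: Xp|split; [exact: Xm|]]]].
  move=> Zxp Zxm Cp Cm HZxp HZxm HCp HCm.
  have [Zp0 Cp_d] := Ep Zxp Cp (fun j => (HZxp j).1) (fun j => (HZxp j).2.2) HCp.
  have [Zm0 Cm_d] := Em Zxm Cm (fun j => (HZxm j).1) (fun j => (HZxm j).2.2) HCm.
  have ex1 : expR (- (alpha / 2) * L) <= 1.
    by rewrite -[leRHS]expR0 ler_expR mulNr oppr_le0 mulr_ge0 ?divr_ge0 ?ltW.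
  exact: (evans_error hr cm0 cp0 (expR_ge0 _) ex1 Zm0 Zp0 (detm l Kl) (detp l Kl) Ctm_le Ctp_le
    Cm_d Cp_d Mm Mp).
(* Each factor is holomorphic by itself; the exponentials undo the determinants of the two decay
   matrices, so that on Om this is the approximate Evans function. *)
pose G mu := detcat hr (P0m mu *m Zm mu) (P0p mu *m Zp mu) *
  (cexp ((\sum_(j < n - r) - num (widen_ord (leq_subr r n) j) mu) * rC L) *
   cexp ((\sum_(j < r) nup (widen_ord hr j) mu) * rC L)).
have HG : exists d, holo_at G l d.
  have [d1 Hd1] := @holo_detcat R n r hr (fun mu => P0m mu *m Zm mu) (fun mu => P0p mu *m Zp mu) l
    (holo_mulmx (holom l Ol) (derivable_mx_holo (dZm l Ol)))
    (holo_mulmx (holop l Ol) (derivable_mx_holo (dZp l Ol))).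
  have [d2 Hd2] := holo_eigen_factor hr L oOm Ol (dAp l Ol) cVp inp Vp0 Wp0 AVp AWp.
  (* The left half line enters through - A_-, whose eigenvalues are the negated ones, in agreement
     with the reflection. *)
  have [|||d3 Hd3] := @holo_eigen_factor R n (n - r) (leq_subr r n) Om (fun l => - Am l)
    (fun j l => - num j l) Vm Wm L l oOm Ol (derivableN (dAm l Ol)) cVm _ Vm0 Wm0 _ _.
  - by move=> w Kw i j /oppr_inj; exact: inm.
  - by move=> w Kw j; rewrite mulNmx AVm// scaleNr.
  - move=> w Kw j; have -> : ctr (- Am w) = - ctr (Am w) by apply/matrixP => a b; rewrite !mxE rmorphN.
    by rewrite mulNmx AWm// rmorphN scaleNr.
  eexists; exact: (holoM Hd1 (holoM Hd3 Hd2)).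
have [d Hd] := HG; apply: (@holo_derivable R _ l d); apply: holo_eq_near Hd.
have nO : nbhs l Om by exact: open_nbhs_nbhs.
apply: (@filterS _ (nbhs l) (nbhs_filter l) _ _ _ nO) => mu Omu.
have Kmu : closure Om mu by exact: subset_closure.
have [_ [_ [P0Zp _]]] := H1p mu Kmu; have [_ [_ [P0Zm _]]] := H1m mu Kmu.
rewrite /G P0Zp P0Zm !detcat_mul !det_decay !sumrN opprK !mulNr.
set E := detcat _ _ _; set a := _ * rC L; set b := _ * rC L.
have cexpK z : cexp z * cexp (- z) = 1 :> R[i] by rewrite -cexpD addrN cexp0.
have -> : E * (cexp b * cexp (- a)) * (\det (Ctm mu) * \det (Ctp mu)) * (cexp (- b) * cexp a) =
    E * (\det (Ctm mu) * \det (Ctp mu)) * (cexp a * cexp (- a)) * (cexp b * cexp (- b)) by ring.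
by rewrite !cexpK !mulr1.
Qed.
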